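(* Let $F\colon\mathbb D\rightsquigarrow\mathbb E$ be a twisted normal lax functor between double categories. (i) When $\mathbb D$ has companions, there is a twisted pseudo functor $\mathbb F\colon\mathbb D\rightsquigarrow\mathrm{Sq}(\mathbf{TwoCat}(\mathbb E))$ that agrees with $F$ on objects and proarrows and acts on arrows as $\mathbb F(f)=F(f_!)$. (ii) When $\mathbb D$ has conjoints, there is a twisted pseudo functor $\mathbb F\colon\mathbb D^{\mathrm{op}}\rightsquigarrow\mathrm{Sq}(\mathbf{TwoCat}(\mathbb E^{\mathrm{co}}))$ that agrees with $F$ on objects and proarrows and acts on arrows as $\mathbb F(f)=F(f^* )$. (iii) When $\mathbb D$ is an equipment, there is a twisted pseudo functor $\mathbb F\colon\mathbb D\rightsquigarrow\mathrm{Adj}(\mathbf{TwoCat}(\mathbb E))$ that agrees with $F$ on objects and proarrows and acts on arrows as $\mathbb F(f)=(F(f_!)\dashv F(f^* ))$.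
   Context: Conventions. A double category $\mathbb D$ means a pseudo double category: a category $\mathbb D_0$ of objects and arrows (tight morphisms), a category $\mathbb D_1$ of proarrows (loose morphisms, written $m\colon x\nrightarrow y$) and cells, functors $\mathrm{src},\mathrm{tgt}\colon\mathbb D_1\to\mathbb D_0$, loose composition $\odot$ (in diagrammatic order) and loose identities $\mathrm{id}_x$, with coherent invertible associators and unitors (usually elided). Composition in $\mathbb D_0$ and $\mathbb D_1$ is tight composition, written in diagrammatic order $f\cdot g=g\circ f$, $\alpha\cdot\beta$. $\alpha\colon(f\mid m\to n\mid g)$ denotes a cell with left arrow $f=\mathrm{src}\,\alpha$, top proarrow $m$, bottom proarrow $n$, right arrow $g=\mathrm{tgt}\,\alpha$; $1_m$ is the identity cell of $m$ for $\cdot$ and $\mathrm{id}_f$ the identity cell of $f$ for $\odot$. A cell is tightly globular if its left and right arrows are identities, loosely globular if its top and bottom proarrows are loose identities. $\mathbb D^{\mathrm{op}}$ reverses arrows, $\mathbb D^{\mathrm{co}}$ reverses proarrows. Twisted functors. A twisted doubly lax functor $F\colon\mathbb D\rightsquigarrow\mathbb E$ assigns to each object $x$ an object $Fx$; to each arrow $f\colon x\to y$ a proarrow $Ff\colon Fx\nrightarrow Fy$; to each proarrow $m\colon x\nrightarrow y$ an arrow $Fm\colon Fx\to Fy$; to each cell $\alpha\colon(f\mid m\to n\mid g)$ a cell $F\alpha\colon(Fm\mid Ff\to Fg\mid Fn)$; together with tight-to-loose comparison cells $F_{f,g}\colon(1_{Fx}\mid Ff\odot Fg\to F(f\cdot g)\mid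 1_{Fz})$ for $x\xrightarrow{f}y\xrightarrow{g}z$ and $F_x\colon(1_{Fx}\mid\mathrm{id}_{Fx}\to F(1_x)\mid 1_{Fx})$, and loose-to-tight comparison cells $F^{m,n}\colon(Fm\cdot Fn\mid\mathrm{id}_{Fx}\to\mathrm{id}_{Fz}\mid F(m\odot n))$ for $x\stackrel{m}{\nrightarrow}y\stackrel{n}{\nrightarrow}z$ and $F^x\colon(1_{Fx}\mid\mathrm{id}_{Fx}\to\mathrm{id}_{Fx}\mid F(\mathrm{id}_x))$, such that: (1) $(F\alpha\odot F\beta)\cdot F_{f',g'}=F_{f,g}\cdot F(\alpha\cdot\beta)$ for $\alpha\colon(f\mid m\to n\mid f')$, $\beta\colon(g\mid n\to p\mid g')$; (2) $\mathrm{id}_{Fm}\cdot F_y=F_x\cdot F(1_m)$ for $m\colon x\nrightarrow y$; (3) $(F\alpha\cdot F\beta)\odot F^{m',n'}=F^{m,n}\odot F(\alpha\odot\beta)$ for $\alpha\colon(f\mid m\to m'\mid g)$, $\beta\colon(g\mid n\to n'\mid h)$; (4) $1_{Ff}\odot F^y=F^x\odot F(\mathrm{id}_f)$ for $f\colon x\to y$; (5) $(F_{f,g}\odot 1_{Fh})\cdot F_{f\cdot g,h}=(1_{Ff}\odot F_{g,h})\cdot F_{f,g\cdot h}$; (6) $(F_x\odot 1_{Ff})\cdot F_{1_x,f}=1_{Ff}=(1_{Ff}\odot F_y)\cdot F_{f,1_y}$; (7) for $w\stackrel{m}{\nrightarrow}x\stackrel{n}{\nrightarrow}y\stackrel{p}{\nrightarrow}z$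 with associator $a\colon(m\odot n)\odot p\to m\odot(n\odot p)$: $(F^{m,n}\cdot\mathrm{id}_{Fp})\odot F^{m\odot n,p}\odot(F_w\cdot F(a))=(\mathrm{id}_{Fm}\cdot F^{n,p})\odot F^{m,n\odot p}\odot(\mathrm{id}_{F(m\odot(n\odot p))}\cdot F_z)$; (8) with unitors $\lambda_m\colon\mathrm{id}_x\odot m\to m$, $\rho_m\colon m\odot\mathrm{id}_y\to m$: $(F^x\cdot\mathrm{id}_{Fm})\odot F^{\mathrm{id}_x,m}\odot(F_x\cdot F(\lambda_m))=\mathrm{id}_{Fm}\cdot F_y=(\mathrm{id}_{Fm}\cdot F^y)\odot F^{m,\mathrm{id}_y}\odot(F_x\cdot F(\rho_m))$. $F$ is a twisted lax functor if all $F^{m,n},F^x$ are invertible for $\odot$. $F$ is normal if all $F_x$ are invertible for $\cdot$. A twisted lax functor is pseudo if all $F_{f,g}$ and $F_x$ are invertible for $\cdot$. Companions and conjoints. A companion of $f\colon x\to y$ is a proarrow $f_!\colon x\nrightarrow y$ with cells $\eta\colon(1_x\mid\mathrm{id}_x\to f_!\mid f)$, $\varepsilon\colon(f\mid f_!\to\mathrm{id}_y\mid 1_y)$ such that $\eta\cdot\varepsilon=\mathrm{id}_f$ and $\eta\odot\varepsilon=1_{f_!}$ (up to unitors). A conjoint of $f\colon x\to y$ is a proarrow $f^*\colon y\nrightarrow x$ with cells $\eta\colon(f\mid\mathrm{id}_x\to f^*\mid 1_x)$, $\varepsilon\colon(1_y\mid f^*\to\mathrm{id}_y\mid f)$ with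 $\eta\cdot\varepsilon=\mathrm{id}_f$, $\varepsilon\odot\eta=1_{f^*}$. $\mathbb D$ has companions (conjoints) if every arrow has one (a choice $f_!$, resp. $f^*$, is fixed); an equipment has both. $\mathbf{TwoCat}(\mathbb E)$ is the 2-category of objects and arrows of $\mathbb E$, with 2-cells $u\Rightarrow v$ the loosely globular cells $(u\mid\mathrm{id}\to\mathrm{id}\mid v)$. For a 2-category $\mathcal C$: $\mathrm{Sq}(\mathcal C)$ is the strict double category with objects those of $\mathcal C$, both arrows and proarrows the 1-cells of $\mathcal C$, and cells $(f\mid h\to k\mid g)$ the 2-cells $f\cdot k\Rightarrow h\cdot g$ of $\mathcal C$. $\mathrm{Adj}(\mathcal C)$ has the same objects and arrows; its proarrows $x\nrightarrow y$ are adjunctions in $\mathcal C$ with left adjoint $x\to y$; its cells are mate pairs of 2-cells of $\mathcal C$. *)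

(* Defs.v *)
From Corelib Require Import ssreflect ssrbool ssrfun.
From Stdlib Require Import ProofIrrelevance ClassicalEpsilon.

Set Implicit Arguments.
Unset Strict Implicit.
Unset Printing Implicit Defensive.

Declare Scope dbl_scope.
Delimit Scope dbl_scope with dbl.
Local Open Scope dbl_scope.

Reserved Notation "f · g" (at level 40, left associativity).
Reserved Notation "m ⊙ n" (at level 40, left associativity).
Reserved Notation "a ·' b" (at level 40, left associativity).
Reserved Notation "a ⊙' b" (at level 40, left associativity).
Reserved Notation "a ≈ b" (at level 70, no associativity).

(* [cell f m n g] is the type of cells (f | m -> n | g): left arrow f, top
   proarrow m, bottom proarrow n, right arrow g.  All compositions are written
   in diagrammatic order. *)
Record dblData := DblData {
  ob :> Type;
  arr : ob -> ob -> Type;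
  pro : ob -> ob -> Type;
  cell : forall x y x' y' : ob,
    arr x x' -> pro x y -> pro x' y' -> arr y y' -> Type;
  aid : forall x, arr x x;
  acomp : forall x y z, arr x y -> arr y z -> arr x z;
  pid : forall x, pro x x;
  pcomp : forall x y z, pro x y -> pro y z -> pro x z;
  cid : forall x y (m : pro x y), cell (aid x) m m (aid y);
  ccomp : forall x y x' y' x'' y''
      (f : arr x x') (m : pro x y) (n : pro x' y') (g : arr y y')
      (f' : arr x' x'') (p : pro x'' y'') (g' : arr y' y''),
    cell f m n g -> cell f' n p g' -> cell (acomp f f') m p (acomp g g');
  lid : forall x y (f : arr x y), cell f (pid x) (pid y) f;
  lcomp : forall x y z x' y' z'
      (f : arr x x') (m : pro x y) (m' : pro x' y') (g : arr y y')
      (n : pro y z) (n' : pro y' z') (h : arr z z'),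
    cell f m m' g -> cell g n n' h -> cell f (pcomp m n) (pcomp m' n') h;
  ass : forall w x y z (m : pro w x) (n : pro x y) (p : pro y z),
    cell (aid w) (pcomp (pcomp m n) p) (pcomp m (pcomp n p)) (aid z);
  ass_inv : forall w x y z (m : pro w x) (n : pro x y) (p : pro y z),
    cell (aid w) (pcomp m (pcomp n p)) (pcomp (pcomp m n) p) (aid z);
  lun : forall x y (m : pro x y), cell (aid x) (pcomp (pid x) m) m (aid y);
  lun_inv : forall x y (m : pro x y), cell (aid x) m (pcomp (pid x) m) (aid y);
  run : forall x y (m : pro x y), cell (aid x) (pcomp m (pid y)) m (aid y);
  run_inv : forall x y (m : pro x y), cell (aid x) m (pcomp m (pid y)) (aid y)
}.

Arguments arr {d} x y.
Arguments pro {d} x y.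
Arguments cell {d x y x' y'} f m n g.
Arguments aid {d} x.
Arguments pid {d} x.

Notation "f · g" := (acomp f g) : dbl_scope.
Notation "m ⊙ n" := (pcomp m n) : dbl_scope.
Notation "a ·' b" := (ccomp a b) : dbl_scope.
Notation "a ⊙' b" := (lcomp a b) : dbl_scope.

(* Arrows compose strictly, but only up to propositional equality; hence two
   sides of an equation of cells often have boundaries that are equal without
   being convertible.  [a ≈ b] says that a and b are equal, boundaries
   included: it is equality of morphisms of the category of proarrows and
   cells. *)
Inductive ceq (D : dblData) (x y x' y' : D)
    (f : arr x x') (m : pro x y) (n : pro x' y') (g : arr y y')
    (a : cell f m n g) :
  forall f' m' n' g', cell f' m' n' g' -> Prop :=
| ceq_refl : ceq a a.

Notation "a ≈ b" := (ceq a b) : dbl_scope.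

Definition ecast (D : dblData) (x y x' y' : D)
    (f f1 : arr x x') (m : pro x y) (n : pro x' y') (g g1 : arr y y')
    (ef : f = f1) (eg : g = g1) (a : cell f m n g) : cell f1 m n g1 :=
  match ef in _ = f1, eg in _ = g1 return cell f1 m n g1 with
  | eq_refl, eq_refl => a
  end.

Record dblLaws (D : dblData) : Prop := DblLaws {
  acompA : forall (w x y z : D) (f : arr w x) (g : arr x y) (h : arr y z),
    f · (g · h) = (f · g) · h;
  aidl : forall (x y : D) (f : arr x y), aid x · f = f;
  aidr : forall (x y : D) (f : arr x y), f · aid y = f;
  ccompA : forall (x y x1 y1 x2 y2 x3 y3 : D)
      (m : pro x y) (n : pro x1 y1) (p : pro x2 y2) (q : pro x3 y3)
      (f : arr x x1) (f' : arr x1 x2) (f'' : arr x2 x3)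
      (g : arr y y1) (g' : arr y1 y2) (g'' : arr y2 y3)
      (a : cell f m n g) (b : cell f' n p g') (c : cell f'' p q g''),
    a ·' (b ·' c) ≈ (a ·' b) ·' c;
  cidl : forall (x y x' y' : D) (f : arr x x') (m : pro x y) (n : pro x' y')
      (g : arr y y') (a : cell f m n g), cid m ·' a ≈ a;
  cidr : forall (x y x' y' : D) (f : arr x x') (m : pro x y) (n : pro x' y')
      (g : arr y y') (a : cell f m n g), a ·' cid n ≈ a;
  lid_aid : forall x : D, lid (aid x) = cid (pid x);
  lid_acomp : forall (x y z : D) (f : arr x y) (g : arr y z),
    lid (f · g) = lid f ·' lid g;
  lcomp_cid : forall (x y z : D) (m : pro x y) (n : pro y z),
    cid m ⊙' cid n = cid (m ⊙ n);
  interchange : forall (x y z x' y' z' x'' y'' z'' : D)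
      (m : pro x y) (m' : pro x' y') (m'' : pro x'' y'')
      (n : pro y z) (n' : pro y' z') (n'' : pro y'' z'')
      (f : arr x x') (g : arr y y') (h : arr z z')
      (f' : arr x' x'') (g' : arr y' y'') (h' : arr z' z'')
      (a : cell f m m' g) (b : cell g n n' h)
      (c : cell f' m' m'' g') (d : cell g' n' n'' h'),
    (a ⊙' b) ·' (c ⊙' d) = (a ·' c) ⊙' (b ·' d);
  assK : forall (w x y z : D) (m : pro w x) (n : pro x y) (p : pro y z),
    ass m n p ·' ass_inv m n p ≈ cid ((m ⊙ n) ⊙ p);
  ass_invK : forall (w x y z : D) (m : pro w x) (n : pro x y) (p : pro y z),
    ass_inv m n p ·' ass m n p ≈ cid (m ⊙ (n ⊙ p));
  lunK : forall (x y : D) (m : pro x y), lun m ·' lun_inv m ≈ cid (pid x ⊙ m);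
  lun_invK : forall (x y : D) (m : pro x y), lun_inv m ·' lun m ≈ cid m;
  runK : forall (x y : D) (m : pro x y), run m ·' run_inv m ≈ cid (m ⊙ pid y);
  run_invK : forall (x y : D) (m : pro x y), run_inv m ·' run m ≈ cid m;
  ass_nat : forall (w x y z w' x' y' z' : D)
      (m : pro w x) (n : pro x y) (p : pro y z)
      (m' : pro w' x') (n' : pro x' y') (p' : pro y' z')
      (e : arr w w') (f : arr x x') (g : arr y y') (h : arr z z')
      (a : cell e m m' f) (b : cell f n n' g) (c : cell g p p' h),
    ((a ⊙' b) ⊙' c) ·' ass m' n' p' ≈ ass m n p ·' (a ⊙' (b ⊙' c));
  lun_nat : forall (x y x' y' : D) (f : arr x x') (m : pro x y)
      (n : pro x' y') (g : arr y y') (a : cell f m n g),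
    (lid f ⊙' a) ·' lun n ≈ lun m ·' a;
  run_nat : forall (x y x' y' : D) (f : arr x x') (m : pro x y)
      (n : pro x' y') (g : arr y y') (a : cell f m n g),
    (a ⊙' lid g) ·' run n ≈ run m ·' a;
  pentagon : forall (v w x y z : D)
      (m : pro v w) (n : pro w x) (p : pro x y) (q : pro y z),
    ass (m ⊙ n) p q ·' ass m n (p ⊙ q)
    ≈ (ass m n p ⊙' cid q) ·' ass m (n ⊙ p) q ·' (cid m ⊙' ass n p q);
  triangle : forall (x y z : D) (m : pro x y) (n : pro y z),
    ass m (pid y) n ·' (cid m ⊙' lun n) ≈ run m ⊙' cid n
}.

Record doubleCat := DoubleCat {
  dbl_data :> dblData;
  dbl_laws : dblLaws dbl_data
}.

Lemma uip (T : Type) (x y : T) (p q : x = y) : p = q.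
Proof. exact: proof_irrelevance. Qed.

Section CeqTheory.
Variable D : dblData.
Implicit Types x y z : D.

Lemma ceq_sym x y x' y' (f f' : arr x x') (m m' : pro x y) (n n' : pro x' y')
  (g g' : arr y y') (a : cell f m n g) (b : cell f' m' n' g') :
  a ≈ b -> b ≈ a.
Proof. by case. Qed.

Lemma ceq_trans x y x' y' (f f' f'' : arr x x') (m m' m'' : pro x y)
  (n n' n'' : pro x' y') (g g' g'' : arr y y') (a : cell f m n g)
  (b : cell f' m' n' g') (c : cell f'' m'' n'' g'') :
  a ≈ b -> b ≈ c -> a ≈ c.
Proof. by case=> Hc. Qed.

Lemma ceq_inv x y x' y' (f f' : arr x x') (m m' : pro x y) (n n' : pro x' y')
  (g g' : arr y y') (a : cell f m n g) (b : cell f' m' n' g') :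
  a ≈ b -> exists (ef : f = f') (em : m = m') (en : n = n') (eg : g = g'),
    match ef in _ = f', em in _ = m', en in _ = n', eg in _ = g'
      return cell f' m' n' g' with
    | eq_refl, eq_refl, eq_refl, eq_refl => a
    end = b.
Proof. by case; do 4 exists eq_refl. Qed.

Lemma ceq_eq x y x' y' (f : arr x x') (m : pro x y) (n : pro x' y')
  (g : arr y y') (a b : cell f m n g) : a ≈ b -> a = b.
Proof.
case/ceq_inv=> ef [em [en [eg]]].
by rewrite (uip ef eq_refl) (uip em eq_refl) (uip en eq_refl) (uip eg eq_refl).
Qed.

Lemma eq_ceq x y x' y' (f : arr x x') (m : pro x y) (n : pro x' y')
  (g : arr y y') (a b : cell f m n g) : a = b -> a ≈ b.
Proof. by move=> ->. Qed.

Lemma ecastE x y x' y' (f f1 : arr x x') (m : pro x y) (n : pro x' y')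
  (g g1 : arr y y') (ef : f = f1) (eg : g = g1) (a : cell f m n g) :
  ecast ef eg a ≈ a.
Proof. by case: f1 / ef; case: g1 / eg. Qed.

Lemma ceq_ccomp x y x' y' x'' y''
  (f f1 : arr x x') (m m1 : pro x y) (n n1 : pro x' y') (g g1 : arr y y')
  (h h1 : arr x' x'') (p p1 : pro x'' y'') (k k1 : arr y' y'')
  (a : cell f m n g) (a1 : cell f1 m1 n1 g1)
  (b : cell h n p k) (b1 : cell h1 n1 p1 k1) :
  a ≈ a1 -> b ≈ b1 -> a ·' b ≈ a1 ·' b1.
Proof.
case/ceq_inv=> ef [em [en [eg <-]]].
destruct ef, em, en, eg; case/ceq_inv=> ef [em [en [eg <-]]].
by rewrite (uip em eq_refl); destruct ef, en, eg.
Qed.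

Lemma ceq_lcomp x y z x' y' z'
  (f f1 : arr x x') (m m1 : pro x y) (m' m'1 : pro x' y') (g g1 : arr y y')
  (n n1 : pro y z) (n' n'1 : pro y' z') (h h1 : arr z z')
  (a : cell f m m' g) (a1 : cell f1 m1 m'1 g1)
  (b : cell g n n' h) (b1 : cell g1 n1 n'1 h1) :
  a ≈ a1 -> b ≈ b1 -> a ⊙' b ≈ a1 ⊙' b1.
Proof.
case/ceq_inv=> ef [em [en [eg <-]]].
destruct ef, em, en, eg; case/ceq_inv=> ef [em [en [eg <-]]].
by rewrite (uip ef eq_refl); destruct em, en, eg.
Qed.

(* Cells with fixed top and bottom, as morphisms of a category. *)
Definition tcell x y x' y' (m : pro x y) (n : pro x' y') : Type :=
  {f : arr x x' & {g : arr y y' & cell f m n g}}.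

Definition tot x y x' y' (f : arr x x') (m : pro x y) (n : pro x' y')
  (g : arr y y') (a : cell f m n g) : tcell m n := existT _ f (existT _ g a).

Definition tcomp x y x' y' x'' y'' (m : pro x y) (n : pro x' y')
  (p : pro x'' y'') (a : tcell m n) (b : tcell n p) : tcell m p :=
  tot (projT2 (projT2 a) ·' projT2 (projT2 b)).

Lemma ceq_tot x y x' y' (f f1 : arr x x') (m : pro x y) (n : pro x' y')
  (g g1 : arr y y') (a : cell f m n g) (b : cell f1 m n g1) :
  a ≈ b -> tot a = tot b.
Proof.
case/ceq_inv=> ef [em [en [eg <-]]].
by rewrite (uip em eq_refl) (uip en eq_refl); destruct ef, eg.
Qed.

Lemma tot_ceq x y x' y' (f f1 : arr x x') (m : pro x y) (n : pro x' y')
  (g g1 : arr y y') (a : cell f m n g) (b : cell f1 m n g1) :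
  tot a = tot b -> a ≈ b.
Proof.
move=> e; change (projT2 (projT2 (tot a)) ≈ projT2 (projT2 (tot b))).
by rewrite e.
Qed.

Lemma tot_eq x y x' y' (f : arr x x') (m : pro x y) (n : pro x' y')
  (g : arr y y') (a b : cell f m n g) : tot a = tot b -> a = b.
Proof. by move/tot_ceq/ceq_eq. Qed.

Lemma tot_ecast x y x' y' (f f1 : arr x x') (m : pro x y) (n : pro x' y')
  (g g1 : arr y y') (ef : f = f1) (eg : g = g1) (a : cell f m n g) :
  tot (ecast ef eg a) = tot a.
Proof. exact/ceq_tot/ecastE. Qed.

Lemma tot_ccomp x y x' y' x'' y''
  (f : arr x x') (m : pro x y) (n : pro x' y') (g : arr y y')
  (h : arr x' x'') (p : pro x'' y'') (k : arr y' y'')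
  (a : cell f m n g) (b : cell h n p k) :
  tot (a ·' b) = tcomp (tot a) (tot b).
Proof. by []. Qed.

End CeqTheory.

Section DoubleCatTheory.
Variable D : doubleCat.
Implicit Types x y z : D.
Let L := dbl_laws D.

Lemma tcompA x y x1 y1 x2 y2 x3 y3 (m : pro x y) (n : pro x1 y1)
  (p : pro x2 y2) (q : pro x3 y3) (a : tcell m n) (b : tcell n p)
  (c : tcell p q) : tcomp a (tcomp b c) = tcomp (tcomp a b) c.
Proof. exact/ceq_tot/(ccompA L). Qed.

Lemma tcomp1l x y x' y' (m : pro x y) (n : pro x' y') (a : tcell m n) :
  tcomp (tot (cid m)) a = a.
Proof. case: a => f [g a]; exact/ceq_tot/(cidl L). Qed.

Lemma tcomp1r x y x' y' (m : pro x y) (n : pro x' y') (a : tcell m n) :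
  tcomp a (tot (cid n)) = a.
Proof. case: a => f [g a]; exact/ceq_tot/(cidr L). Qed.

Lemma tot_lun_nat x y x' y' (f : arr x x') (m : pro x y)
  (n : pro x' y') (g : arr y y') (a : cell f m n g) :
  tcomp (tot (lid f ⊙' a)) (tot (lun n)) = tcomp (tot (lun m)) (tot a).
Proof. exact/ceq_tot/(lun_nat L). Qed.

Lemma tot_run_nat x y x' y' (f : arr x x') (m : pro x y)
  (n : pro x' y') (g : arr y y') (a : cell f m n g) :
  tcomp (tot (a ⊙' lid g)) (tot (run n)) = tcomp (tot (run m)) (tot a).
Proof. exact/ceq_tot/(run_nat L). Qed.

Lemma tot_lunK x y (m : pro x y) :
  tcomp (tot (lun m)) (tot (lun_inv m)) = tot (cid (pid x ⊙ m)).
Proof. exact/ceq_tot/(lunK L). Qed.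

Lemma tot_lun_invK x y (m : pro x y) :
  tcomp (tot (lun_inv m)) (tot (lun m)) = tot (cid m).
Proof. exact/ceq_tot/(lun_invK L). Qed.

Lemma tot_runK x y (m : pro x y) :
  tcomp (tot (run m)) (tot (run_inv m)) = tot (cid (m ⊙ pid y)).
Proof. exact/ceq_tot/(runK L). Qed.

Lemma tot_run_invK x y (m : pro x y) :
  tcomp (tot (run_inv m)) (tot (run m)) = tot (cid m).
Proof. exact/ceq_tot/(run_invK L). Qed.

Lemma tot_assK w x y z (m : pro w x) (n : pro x y) (p : pro y z) :
  tcomp (tot (ass m n p)) (tot (ass_inv m n p)) = tot (cid ((m ⊙ n) ⊙ p)).
Proof. exact/ceq_tot/(assK L). Qed.

Lemma tot_ass_invK w x y z (m : pro w x) (n : pro x y) (p : pro y z) :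
  tcomp (tot (ass_inv m n p)) (tot (ass m n p)) = tot (cid (m ⊙ (n ⊙ p))).
Proof. exact/ceq_tot/(ass_invK L). Qed.

Lemma tot_ass_nat w x y z w' x' y' z'
  (m : pro w x) (n : pro x y) (p : pro y z)
  (m' : pro w' x') (n' : pro x' y') (p' : pro y' z')
  (e : arr w w') (f : arr x x') (g : arr y y') (h : arr z z')
  (a : cell e m m' f) (b : cell f n n' g) (c : cell g p p' h) :
  tcomp (tot ((a ⊙' b) ⊙' c)) (tot (ass m' n' p'))
  = tcomp (tot (ass m n p)) (tot (a ⊙' (b ⊙' c))).
Proof. exact/ceq_tot/(ass_nat L). Qed.

Definition gcomp x y (m n p : pro x y) (a : cell (aid x) m n (aid y))
  (b : cell (aid x) n p (aid y)) : cell (aid x) m p (aid y) :=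
  ecast (aidl L (aid x)) (aidl L (aid y)) (a ·' b).

Lemma tot_gcomp x y (m n p : pro x y) (a : cell (aid x) m n (aid y))
  (b : cell (aid x) n p (aid y)) :
  tot (gcomp a b) = tcomp (tot a) (tot b).
Proof. by rewrite tot_ecast. Qed.

Lemma gcomp_lcomp x y z (m m' m'' : pro x y) (n n' n'' : pro y z)
  (a : cell (aid x) m m' (aid y)) (a' : cell (aid x) m' m'' (aid y))
  (b : cell (aid y) n n' (aid z)) (b' : cell (aid y) n' n'' (aid z)) :
  gcomp a a' ⊙' gcomp b b' = gcomp (a ⊙' b) (a' ⊙' b').
Proof.
apply: ceq_eq; apply: ceq_trans (ceq_lcomp (ecastE _ _ _) (ecastE _ _ _)) _.
rewrite -(interchange L); exact/ceq_sym/ecastE.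
Qed.

Lemma gcompA x y (m n p q : pro x y) (a : cell (aid x) m n (aid y))
  (b : cell (aid x) n p (aid y)) (c : cell (aid x) p q (aid y)) :
  gcomp a (gcomp b c) = gcomp (gcomp a b) c.
Proof. by apply: tot_eq; rewrite !tot_gcomp tcompA. Qed.

Lemma gcomp1l x y (m n : pro x y) (a : cell (aid x) m n (aid y)) :
  gcomp (cid m) a = a.
Proof. by apply: tot_eq; rewrite tot_gcomp tcomp1l. Qed.

Lemma gcomp1r x y (m n : pro x y) (a : cell (aid x) m n (aid y)) :
  gcomp a (cid n) = a.
Proof. by apply: tot_eq; rewrite tot_gcomp tcomp1r. Qed.

Lemma glun_nat x y (m n : pro x y) (a : cell (aid x) m n (aid y)) :
  gcomp (cid (pid x) ⊙' a) (lun n) = gcomp (lun m) a.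
Proof. by apply: tot_eq; rewrite !tot_gcomp -(lid_aid L) tot_lun_nat. Qed.

Lemma grun_nat x y (m n : pro x y) (a : cell (aid x) m n (aid y)) :
  gcomp (a ⊙' cid (pid y)) (run n) = gcomp (run m) a.
Proof. by apply: tot_eq; rewrite !tot_gcomp -(lid_aid L) tot_run_nat. Qed.

Lemma gass_nat w x y z (m m' : pro w x) (n n' : pro x y) (p p' : pro y z)
  (a : cell (aid w) m m' (aid x)) (b : cell (aid x) n n' (aid y))
  (c : cell (aid y) p p' (aid z)) :
  gcomp ((a ⊙' b) ⊙' c) (ass m' n' p') = gcomp (ass m n p) (a ⊙' (b ⊙' c)).
Proof. by apply: tot_eq; rewrite !tot_gcomp tot_ass_nat. Qed.

Lemma gpentagon v w x y z
  (m : pro v w) (n : pro w x) (p : pro x y) (q : pro y z) :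
  gcomp (ass (m ⊙ n) p q) (ass m n (p ⊙ q))
  = gcomp (gcomp (ass m n p ⊙' cid q) (ass m (n ⊙ p) q))
          (cid m ⊙' ass n p q).
Proof.
apply: tot_eq; rewrite !tot_gcomp; exact: (ceq_tot (pentagon L m n p q)).
Qed.

Lemma gtriangle x y z (m : pro x y) (n : pro y z) :
  gcomp (ass m (pid y) n) (cid m ⊙' lun n) = run m ⊙' cid n.
Proof. apply: tot_eq; rewrite tot_gcomp; exact: (ceq_tot (triangle L m n)). Qed.

Lemma gcancel_run x y (m n : pro x y) (a b : cell (aid x) m n (aid y)) :
  a ⊙' cid (pid y) = b ⊙' cid (pid y) -> a = b.
Proof.
move=> e; have: gcomp (run m) a = gcomp (run m) b by rewrite -!grun_nat e.
move/(congr1 (gcomp (run_inv m))); rewrite !gcompA.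
suff -> : gcomp (run_inv m) (run m) = cid m by rewrite !gcomp1l.
by apply: tot_eq; rewrite tot_gcomp tot_run_invK.
Qed.

Lemma gcancel_lun x y (m n : pro x y) (a b : cell (aid x) m n (aid y)) :
  cid (pid x) ⊙' a = cid (pid x) ⊙' b -> a = b.
Proof.
move=> e; have: gcomp (lun m) a = gcomp (lun m) b by rewrite -!glun_nat e.
move/(congr1 (gcomp (lun_inv m))); rewrite !gcompA.
suff -> : gcomp (lun_inv m) (lun m) = cid m by rewrite !gcomp1l.
by apply: tot_eq; rewrite tot_gcomp tot_lun_invK.
Qed.

Lemma gcancel_ass w x y z (m : pro w x) (n : pro x y) (p : pro y z) q
  (a b : cell (aid w) (m ⊙ (n ⊙ p)) q (aid z)) :
  gcomp (ass m n p) a = gcomp (ass m n p) b -> a = b.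
Proof.
move/(congr1 (gcomp (ass_inv m n p))); rewrite !gcompA.
suff -> : gcomp (ass_inv m n p) (ass m n p) = cid _ by rewrite !gcomp1l.
by apply: tot_eq; rewrite tot_gcomp tot_ass_invK.
Qed.

Lemma gcancel_lunr x y (m n : pro x y) (a b : cell (aid x) m (pid x ⊙ n) (aid y)) :
  gcomp a (lun n) = gcomp b (lun n) -> a = b.
Proof.
move/(congr1 (fun c => gcomp c (lun_inv n))); rewrite -!gcompA.
suff -> : gcomp (lun n) (lun_inv n) = cid _ by rewrite !gcomp1r.
by apply: tot_eq; rewrite tot_gcomp tot_lunK.
Qed.

(* Kelly's argument: the two unitors of a loose identity agree. *)
Lemma ass_lun x y z (m : pro x y) (n : pro y z) :
  gcomp (ass (pid x) m n) (lun (m ⊙ n)) = lun m ⊙' cid n.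
Proof.
apply: gcancel_lun.
have e1 : cid (pid x) ⊙' gcomp (ass (pid x) m n) (lun (m ⊙ n))
  = gcomp (cid (pid x) ⊙' ass (pid x) m n) (cid (pid x) ⊙' lun (m ⊙ n)).
  by rewrite -gcomp_lcomp gcomp1l.
rewrite e1.
apply: (@gcancel_ass _ _ _ _ (pid x) (pid x ⊙ m) n).
rewrite -gass_nat gcompA.
set u := ass (pid x) (pid x) m ⊙' cid n.
have uK c d : gcomp u c = gcomp u d ->
    c = d :> cell (aid x) ((pid x ⊙ (pid x ⊙ m)) ⊙ n) (pid x ⊙ (m ⊙ n)) (aid z).
  move/(congr1 (gcomp (ass_inv (pid x) (pid x) m ⊙' cid n))); rewrite !gcompA.
  rewrite /u -gcomp_lcomp gcomp1l.
  suff -> : gcomp (ass_inv (pid x) (pid x) m) (ass (pid x) (pid x) m) = cid _.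
    by rewrite (lcomp_cid L) !gcomp1l.
  by apply: tot_eq; rewrite tot_gcomp tot_ass_invK.
apply: uK; rewrite !gcompA -gpentagon -gcompA gtriangle.
rewrite /u -(lcomp_cid L m n) -gass_nat -gtriangle -gcompA.
rewrite -{1}(gcomp1l (cid n)) gcomp_lcomp.
by rewrite !gcompA.
Qed.

Lemma lun_pid x : run (pid x) = lun (pid x).
Proof.
apply: gcancel_run; rewrite -gtriangle -ass_lun; congr gcomp.
by apply: gcancel_lunr; rewrite glun_nat.
Qed.

End DoubleCatTheory.

Definition op_data (D : dblData) : dblData := {|
  ob := ob D;
  arr := fun x y => @arr D y x;
  pro := fun x y => @pro D x y;
  cell := fun x y x' y' f m n g => @cell D x' y' x y f n m g;
  aid := fun x => @aid D x;
  acomp := fun x y z f g => g · f;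
  pid := fun x => @pid D x;
  pcomp := fun x y z m n => m ⊙ n;
  cid := fun x y m => cid m;
  ccomp := fun x y x' y' x'' y'' f m n g f' p g' a b => b ·' a;
  lid := fun x y f => lid f;
  lcomp := fun x y z x' y' z' f m m' g n n' h a b => a ⊙' b;
  ass := fun w x y z m n p => ass_inv m n p;
  ass_inv := fun w x y z m n p => ass m n p;
  lun := fun x y m => lun_inv m;
  lun_inv := fun x y m => lun m;
  run := fun x y m => run_inv m;
  run_inv := fun x y m => run m
|}.

Definition co_data (D : dblData) : dblData := {|
  ob := ob D;
  arr := fun x y => @arr D x y;
  pro := fun x y => @pro D y x;
  cell := fun x y x' y' f m n g => @cell D y x y' x' g m n f;
  aid := fun x => @aid D x;
  acomp := fun x y z f g => f · g;
  pid := fun x => @pid D x;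
  pcomp := fun x y z m n => n ⊙ m;
  cid := fun x y m => cid m;
  ccomp := fun x y x' y' x'' y'' f m n g f' p g' a b => a ·' b;
  lid := fun x y f => lid f;
  lcomp := fun x y z x' y' z' f m m' g n n' h a b => b ⊙' a;
  ass := fun w x y z m n p => ass_inv p n m;
  ass_inv := fun w x y z m n p => ass p n m;
  lun := fun x y m => run m;
  lun_inv := fun x y m => run_inv m;
  run := fun x y m => lun m;
  run_inv := fun x y m => lun_inv m
|}.

Section Duals.
Variable D : doubleCat.
Implicit Types x y z : D.
Let L := dbl_laws D.

Lemma ceq_op x y x' y' (f f' : @arr D x' x) (m m' : pro x y)
  (n n' : pro x' y') (g g' : arr y' y) (a : cell f n m g)
  (b : cell f' n' m' g') :
  a ≈ b -> @ceq (op_data D) x y x' y' f m n g a f' m' n' g' b.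
Proof. by case. Qed.

Lemma ceq_co x y x' y' (f f' : @arr D x x') (m m' : pro y x)
  (n n' : pro y' x') (g g' : arr y y') (a : cell g m n f)
  (b : cell g' m' n' f') :
  a ≈ b -> @ceq (co_data D) x y x' y' f m n g a f' m' n' g' b.
Proof. by case. Qed.

Lemma tmove x y x' y' (m m1 : pro x y) (n n1 : pro x' y')
  (i : tcell m m1) (i' : tcell m1 m) (j : tcell n n1) (j' : tcell n1 n)
  (a : tcell m n) (b : tcell m1 n1) :
  tcomp i' i = tot (cid m1) -> tcomp j j' = tot (cid n) ->
  tcomp a j = tcomp i b -> tcomp b j' = tcomp i' a.
Proof.
move=> ei ej e; rewrite -[a]tcomp1r -ej [tcomp a _]tcompA e -tcompA.
by rewrite [RHS]tcompA ei tcomp1l.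
Qed.

Lemma tinv_uniq x y (m n : pro x y) (a : tcell m n) (b c : tcell n m) :
  tcomp b a = tot (cid n) -> tcomp a c = tot (cid m) -> b = c.
Proof. by move=> e1 e2; rewrite -[b]tcomp1r -e2 tcompA e1 tcomp1l. Qed.

Lemma inv_nat x y x' y' (f : arr x x') (m m1 : pro x y) (n n1 : pro x' y')
  (g : arr y y') (i : cell (aid x) m m1 (aid y))
  (i' : cell (aid x) m1 m (aid y)) (j : cell (aid x') n n1 (aid y'))
  (j' : cell (aid x') n1 n (aid y')) (a : cell f m n g) (b : cell f m1 n1 g) :
  i' ·' i ≈ cid m1 -> j ·' j' ≈ cid n ->
  a ·' j ≈ i ·' b -> i' ·' a ≈ b ·' j'.
Proof.
move=> /ceq_tot; rewrite tot_ccomp => ei /ceq_tot; rewrite tot_ccomp => ej.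
move=> /ceq_tot; rewrite !tot_ccomp => e; apply/ceq_sym/tot_ceq.
rewrite !tot_ccomp; exact: tmove ei ej e.
Qed.

Lemma inv_pentagon v w x y z
  (m : pro v w) (n : pro w x) (p : pro x y) (q : pro y z) :
  ass_inv m n (p ⊙ q) ·' ass_inv (m ⊙ n) p q
  ≈ (cid m ⊙' ass_inv n p q) ·' (ass_inv m (n ⊙ p) q ·' (ass_inv m n p ⊙' cid q)).
Proof.
apply: tot_ceq.
apply: (@tinv_uniq _ _ _ _ (tcomp (tot (ass (m ⊙ n) p q)) (tot (ass m n (p ⊙ q))))).
  rewrite tot_ccomp -tcompA [tcomp (tot (ass_inv (m ⊙ n) p q)) _]tcompA.
  by rewrite tot_ass_invK tcomp1l tot_ass_invK.
rewrite -tot_ccomp (ceq_tot (pentagon L m n p q)) !tot_ccomp -!tcompA.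
rewrite [X in tcomp _ (tcomp _ X)]tcompA -[tcomp (tot (cid m ⊙' _)) _]tot_ccomp.
rewrite (interchange L).
rewrite (ceq_tot (ceq_lcomp (cidl L _) (assK L _ _ _))) (lcomp_cid L) tcomp1l.
rewrite [X in tcomp _ X]tcompA tot_assK tcomp1l -tot_ccomp (interchange L).
by rewrite (ceq_tot (ceq_lcomp (assK L _ _ _) (cidl L _))) (lcomp_cid L).
Qed.

Lemma inv_triangle x y z (m : pro x y) (n : pro y z) :
  (cid m ⊙' lun_inv n) ·' ass_inv m (pid y) n ≈ run_inv m ⊙' cid n.
Proof.
apply: tot_ceq.
apply: (@tinv_uniq _ _ _ _ (tcomp (tot (ass m (pid y) n)) (tot (cid m ⊙' lun n)))).
  rewrite tot_ccomp -tcompA [tcomp (tot (ass_inv _ _ _)) _]tcompA.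
  rewrite tot_ass_invK tcomp1l -tot_ccomp (interchange L).
  by rewrite (ceq_tot (ceq_lcomp (cidl L _) (lun_invK L _))) (lcomp_cid L).
rewrite -tot_ccomp (ceq_tot (triangle L m n)) -tot_ccomp (interchange L).
by rewrite (ceq_tot (ceq_lcomp (runK L _) (cidl L _))) (lcomp_cid L).
Qed.

Lemma inv_triangle_co x y z (m : pro x y) (n : pro y z) :
  ass_inv m (pid y) n ·' (run m ⊙' cid n) ≈ cid m ⊙' lun n.
Proof.
apply: tot_ceq; rewrite tot_ccomp -(ceq_tot (triangle L m n)) tot_ccomp tcompA.
by rewrite tot_ass_invK tcomp1l.
Qed.

Lemma op_laws : dblLaws (op_data D).
Proof.
split=> /=.
- move=> w x y z f g h; exact/esym/(acompA L).
- move=> x y f; exact: (aidr L).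
- move=> x y f; exact: (aidl L).
- move=> *; apply: ceq_op; exact/ceq_sym/(ccompA L).
- move=> *; apply: ceq_op; exact: (cidr L).
- move=> *; apply: ceq_op; exact: (cidl L).
- move=> x; exact: (lid_aid L).
- move=> *; exact: (lid_acomp L).
- move=> *; exact: (lcomp_cid L).
- move=> *; exact: (interchange L).
- move=> *; apply: ceq_op; exact: (assK L).
- move=> *; apply: ceq_op; exact: (ass_invK L).
- move=> *; apply: ceq_op; exact: (lunK L).
- move=> *; apply: ceq_op; exact: (lun_invK L).
- move=> *; apply: ceq_op; exact: (runK L).
- move=> *; apply: ceq_op; exact: (run_invK L).
- move=> *; apply: ceq_op; apply: inv_nat (ass_nat L _ _ _).
    exact: (ass_invK L).
  exact: (assK L).
- move=> *; apply: ceq_op; apply: inv_nat (lun_nat L _).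
    exact: (lun_invK L).
  exact: (lunK L).
- move=> *; apply: ceq_op; apply: inv_nat (run_nat L _).
    exact: (run_invK L).
  exact: (runK L).
- move=> *; apply: ceq_op; exact: inv_pentagon.
- move=> *; apply: ceq_op; exact: inv_triangle.
Qed.

Lemma co_laws : dblLaws (co_data D).
Proof.
split=> /=.
- move=> w x y z f g h; exact: (acompA L).
- move=> x y f; exact: (aidl L).
- move=> x y f; exact: (aidr L).
- move=> *; apply: ceq_co; exact: (ccompA L).
- move=> *; apply: ceq_co; exact: (cidl L).
- move=> *; apply: ceq_co; exact: (cidr L).
- move=> x; exact: (lid_aid L).
- move=> *; exact: (lid_acomp L).
- move=> *; exact: (lcomp_cid L).
- move=> *; exact: (interchange L).
- move=> *; apply: ceq_co; exact: (ass_invK L).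
- move=> *; apply: ceq_co; exact: (assK L).
- move=> *; apply: ceq_co; exact: (runK L).
- move=> *; apply: ceq_co; exact: (run_invK L).
- move=> *; apply: ceq_co; exact: (lunK L).
- move=> *; apply: ceq_co; exact: (lun_invK L).
- move=> *; apply: ceq_co; apply: ceq_sym; apply: inv_nat (ass_nat L _ _ _).
    exact: (ass_invK L).
  exact: (assK L).
- move=> *; apply: ceq_co; exact: (run_nat L).
- move=> *; apply: ceq_co; exact: (lun_nat L).
- move=> v w x y z m n p q; apply: ceq_co.
  apply: ceq_trans (inv_pentagon _ _ _ _) _; exact: (ccompA L).
- move=> *; apply: ceq_co; exact: inv_triangle_co.
Qed.

Definition opD : doubleCat := DoubleCat op_laws.
Definition coD : doubleCat := DoubleCat co_laws.

End Duals.

Definition eq_two (T : Type) (two : T -> T -> Type) (vid : forall f, two f f)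
    (f g : T) (e : f = g) : two f g :=
  match e with eq_refl => vid f end.

(* A (strict) 2-category: 1-cells compose strictly, up to propositional
   equality, and the identity 2-cells along these equalities make the
   associativity and unit equations of horizontal composition well typed. *)
Record twoCategory := TwoCategory {
  ob2 :> Type;
  hom : ob2 -> ob2 -> Type;
  hid : forall x, hom x x;
  hom_comp : forall x y z, hom x y -> hom y z -> hom x z;
  two : forall x y, hom x y -> hom x y -> Type;
  vid : forall x y (f : hom x y), two f f;
  vcomp : forall x y (f g h : hom x y), two f g -> two g h -> two f h;
  hcomp : forall x y z (f f' : hom x y) (g g' : hom y z),
    two f f' -> two g g' -> two (hom_comp f g) (hom_comp f' g');
  homA : forall w x y z (f : hom w x) (g : hom x y) (h : hom y z),
    hom_comp f (hom_comp g h) = hom_comp (hom_comp f g) h;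
  hom1l : forall x y (f : hom x y), hom_comp (hid x) f = f;
  hom1r : forall x y (f : hom x y), hom_comp f (hid y) = f;
  vcompA : forall x y (f g h k : hom x y) (a : two f g) (b : two g h)
    (c : two h k), vcomp a (vcomp b c) = vcomp (vcomp a b) c;
  vcomp1l : forall x y (f g : hom x y) (a : two f g), vcomp (vid f) a = a;
  vcomp1r : forall x y (f g : hom x y) (a : two f g), vcomp a (vid g) = a;
  hcomp_vid : forall x y z (f : hom x y) (g : hom y z),
    hcomp (vid f) (vid g) = vid (hom_comp f g);
  hcomp_vcomp : forall x y z (f f' f'' : hom x y) (g g' g'' : hom y z)
    (a : two f f') (a' : two f' f'') (b : two g g') (b' : two g' g''),
    hcomp (vcomp a a') (vcomp b b') = vcomp (hcomp a b) (hcomp a' b');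
  hcompA : forall w x y z (f f' : hom w x) (g g' : hom x y) (h h' : hom y z)
    (a : two f f') (b : two g g') (c : two h h'),
    vcomp (hcomp a (hcomp b c)) (eq_two (@vid w z) (homA f' g' h'))
    = vcomp (eq_two (@vid w z) (homA f g h)) (hcomp (hcomp a b) c);
  hcomp1l : forall x y (f f' : hom x y) (a : two f f'),
    vcomp (hcomp (vid (hid x)) a) (eq_two (@vid x y) (hom1l f'))
    = vcomp (eq_two (@vid x y) (hom1l f)) a;
  hcomp1r : forall x y (f f' : hom x y) (a : two f f'),
    vcomp (hcomp a (vid (hid y))) (eq_two (@vid x y) (hom1r f'))
    = vcomp (eq_two (@vid x y) (hom1r f)) a
}.

Arguments hom {t} x y.
Arguments hid {t} x.
Arguments two {t x y} f g.
Arguments homA {t w x y z} f g h.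
Arguments hom1l {t x y} f.
Arguments hom1r {t x y} f.

Declare Scope two_scope.
Delimit Scope two_scope with two.
Notation "f · g" := (hom_comp f g) : two_scope.
Notation "a • b" := (vcomp a b) (at level 50, left associativity) : two_scope.
Notation "a ∗ b" := (hcomp a b) (at level 40, left associativity) : two_scope.
Notation "f ◁ a" := (hcomp (vid f) a)
  (at level 35, right associativity) : two_scope.
Notation "a ▷ g" := (hcomp a (vid g))
  (at level 36, left associativity) : two_scope.

Definition eq2 (C : twoCategory) (x y : C) (f g : hom x y) (e : f = g) :
  two f g := eq_two (@vid C x y) e.

Section LooselyGlobular.
Variable E : doubleCat.
Implicit Types x y z : E.
Let L := dbl_laws E.

(* Loose composition of loosely globular cells, conjugated by the unitor of
   the loose identity so as to be loosely globular again. *)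
Definition glcomp x y (u v w : arr x y) (a : cell u (pid x) (pid y) v)
    (b : cell v (pid x) (pid y) w) : cell u (pid x) (pid y) w :=
  ecast (etrans (aidr L _) (aidl L u)) (etrans (aidr L _) (aidl L w))
    (lun_inv (pid x) ·' (a ⊙' b) ·' lun (pid y)).

Lemma tot_glcomp x y (u v w : arr x y) (a : cell u (pid x) (pid y) v)
  (b : cell v (pid x) (pid y) w) :
  tot (glcomp a b) = tcomp (tot (lun_inv (pid x)))
                       (tcomp (tot (a ⊙' b)) (tot (lun (pid y)))).
Proof. by rewrite tot_ecast !tot_ccomp tcompA. Qed.

Lemma glcomp1l x y (u v : arr x y) (a : cell u (pid x) (pid y) v) :
  glcomp (lid u) a = a.
Proof.
by apply: tot_eq; rewrite tot_glcomp tot_lun_nat tcompA tot_lun_invK tcomp1l.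
Qed.

Lemma glcomp1r x y (u v : arr x y) (a : cell u (pid x) (pid y) v) :
  glcomp a (lid v) = a.
Proof.
apply: tot_eq; rewrite tot_glcomp -(lun_pid y) tot_run_nat (lun_pid x).
by rewrite tcompA tot_lun_invK tcomp1l.
Qed.

Lemma glcompA x y (u v w t : arr x y) (a : cell u (pid x) (pid y) v)
  (b : cell v (pid x) (pid y) w) (c : cell w (pid x) (pid y) t) :
  glcomp a (glcomp b c) = glcomp (glcomp a b) c.
Proof.
have tri z : tcomp (tot (ass (pid z) (pid z) (pid z))) (tot (cid (pid z) ⊙' lun (pid z)))
    = tot (lun (pid z) ⊙' cid (pid z)).
  by rewrite -tot_ccomp (ceq_tot (triangle L _ _)) lun_pid.
have tri' z : tcomp (tot (lun_inv (pid z) ⊙' cid (pid z)))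
    (tot (ass (pid z) (pid z) (pid z))) = tot (cid (pid z) ⊙' lun_inv (pid z)).
  apply: (@tinv_uniq _ _ _ _ _ (tot (cid (pid z) ⊙' lun (pid z)))).
    rewrite -tcompA tri -tot_ccomp (interchange L).
    by rewrite (ceq_tot (ceq_lcomp (lun_invK L _) (cidl L _))) (lcomp_cid L).
  rewrite -tot_ccomp (interchange L).
  by rewrite (ceq_tot (ceq_lcomp (cidl L _) (lunK L _))) (lcomp_cid L).
apply: tot_eq; rewrite 2!tot_glcomp; do 2!congr tcomp.
have -> : tot (a ⊙' glcomp b c)
  = tcomp (tot (cid (pid x) ⊙' lun_inv (pid x)))
      (tcomp (tot (a ⊙' (b ⊙' c))) (tot (cid (pid y) ⊙' lun (pid y)))).
  have h : a ⊙' glcomp b c ≈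
      (cid (pid x) ·' a ·' cid (pid y))
      ⊙' (lun_inv (pid x) ·' (b ⊙' c) ·' lun (pid y)).
    apply: ceq_lcomp; last exact: ecastE.
    by apply/ceq_sym; apply: ceq_trans (cidr L _) _; exact: (cidl L).
  by rewrite (ceq_tot h) -!(interchange L) !tot_ccomp !tcompA.
have -> : tot (glcomp a b ⊙' c)
  = tcomp (tot (lun_inv (pid x) ⊙' cid (pid x)))
      (tcomp (tot ((a ⊙' b) ⊙' c)) (tot (lun (pid y) ⊙' cid (pid y)))).
  have h : glcomp a b ⊙' c ≈
      (lun_inv (pid x) ·' (a ⊙' b) ·' lun (pid y))
      ⊙' (cid (pid x) ·' c ·' cid (pid y)).
    apply: ceq_lcomp; first exact: ecastE.
    by apply/ceq_sym; apply: ceq_trans (cidr L _) _; exact: (cidl L).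
  by rewrite (ceq_tot h) -!(interchange L) !tot_ccomp !tcompA.
rewrite -tri -tri' -!tcompA; congr tcomp; rewrite !tcompA; congr tcomp.
by rewrite tot_ass_nat.
Qed.

Lemma glcomp_ccomp x y z (f f' f'' : arr x y) (g g' g'' : arr y z)
  (a : cell f (pid x) (pid y) f') (a' : cell f' (pid x) (pid y) f'')
  (b : cell g (pid y) (pid z) g') (b' : cell g' (pid y) (pid z) g'') :
  glcomp a a' ·' glcomp b b' = glcomp (a ·' b) (a' ·' b').
Proof.
apply: tot_eq; rewrite tot_ccomp !tot_glcomp -(interchange L) tot_ccomp -!tcompA.
by rewrite [X in tcomp _ (tcomp _ X)]tcompA tot_lunK tcomp1l.
Qed.

Lemma glcomp_eq x y (u u' v v' : arr x y) (eu : u = u') (ev : v = v')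
  (a : cell u (pid x) (pid y) v) (b : cell u' (pid x) (pid y) v') :
  a ≈ b ->
  let eq2 := @eq_two _ (fun f g => cell f (pid x) (pid y) g) (@lid E x y) in
  glcomp a (eq2 _ _ ev) = glcomp (eq2 _ _ eu) b.
Proof.
by destruct eu, ev => /ceq_eq -> /=; rewrite glcomp1l glcomp1r.
Qed.

Definition TwoCat : twoCategory.
Proof.
refine (@TwoCategory E (@arr E) (@aid E) (@acomp E)
  (fun x y u v => cell u (pid x) (pid y) v) (@lid E) glcomp
  (fun x y z f f' g g' a b => a ·' b) (@acompA E L) (@aidl E L) (@aidr E L)
  glcompA glcomp1l glcomp1r _ _ _ _ _).
- by move=> x y z f g; rewrite (lid_acomp L).
- by move=> x y z f f' f'' g g' g'' a a' b b'; rewrite glcomp_ccomp.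
- move=> w x y z f f' g g' h h' a b c; exact/glcomp_eq/(ccompA L).
- move=> x y f f' a; apply: glcomp_eq; rewrite (lid_aid L); exact: (cidl L).
- move=> x y f f' a; apply: glcomp_eq; rewrite (lid_aid L); exact: (cidr L).
Defined.

End LooselyGlobular.

Section TwoTheory.
Variable C : twoCategory.
Local Open Scope two_scope.
Implicit Types x y z : C.

(* 2-cells with unspecified boundary, with a value [None] for the ill-typed
   composites: this turns associativity into plain equations. *)
Definition t2 x y : Type := option {f : hom x y & {g : hom x y & two f g}}.

Definition tt2 x y (f g : hom x y) (a : two f g) : t2 x y :=
  Some (existT _ f (existT _ g a)).

Definition I2 x y (f : hom x y) : t2 x y := tt2 (vid f).

Definition V2 x y (a b : t2 x y) : t2 x y :=
  match a, b with
  | Some (existT _ f (existT _ g a)), Some (existT _ g' (existT _ h b)) =>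
    match excluded_middle_informative (g' = g) with
    | left e => tt2 (a • match e in _ = g return two g h with eq_refl => b end)
    | right _ => None
    end
  | _, _ => None
  end.

Definition H2 x y z (a : t2 x y) (b : t2 y z) : t2 x z :=
  match a, b with
  | Some (existT _ f (existT _ g a)), Some (existT _ f' (existT _ g' b)) =>
    tt2 (a ∗ b)
  | _, _ => None
  end.

Lemma tt2_inj x y (f g : hom x y) (a b : two f g) : tt2 a = tt2 b -> a = b.
Proof.
move=> e; have e' : existT (fun f => {g & two f g}) f (existT _ g a)
    = existT _ f (existT _ g b) by injection e.
exact: inj_pair2 (inj_pair2 _ _ _ _ _ e').
Qed.

Lemma tt2V x y (f g h : hom x y) (a : two f g) (b : two g h) :
  tt2 (a • b) = V2 (tt2 a) (tt2 b).
Proof.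
rewrite /V2 /=; case: excluded_middle_informative => // e.
by rewrite (uip e eq_refl).
Qed.

Lemma tt2H x y z (f g : hom x y) (f' g' : hom y z) (a : two f g)
  (b : two f' g') : tt2 (a ∗ b) = H2 (tt2 a) (tt2 b).
Proof. by []. Qed.

Lemma V2A x y (a b c : t2 x y) : V2 a (V2 b c) = V2 (V2 a b) c.
Proof.
case: a => [[f [g a]]|] //; case: b => [[g' [h b]]|] //;
  case: c => [[h' [k c]]|] //=.
- case: (excluded_middle_informative (h' = h)) => [e|n];
    case: (excluded_middle_informative (g' = g)) => [e'|n'] //=.
  + destruct e, e' => /=.
    case: (excluded_middle_informative (h' = h')) => [e|] //.
    case: (excluded_middle_informative (g' = g')) => [e'|] //.
    by rewrite (uip e eq_refl) (uip e' eq_refl) vcompA.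
  + by case: (excluded_middle_informative (g' = g)).
  + by case: (excluded_middle_informative (h' = h)).
- by case: (excluded_middle_informative (g' = g)).
Qed.

Lemma tt2_eq2l x y (f g h : hom x y) (e : f = g) (a : two g h) :
  tt2 (eq2 e • a) = tt2 a.
Proof. by destruct e; rewrite /eq2 /= vcomp1l. Qed.

Lemma tt2_eq2r x y (f g h : hom x y) (e : g = h) (a : two f g) :
  tt2 (a • eq2 e) = tt2 a.
Proof. by destruct e; rewrite /eq2 /= vcomp1r. Qed.

Lemma tt2_eq2m x y (f g h k : hom x y) (e : g = h) (a : two f g)
  (b : two h k) : tt2 (a • eq2 e • b) = V2 (tt2 a) (tt2 b).
Proof. by destruct e; rewrite /eq2 /= vcomp1r tt2V. Qed.

Lemma tt2_eq2 x y (f g : hom x y) (e : f = g) : tt2 (eq2 e) = I2 f.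
Proof. by destruct e. Qed.

Lemma tt2_vid x y (f : hom x y) : tt2 (vid f) = I2 f.
Proof. by []. Qed.

Lemma I2M x y z (f : hom x y) (g : hom y z) : I2 (f · g) = H2 (I2 f) (I2 g).
Proof. by rewrite /I2 -tt2H hcomp_vid. Qed.

Lemma H2A w x y z (a : t2 w x) (b : t2 x y) (c : t2 y z) :
  H2 a (H2 b c) = H2 (H2 a b) c.
Proof.
case: a => [[f [g a]]|] //; case: b => [[g' [h b]]|] //;
  case: c => [[h' [k c]]|] //=.
by move: (hcompA a b c) => /(congr1 (@tt2 _ _ _ _)); rewrite tt2_eq2l tt2_eq2r.
Qed.

Lemma H21l x y (a : t2 x y) : H2 (I2 (hid x)) a = a.
Proof.
case: a => [[f [g a]]|] //=.
by move: (hcomp1l a) => /(congr1 (@tt2 _ _ _ _)); rewrite tt2_eq2l tt2_eq2r.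
Qed.

Lemma H21r x y (a : t2 x y) : H2 a (I2 (hid y)) = a.
Proof.
case: a => [[f [g a]]|] //=.
by move: (hcomp1r a) => /(congr1 (@tt2 _ _ _ _)); rewrite tt2_eq2l tt2_eq2r.
Qed.

Lemma V21l x y (f g : hom x y) (a : two f g) : V2 (I2 f) (tt2 a) = tt2 a.
Proof. by rewrite -tt2V vcomp1l. Qed.

Lemma V21r x y (f g : hom x y) (a : two f g) : V2 (tt2 a) (I2 g) = tt2 a.
Proof. by rewrite -tt2V vcomp1r. Qed.

Lemma V2I x y (f : hom x y) : V2 (I2 f) (I2 f) = I2 f.
Proof. exact: V21l. Qed.

Lemma whl_V x y z (f : hom x y) (g g' g'' : hom y z) (a : two g g')
  (b : two g' g'') : f ◁ (a • b) = (f ◁ a) • (f ◁ b).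
Proof. by rewrite -hcomp_vcomp vcomp1l. Qed.

Lemma whr_V x y z (f f' f'' : hom x y) (g : hom y z) (a : two f f')
  (b : two f' f'') : (a • b) ▷ g = (a ▷ g) • (b ▷ g).
Proof. by rewrite -hcomp_vcomp vcomp1l. Qed.

Lemma whl_eq2 x y z (f : hom x y) (g g' : hom y z) (e : g = g') :
  f ◁ eq2 e = eq2 (congr1 (fun h => f · h) e).
Proof. by destruct e; rewrite /eq2 /= hcomp_vid. Qed.

Lemma whr_eq2 x y z (f f' : hom x y) (g : hom y z) (e : f = f') :
  eq2 e ▷ g = eq2 (congr1 (fun h => h · g) e).
Proof. by destruct e; rewrite /eq2 /= hcomp_vid. Qed.

Definition wh := (whl_V, whr_V, whl_eq2, whr_eq2).
Definition tt2E :=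
  (tt2_eq2r, tt2_eq2m, tt2_eq2l, tt2_eq2, tt2_vid, tt2V, tt2H).

Lemma exch x y z (f f' : hom x y) (g g' : hom y z) (a : two f f')
  (b : two g g') :
  V2 (H2 (tt2 a) (I2 g)) (H2 (I2 f') (tt2 b))
  = V2 (H2 (I2 f) (tt2 b)) (H2 (tt2 a) (I2 g')).
Proof.
by rewrite -!tt2H -!tt2V -!hcomp_vcomp !vcomp1l !vcomp1r.
Qed.

Lemma exchC v w x y z t (p : hom v w) (f f' : hom w x) (q : hom x y)
  (g g' : hom y z) (r : hom z t) (a : two f f') (b : two g g') :
  V2 (H2 (I2 p) (H2 (tt2 a) (H2 (I2 q) (H2 (I2 g) (I2 r)))))
     (H2 (I2 p) (H2 (I2 f') (H2 (I2 q) (H2 (tt2 b) (I2 r)))))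
  = V2 (H2 (I2 p) (H2 (I2 f) (H2 (I2 q) (H2 (tt2 b) (I2 r)))))
       (H2 (I2 p) (H2 (tt2 a) (H2 (I2 q) (H2 (I2 g') (I2 r))))).
Proof.
by rewrite /I2 -!tt2H -!tt2V; congr tt2; rewrite -!hcomp_vcomp !vcomp1l !vcomp1r.
Qed.

Lemma exchCV v w x y z t (p : hom v w) (f f' : hom w x) (q : hom x y)
  (g g' : hom y z) (r : hom z t) (a : two f f') (b : two g g') c :
  V2 (H2 (I2 p) (H2 (tt2 a) (H2 (I2 q) (H2 (I2 g) (I2 r)))))
     (V2 (H2 (I2 p) (H2 (I2 f') (H2 (I2 q) (H2 (tt2 b) (I2 r))))) c)
  = V2 (H2 (I2 p) (H2 (I2 f) (H2 (I2 q) (H2 (tt2 b) (I2 r)))))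
       (V2 (H2 (I2 p) (H2 (tt2 a) (H2 (I2 q) (H2 (I2 g') (I2 r))))) c).
Proof. by rewrite !V2A exchC. Qed.

End TwoTheory.

Arguments tt2E {C}.
Arguments wh {C}.

Section Squares.
Variable C : twoCategory.
Local Open Scope two_scope.
Implicit Types x y z : C.

(* Square (f | h -> k | g): left f, top h, bottom k, right g. *)
Definition sq_cell x y x' y' (f : hom x x') (h : hom x y) (k : hom x' y')
  (g : hom y y') : Type := two (f · k) (h · g).

Definition sq_ccomp x y x' y' x'' y'' (f : hom x x') (h : hom x y)
    (k : hom x' y') (g : hom y y') (f' : hom x' x'') (l : hom x'' y'')
    (g' : hom y' y'') (a : sq_cell f h k g) (b : sq_cell f' k l g') :
    sq_cell (f · f') h l (g · g') :=
  eq2 (esym (homA f f' l)) • (f ◁ b) • eq2 (homA f k g') • (a ▷ g')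
  • eq2 (esym (homA h g g')).

Definition sq_lcomp x y z x' y' z' (f : hom x x') (h : hom x y)
    (k : hom x' y') (g : hom y y') (h' : hom y z) (k' : hom y' z')
    (i : hom z z') (a : sq_cell f h k g) (b : sq_cell g h' k' i) :
    sq_cell f (h · h') (k · k') i :=
  eq2 (homA f k k') • (a ▷ k') • eq2 (esym (homA h g k')) • (h ◁ b)
  • eq2 (homA h h' i).

Definition sq_data : dblData := {|
  ob := ob2 C;
  arr := @hom C;
  pro := @hom C;
  cell := sq_cell;
  aid := @hid C;
  acomp := @hom_comp C;
  pid := @hid C;
  pcomp := @hom_comp C;
  cid := fun x y h => eq2 (etrans (hom1l h) (esym (hom1r h)));
  ccomp := sq_ccomp;
  lid := fun x y f => eq2 (etrans (hom1r f) (esym (hom1l f)));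
  lcomp := sq_lcomp;
  ass := fun w x y z m n p =>
    eq2 (etrans (hom1l _) (etrans (homA m n p) (esym (hom1r _))));
  ass_inv := fun w x y z m n p =>
    eq2 (etrans (hom1l _) (etrans (esym (homA m n p)) (esym (hom1r _))));
  lun := fun x y m => eq2 (esym (hom1r _));
  lun_inv := fun x y m =>
    eq2 (etrans (hom1l _) (etrans (hom1l m) (esym (hom1r m))));
  run := fun x y m =>
    eq2 (etrans (hom1l m) (etrans (esym (hom1r m)) (esym (hom1r _))));
  run_inv := fun x y m =>
    eq2 (etrans (hom1l _) (etrans (hom1r m) (esym (hom1r m))))
|}.

Lemma sq_ceq x y x' y' (f f' : hom x x') (h h' : hom x y) (k k' : hom x' y')
  (g g' : hom y y') (a : sq_cell f h k g) (b : sq_cell f' h' k' g') :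
  f = f' -> h = h' -> k = k' -> g = g' -> tt2 a = tt2 b ->
  @ceq sq_data _ _ _ _ f h k g a f' h' k' g' b.
Proof. by move=> ef eh ek eg; destruct ef, eh, ek, eg => /tt2_inj ->. Qed.

Lemma ceq_sq x y x' y' (f f' : hom x x') (h h' : hom x y) (k k' : hom x' y')
  (g g' : hom y y') (a : sq_cell f h k g) (b : sq_cell f' h' k' g') :
  @ceq sq_data _ _ _ _ f h k g a f' h' k' g' b ->
  tt2 a = tt2 b.
Proof. by case. Qed.

Lemma tt2_ccomp x y x' y' x'' y'' (f : hom x x') (h : hom x y)
  (k : hom x' y') (g : hom y y') (f' : hom x' x'') (l : hom x'' y'')
  (g' : hom y' y'') (a : sq_cell f h k g) (b : sq_cell f' k l g') :
  tt2 (sq_ccomp a b) = V2 (H2 (I2 f) (tt2 b)) (H2 (tt2 a) (I2 g')).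
Proof. by rewrite /sq_ccomp !tt2E. Qed.

Lemma tt2_lcomp x y z x' y' z' (f : hom x x') (h : hom x y)
  (k : hom x' y') (g : hom y y') (h' : hom y z) (k' : hom y' z')
  (i : hom z z') (a : sq_cell f h k g) (b : sq_cell g h' k' i) :
  tt2 (sq_lcomp a b) = V2 (H2 (tt2 a) (I2 k')) (H2 (I2 h) (tt2 b)).
Proof. by rewrite /sq_lcomp !tt2E. Qed.

Lemma V2_src x y (f g h : hom x y) (a : two f g) :
  h = f -> V2 (I2 h) (tt2 a) = tt2 a.
Proof. by move=> ->; exact: V21l. Qed.

Lemma V2_tgt x y (f g h : hom x y) (a : two f g) :
  h = g -> V2 (tt2 a) (I2 h) = tt2 a.
Proof. by move=> ->; exact: V21r. Qed.

Local Ltac nf2 :=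
  rewrite /sq_ccomp /sq_lcomp ?wh ?tt2E ?H21l ?H21r ?I2M ?H21l ?H21r
    -?H2A -?V2A.

Lemma sq_laws : dblLaws sq_data.
Proof.
split=> /=; [by move=> *; exact: homA|by move=> *; exact: hom1l|by move=> *; exact: hom1r|..].
all: intros; try (apply: sq_ceq=>//).
all: rewrite ?hom1l ?hom1r ?homA //.
all: try apply: tt2_inj; nf2.
all: try by [].
all: rewrite ?V2I.
all: try by [].
- by rewrite -I2M V21l.
- congr V2; rewrite 2!V2A; congr V2.
  by move: (exch a d); rewrite !I2M -!H2A => ->.
- rewrite V2A; congr V2.
  move: (V21l (a ▷ (n' · p'))); by rewrite tt2H !tt2_vid !I2M -!H2A.
- by rewrite -I2M !V21l.
- by rewrite -I2M V21l.
- by rewrite -!I2M !V2I.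
Qed.

End Squares.

(* [l] is left adjoint to [r]; the paddings by [eq2] are the strict
   associativity and unit equations of 1-cells. *)
Record isAdj (C : twoCategory) (x y : C) (l : hom x y) (r : hom y x) : Type :=
  IsAdj {
    adj_unit : two (hid x) (l · r)%two;
    adj_counit : two (r · l)%two (hid y);
    adj_tri_l :
      (eq2 (esym (hom1l l)) • (adj_unit ▷ l) • eq2 (esym (homA l r l))
       • (l ◁ adj_counit) • eq2 (hom1r l) = vid l)%two;
    adj_tri_r :
      (eq2 (esym (hom1r r)) • (r ◁ adj_unit) • eq2 (homA r l r)
       • (adj_counit ▷ r) • eq2 (hom1l r) = vid r)%two
  }.

Record adjunction (C : twoCategory) (x y : C) : Type := Adjunction {
  ladj : hom x y;
  radj : hom y x;
  adjP : isAdj ladj radj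
}.

Section Adjunctions.
Variable C : twoCategory.
Local Open Scope two_scope.
Implicit Types x y z : C.

Local Notation "'η' m" := (adj_unit (adjP m)) (at level 9, m at level 0).
Local Notation "'ε' m" := (adj_counit (adjP m)) (at level 9, m at level 0).

Lemma tt2_tri_l x y (l : hom x y) (r : hom y x) (m : isAdj l r) :
  V2 (H2 (tt2 (adj_unit m)) (I2 l)) (H2 (I2 l) (tt2 (adj_counit m))) = I2 l.
Proof. by move: (congr1 (@tt2 _ _ _ _ _) (adj_tri_l m)); rewrite !tt2E. Qed.

Lemma tt2_tri_r x y (l : hom x y) (r : hom y x) (m : isAdj l r) :
  V2 (H2 (I2 r) (tt2 (adj_unit m))) (H2 (tt2 (adj_counit m)) (I2 r)) = I2 r.
Proof. by move: (congr1 (@tt2 _ _ _ _ _) (adj_tri_r m)); rewrite !tt2E. Qed.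

Lemma triC w x y z (l : hom x y) (r : hom y x) (m : isAdj l r)
  (p : hom w x) (q : hom y z) :
  V2 (H2 (I2 p) (H2 (tt2 (adj_unit m)) (H2 (I2 l) (I2 q))))
     (H2 (I2 p) (H2 (I2 l) (H2 (tt2 (adj_counit m)) (I2 q))))
  = H2 (I2 p) (H2 (I2 l) (I2 q)).
Proof.
move: (congr1 (fun a => tt2 (p ◁ a ▷ q)) (adj_tri_l m)).
by rewrite !wh !tt2E -?H2A.
Qed.

Lemma triRC w x y z (l : hom x y) (r : hom y x) (m : isAdj l r)
  (p : hom w y) (q : hom x z) :
  V2 (H2 (I2 p) (H2 (I2 r) (H2 (tt2 (adj_unit m)) (I2 q))))
     (H2 (I2 p) (H2 (tt2 (adj_counit m)) (H2 (I2 r) (I2 q))))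
  = H2 (I2 p) (H2 (I2 r) (I2 q)).
Proof.
move: (congr1 (fun a => tt2 (p ◁ a ▷ q)) (adj_tri_r m)).
by rewrite !wh !tt2E -?H2A.
Qed.

Definition id_isAdj x : isAdj (hid x) (hid x).
Proof.
refine (@IsAdj _ _ _ _ _ (eq2 (esym (hom1l (hid x)))) (eq2 (hom1l (hid x))) _ _).
- by apply: tt2_inj; rewrite ?wh ?tt2E ?I2M ?H21l ?H21r ?V2I.
- by apply: tt2_inj; rewrite ?wh ?tt2E ?I2M ?H21l ?H21r ?V2I.
Defined.

Section Composition.
Variables (x y z : C) (l : hom x y) (r : hom y x) (l' : hom y z) (r' : hom z y).
Variables (m : isAdj l r) (m' : isAdj l' r').

Definition comp_unit : two (hid x) ((l · l') · (r' · r)) :=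
  adj_unit m
  • (l ◁ (eq2 (esym (hom1l r)) • (adj_unit m' ▷ r) • eq2 (esym (homA l' r' r))))
  • eq2 (homA l l' (r' · r)).

Definition comp_counit : two ((r' · r) · (l · l')) (hid z) :=
  eq2 (esym (homA r' r (l · l')))
  • (r' ◁ (eq2 (homA r l l') • (adj_counit m ▷ l') • eq2 (hom1l l')))
  • adj_counit m'.

Lemma tt2_comp_unit : tt2 comp_unit =
  V2 (tt2 (adj_unit m)) (H2 (I2 l) (H2 (tt2 (adj_unit m')) (I2 r))).
Proof. by rewrite /comp_unit !wh !tt2E. Qed.

Lemma tt2_comp_counit : tt2 comp_counit =
  V2 (H2 (I2 r') (H2 (tt2 (adj_counit m)) (I2 l'))) (tt2 (adj_counit m')).
Proof. by rewrite /comp_counit !wh !tt2E. Qed.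

Lemma comp_tri_l :
  eq2 (esym (hom1l _)) • (comp_unit ▷ (l · l')) • eq2 (esym (homA _ _ _))
  • ((l · l') ◁ comp_counit) • eq2 (hom1r _) = vid (l · l').
Proof.
apply: tt2_inj; rewrite /comp_unit /comp_counit !wh !tt2E !I2M -!H2A -!V2A.
have := exchCV l (hid y) l' (adj_unit m') (adj_counit m).
rewrite !I2M !H21l -!H2A => ->; rewrite V2A.
have := triC m (hid x) l'; rewrite !H21l => ->.
have := triC m' l (hid z); rewrite !H21r => e.
by rewrite e -I2M V2I.
Qed.

Lemma comp_tri_r :
  eq2 (esym (hom1r _)) • ((r' · r) ◁ comp_unit) • eq2 (homA _ _ _)
  • (comp_counit ▷ (r' · r)) • eq2 (hom1l _) = vid (r' · r).
Proof.
apply: tt2_inj; rewrite /comp_unit /comp_counit !wh !tt2E !I2M -!H2A -!V2A.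
have := exchCV r' (hid y) r (adj_counit m) (adj_unit m').
rewrite !I2M !H21l -!H2A => <-; rewrite V2A.
have := triRC m r' (hid x); rewrite !H21r => ->.
have := triRC m' (hid z) r; rewrite !H21l => e.
by rewrite e -I2M V2I.
Qed.

Definition comp_isAdj : isAdj (l · l') (r' · r) :=
  IsAdj comp_tri_l comp_tri_r.

End Composition.

Definition id_adj x : adjunction x x := Adjunction (id_isAdj x).

Definition comp_adj x y z (m : adjunction x y) (n : adjunction y z) :
  adjunction x z := Adjunction (comp_isAdj (adjP m) (adjP n)).

(* The mate r·f => g·r' of a 2-cell f·l' => l·g, for l ⊣ r and l' ⊣ r':
   r·f => r·f·l'·r' => r·l·g·r' => g·r'. *)
Definition mate x y x' y' (f : hom x x') (m : adjunction x y)
    (n : adjunction x' y') (g : hom y y')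
    (s : two (f · ladj n) (ladj m · g)) : two (radj m · f) (g · radj n) :=
  let l := ladj m in let r := radj m in
  let l' := ladj n in let r' := radj n in
  eq2 (esym (hom1r (r · f))) • ((r · f) ◁ η n)
  • eq2 (etrans (homA (r · f) l' r')
           (congr1 (fun h => h · r') (esym (homA r f l'))))
  • ((r ◁ s) ▷ r')
  • eq2 (etrans (congr1 (fun h => h · r') (homA r l g))
           (esym (homA (r · l) g r')))
  • (ε m ▷ (g · r')) • eq2 (hom1l (g · r')).

Record mates x y x' y' (f : hom x x') (m : adjunction x y)
    (n : adjunction x' y') (g : hom y y') : Type := Mates {
  mleft : two (f · ladj n) (ladj m · g);
  mright : two (radj m · f) (g · radj n);
  mateP : mright = mate mleft
}.

Lemma tt2_mate x y x' y' (f : hom x x') (m : adjunction x y)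
  (n : adjunction x' y') (g : hom y y')
  (s : two (f · ladj n) (ladj m · g)) :
  tt2 (mate s) =
  V2 (H2 (I2 (radj m)) (H2 (I2 f) (tt2 (η n))))
     (V2 (H2 (I2 (radj m)) (H2 (tt2 s) (I2 (radj n))))
         (H2 (tt2 (ε m)) (H2 (I2 g) (I2 (radj n))))).
Proof. by rewrite /mate !tt2E !I2M -?H2A -?V2A. Qed.

Lemma mates_eq x y x' y' (f : hom x x') (m : adjunction x y)
  (n : adjunction x' y') (g : hom y y') (a b : mates f m n g) :
  mleft a = mleft b -> a = b.
Proof.
by case: a b => [a a' ea] [b b' eb] /= e; subst b; subst a'; subst b'.
Qed.

Lemma mate_eq2 x y (m n : adjunction x y) (e : hid x · ladj n = ladj m · hid y)
  (e' : radj m · hid x = hid y · radj n) :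
  tt2 (ε m) = tt2 (ε n) ->
  eq2 e' = mate (eq2 e).
Proof.
move=> e2; apply: tt2_inj; rewrite tt2_mate !tt2E !I2M !H21l.
have el : ladj m = ladj n by rewrite -[LHS]hom1r -e hom1l.
have er : radj m = radj n by rewrite -[LHS]hom1r e' hom1l.
rewrite e2 er H21r.
have := triRC (adjP n) (hid y) (hid x); rewrite !H21l !H21r => h.
rewrite -{1}h; congr V2.
rewrite -[H2 (tt2 _) (I2 _)]tt2H -!I2M V2_src // homA //.
Qed.

Lemma mateK x y x' y' (f : hom x x') (m : adjunction x y)
  (n : adjunction x' y') (g : hom y y') (a : mates f m n g) :
  (mright a ▷ ladj n) • eq2 (esym (homA _ _ _)) • (g ◁ ε n) • eq2 (hom1r g)
  = eq2 (esym (homA _ _ _)) • (radj m ◁ mleft a) • eq2 (homA _ _ _)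
    • (ε m ▷ g) • eq2 (hom1l g).
Proof.
apply: tt2_inj; rewrite (mateP a) /mate !wh !tt2E !I2M -!H2A -!V2A.
have := exchC (hid y) g (hid y') (ε m) (ε n).
rewrite !I2M !H21l !H21r -!H2A => ->.
have := exchCV (radj m) (hid y') (hid y') (mleft a) (ε n).
rewrite !I2M !H21l !H21r -!H2A => ->; rewrite V2A.
have := triC (adjP n) (radj m · f) (hid y'); rewrite !I2M !H21r -!H2A => ->.
by rewrite V2A -!I2M -tt2H V21l.
Qed.

Lemma cid_mateP x y (m : adjunction x y) :
  eq2 (etrans (hom1r (radj m)) (esym (hom1l (radj m))))
  = mate (m := m) (n := m) (eq2 (etrans (hom1l (ladj m)) (esym (hom1r (ladj m))))).
Proof. exact: mate_eq2. Qed.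

Lemma lid_mateP x y (f : hom x y) :
  eq2 (etrans (hom1l f) (esym (hom1r f)))
  = mate (m := id_adj x) (n := id_adj y) (eq2 (etrans (hom1r f) (esym (hom1l f)))).
Proof.
by apply: tt2_inj; rewrite /mate /= ?wh !tt2E ?I2M ?H21l ?H21r ?H21l ?H21r ?V2I.
Qed.

Definition right_ccomp x y x' y' x'' y'' (f : hom x x') (r : hom y x)
    (r' : hom y' x') (g : hom y y') (f' : hom x' x'') (r'' : hom y'' x'')
    (g' : hom y' y'') (a : two (r · f) (g · r')) (b : two (r' · f') (g' · r'')) :
    two (r · (f · f')) ((g · g') · r'') :=
  eq2 (homA r f f') • (a ▷ f') • eq2 (esym (homA g r' f')) • (g ◁ b)
  • eq2 (homA g g' r'').

Lemma ccomp_mateP x y x' y' x'' y'' (f : hom x x') (m : adjunction x y)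
  (n : adjunction x' y') (g : hom y y') (f' : hom x' x'')
  (p : adjunction x'' y'') (g' : hom y' y'') (a : mates f m n g)
  (b : mates f' n p g') :
  right_ccomp (mright a) (mright b) = mate (sq_ccomp (mleft a) (mleft b)).
Proof.
apply: tt2_inj; rewrite [in RHS]/mate /right_ccomp /sq_ccomp (mateP b) /mate.
rewrite !wh !tt2E !I2M -!H2A -!V2A.
have := exchCV (hid y) f' (hid x'') (mright a) (η p).
rewrite !I2M ?H21l ?H21r -?H2A => ->; congr V2.
have := exchCV (hid y) (hid x') (radj p) (mright a) (mleft b).
rewrite !I2M ?H21l -?H2A => ->; congr V2.
move: (congr1 (fun c => tt2 (c ▷ (g' · radj p))) (mateK a)).
by rewrite !wh !tt2E !I2M -?H2A => ->.
Qed.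

Definition right_lcomp x y z x' y' z' (f : hom x x') (r : hom y x)
    (r' : hom y' x') (g : hom y y') (s : hom z y) (s' : hom z' y')
    (h : hom z z') (a : two (r · f) (g · r')) (b : two (s · g) (h · s')) :
    two ((s · r) · f) (h · (s' · r')) :=
  eq2 (esym (homA s r f)) • (s ◁ a) • eq2 (homA s g r') • (b ▷ r')
  • eq2 (esym (homA h s' r')).

Lemma lcomp_mateP x y z x' y' z' (f : hom x x') (m : adjunction x y)
  (m' : adjunction x' y') (g : hom y y') (n : adjunction y z)
  (n' : adjunction y' z') (h : hom z z') (a : mates f m m' g)
  (b : mates g n n' h) :
  right_lcomp (mright a) (mright b)
  = mate (m := comp_adj m n) (n := comp_adj m' n')
      (sq_lcomp (mleft a) (mleft b)).
Proof.
apply: tt2_inj.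
rewrite /mate /right_lcomp /sq_lcomp (mateP b) (mateP a) /mate /= /comp_unit /comp_counit.
rewrite !wh !tt2E !I2M -!H2A -!V2A.
congr V2.
have := exchCV (radj n) g (radj m') (ε m) (η n').
rewrite !I2M ?H21l -?H2A => ->.
have := exchCV (radj n · radj m) (hid y') (radj m') (mleft a) (η n').
rewrite !I2M ?H21l -?H2A => ->.
have := exchCV (radj n) (hid y) (radj n' · radj m') (ε m) (mleft b).
by rewrite !I2M ?H21l -?H2A => ->.
Qed.

Lemma tt2_comp_adjA w x y z (m : adjunction w x) (n : adjunction x y)
  (p : adjunction y z) :
  tt2 (ε (comp_adj (comp_adj m n) p)) = tt2 (ε (comp_adj m (comp_adj n p))).
Proof.
by rewrite /= /comp_counit !wh !tt2E !I2M -?H2A -?V2A /= /comp_counit ?wh ?tt2E.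
Qed.

Lemma tt2_comp_adj1l x y (m : adjunction x y) :
  tt2 (ε (comp_adj (id_adj x) m)) = tt2 (ε m).
Proof.
by rewrite /= /comp_counit !wh !tt2E ?I2M ?H21l ?H21r -I2M V21l.
Qed.

Lemma tt2_comp_adj1r x y (m : adjunction x y) :
  tt2 (ε (comp_adj m (id_adj y))) = tt2 (ε m).
Proof.
by rewrite /= /comp_counit !wh !tt2E ?I2M ?H21l ?H21r V21r.
Qed.

Definition adj_ass w x y z (m : adjunction w x) (n : adjunction x y)
    (p : adjunction y z) : mates (hid w) (comp_adj (comp_adj m n) p)
                             (comp_adj m (comp_adj n p)) (hid z) :=
  Mates (mate_eq2
    (m := comp_adj (comp_adj m n) p) (n := comp_adj m (comp_adj n p))
    (etrans (hom1l _) (etrans (homA _ _ _) (esym (hom1r _))))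
    (etrans (hom1r _) (etrans (homA _ _ _) (esym (hom1l _))))
    (tt2_comp_adjA m n p)).

Definition adj_ass_inv w x y z (m : adjunction w x) (n : adjunction x y)
    (p : adjunction y z) : mates (hid w) (comp_adj m (comp_adj n p))
                             (comp_adj (comp_adj m n) p) (hid z) :=
  Mates (mate_eq2
    (m := comp_adj m (comp_adj n p)) (n := comp_adj (comp_adj m n) p)
    (etrans (hom1l _) (etrans (esym (homA _ _ _)) (esym (hom1r _))))
    (etrans (hom1r _) (etrans (esym (homA _ _ _)) (esym (hom1l _))))
    (esym (tt2_comp_adjA m n p))).

Definition adj_lun x y (m : adjunction x y) :
    mates (hid x) (comp_adj (id_adj x) m) m (hid y) :=
  Mates (mate_eq2 (m := comp_adj (id_adj x) m) (n := m)
    (esym (hom1r _)) (etrans (hom1r _) (etrans (hom1r _) (esym (hom1l _))))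
    (tt2_comp_adj1l m)).

Definition adj_lun_inv x y (m : adjunction x y) :
    mates (hid x) m (comp_adj (id_adj x) m) (hid y) :=
  Mates (mate_eq2 (m := m) (n := comp_adj (id_adj x) m)
    (etrans (hom1l _) (etrans (hom1l _) (esym (hom1r _))))
    (etrans (hom1r _) (etrans (esym (hom1r _)) (esym (hom1l _))))
    (esym (tt2_comp_adj1l m))).

Definition adj_run x y (m : adjunction x y) :
    mates (hid x) (comp_adj m (id_adj y)) m (hid y) :=
  Mates (mate_eq2 (m := comp_adj m (id_adj y)) (n := m)
    (etrans (hom1l _) (etrans (esym (hom1r _)) (esym (hom1r _))))
    (hom1r _) (tt2_comp_adj1r m)).

Definition adj_run_inv x y (m : adjunction x y) :
    mates (hid x) m (comp_adj m (id_adj y)) (hid y) :=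
  Mates (mate_eq2 (m := m) (n := comp_adj m (id_adj y))
    (etrans (hom1l _) (etrans (hom1r _) (esym (hom1r _))))
    (etrans (hom1r _) (etrans (esym (hom1l _)) (esym (hom1l _))))
    (esym (tt2_comp_adj1r m))).

Definition adj_data : dblData := {|
  ob := ob2 C;
  arr := @hom C;
  pro := @adjunction C;
  cell := mates;
  aid := @hid C;
  acomp := @hom_comp C;
  pid := id_adj;
  pcomp := comp_adj;
  cid := fun x y m => Mates (cid_mateP m);
  ccomp := fun x y x' y' x'' y'' f m n g f' p g' a b => Mates (ccomp_mateP a b);
  lid := fun x y f => Mates (m := id_adj x) (n := id_adj y) (lid_mateP f);
  lcomp := fun x y z x' y' z' f m m' g n n' h a b =>
    Mates (m := comp_adj m n) (n := comp_adj m' n') (lcomp_mateP a b);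
  ass := adj_ass;
  ass_inv := adj_ass_inv;
  lun := adj_lun;
  lun_inv := adj_lun_inv;
  run := adj_run;
  run_inv := adj_run_inv
|}.

(* An equation of mate pairs is an equation of squares between left adjoints. *)
Lemma adj_ceq x y x' y' (f f' : hom x x') (m : adjunction x y)
  (n : adjunction x' y') (g g' : hom y y') (a : mates f m n g)
  (b : mates f' m n g') :
  f = f' -> g = g' ->
  @ceq (sq_data C) _ _ _ _ f (ladj m) (ladj n) g (mleft a)
     f' (ladj m) (ladj n) g' (mleft b) ->
  @ceq adj_data _ _ _ _ f m n g a f' m n g' b.
Proof.
move=> ef eg; destruct ef, eg => /ceq_sq /tt2_inj /mates_eq -> //.
Qed.

Lemma adj_laws : dblLaws adj_data.
Proof.
split=> /=.
- by move=> *; exact: homA.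
- by move=> *; exact: hom1l.
- by move=> *; exact: hom1r.
- move=> *; apply: adj_ceq; try exact: homA; exact: (ccompA (sq_laws C)).
- move=> *; apply: adj_ceq; try exact: hom1l; exact: (cidl (sq_laws C)).
- move=> *; apply: adj_ceq; try exact: hom1r; exact: (cidr (sq_laws C)).
- move=> *; apply: mates_eq; exact: (lid_aid (sq_laws C)).
- move=> *; apply: mates_eq; exact: (lid_acomp (sq_laws C)).
- move=> *; apply: mates_eq; exact: (lcomp_cid (sq_laws C)).
- move=> *; apply: mates_eq; exact: (interchange (sq_laws C)).
- move=> *; apply: adj_ceq; try exact: hom1l; exact: (assK (sq_laws C)).
- move=> *; apply: adj_ceq; try exact: hom1l; exact: (ass_invK (sq_laws C)).
- move=> *; apply: adj_ceq; try exact: hom1l; exact: (lunK (sq_laws C)).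
- move=> *; apply: adj_ceq; try exact: hom1l; exact: (lun_invK (sq_laws C)).
- move=> *; apply: adj_ceq; try exact: hom1l; exact: (runK (sq_laws C)).
- move=> *; apply: adj_ceq; try exact: hom1l; exact: (run_invK (sq_laws C)).
- move=> *; apply: adj_ceq; try by rewrite hom1l hom1r.
  exact: (ass_nat (sq_laws C)).
- move=> *; apply: adj_ceq; try by rewrite hom1l hom1r.
  exact: (lun_nat (sq_laws C)).
- move=> *; apply: adj_ceq; try by rewrite hom1l hom1r.
  exact: (run_nat (sq_laws C)).
- move=> *; apply: adj_ceq; try by rewrite !hom1l.
  exact: (pentagon (sq_laws C)).
- move=> *; apply: adj_ceq; try by rewrite !hom1l.
  exact: (triangle (sq_laws C)).
Qed.

End Adjunctions.

Definition Sq (C : twoCategory) : doubleCat := DoubleCat (sq_laws C).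
Definition Adj (C : twoCategory) : doubleCat := DoubleCat (adj_laws C).

Record twBase (D E : doubleCat) := TwBase {
  tw_ob : D -> E;
  tw_arr : forall x y : D, arr x y -> pro (tw_ob x) (tw_ob y);
  tw_pro : forall x y : D, pro x y -> arr (tw_ob x) (tw_ob y)
}.

Arguments tw_ob {D E} t x.
Arguments tw_arr {D E} t {x y} f.
Arguments tw_pro {D E} t {x y} m.

Section UnitCasts.
Variable E : doubleCat.
Let L := dbl_laws E.
Variables (x y x' y' : E) (f : arr x x') (m : pro x y) (n : pro x' y')
  (g : arr y y').

Definition unitl (a : cell (aid x · f) m n (aid y · g)) : cell f m n g :=
  ecast (aidl L f) (aidl L g) a.
Definition unitr (a : cell (f · aid x') m n (g · aid y')) : cell f m n g :=
  ecast (aidr L f) (aidr L g) a.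
End UnitCasts.

(* The canonical cell (id ⊙ id) ⊙ n -> n. *)
Definition lun2 (E : doubleCat) (x y : E) (n : pro x y) :=
  (lun (pid x) ⊙' cid n) ·' lun n.

(* Twisted doubly lax functors, from cells (f | m -> n | g) to cells
   (F m | F f -> F g | F n).  Where the two sides of an equation have top or
   bottom proarrows that differ by unitors or associators of E, these are
   inserted. *)
Record twFunctor (D E : doubleCat) := TwFunctor {
  tw_base :> twBase D E;
  tw_cell : forall (x y x' y' : D) (f : arr x x') (m : pro x y)
      (n : pro x' y') (g : arr y y'), cell f m n g ->
    cell (tw_pro tw_base m) (tw_arr tw_base f) (tw_arr tw_base g)
         (tw_pro tw_base n);
  (* tight-to-loose comparison cells F_{f,g} and F_x *)
  tw_acomp : forall (x y z : D) (f : arr x y) (g : arr y z),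
    cell (aid (tw_ob tw_base x)) (tw_arr tw_base f ⊙ tw_arr tw_base g)
         (tw_arr tw_base (f · g)) (aid (tw_ob tw_base z));
  tw_aid : forall x : D,
    cell (aid (tw_ob tw_base x)) (pid (tw_ob tw_base x))
         (tw_arr tw_base (aid x)) (aid (tw_ob tw_base x));
  (* loose-to-tight comparison cells F^{m,n} and F^x *)
  tw_pcomp : forall (x y z : D) (m : pro x y) (n : pro y z),
    cell (tw_pro tw_base m · tw_pro tw_base n) (pid (tw_ob tw_base x))
         (pid (tw_ob tw_base z)) (tw_pro tw_base (m ⊙ n));
  tw_pid : forall x : D,
    cell (aid (tw_ob tw_base x)) (pid (tw_ob tw_base x))
         (pid (tw_ob tw_base x)) (tw_pro tw_base (pid x));
  tw_cell_ccomp : forall (x y x' y' x'' y'' : D)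
      (m : pro x y) (n : pro x' y') (p : pro x'' y'')
      (f : arr x x') (f' : arr y y') (g : arr x' x'') (g' : arr y' y'')
      (a : cell f m n f') (b : cell g n p g'),
    (tw_cell a ⊙' tw_cell b) ·' tw_acomp f' g'
    ≈ tw_acomp f g ·' tw_cell (a ·' b);
  tw_cell_cid : forall (x y : D) (m : pro x y),
    lid (tw_pro tw_base m) ·' tw_aid y ≈ tw_aid x ·' tw_cell (cid m);
  tw_cell_lcomp : forall (x y z x' y' z' : D)
      (m : pro x y) (m' : pro x' y') (n : pro y z) (n' : pro y' z')
      (f : arr x x') (g : arr y y') (h : arr z z')
      (a : cell f m m' g) (b : cell g n n' h),
    run_inv (tw_arr tw_base f)
      ·' ((tw_cell a ·' tw_cell b) ⊙' tw_pcomp m' n')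
      ·' run (tw_arr tw_base h)
    ≈ lun_inv (tw_arr tw_base f)
      ·' (tw_pcomp m n ⊙' tw_cell (a ⊙' b))
      ·' lun (tw_arr tw_base h);
  tw_cell_lid : forall (x y : D) (f : arr x y),
    run_inv (tw_arr tw_base f)
      ·' (cid (tw_arr tw_base f) ⊙' tw_pid y)
      ·' run (tw_arr tw_base f)
    ≈ lun_inv (tw_arr tw_base f)
      ·' (tw_pid x ⊙' tw_cell (lid f))
      ·' lun (tw_arr tw_base f);
  tw_acompA : forall (w x y z : D) (f : arr w x) (g : arr x y) (h : arr y z),
    (tw_acomp f g ⊙' cid (tw_arr tw_base h)) ·' tw_acomp (f · g) h
    ≈ ass (tw_arr tw_base f) (tw_arr tw_base g) (tw_arr tw_base h)
      ·' ((cid (tw_arr tw_base f) ⊙' tw_acomp g h) ·' tw_acomp f (g · h));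
  tw_acomp1l : forall (x y : D) (f : arr x y),
    (tw_aid x ⊙' cid (tw_arr tw_base f)) ·' tw_acomp (aid x) f
    ≈ lun (tw_arr tw_base f);
  tw_acomp1r : forall (x y : D) (f : arr x y),
    (cid (tw_arr tw_base f) ⊙' tw_aid y) ·' tw_acomp f (aid y)
    ≈ run (tw_arr tw_base f);
  tw_pcompA : forall (w x y z : D) (m : pro w x) (n : pro x y) (p : pro y z),
    ((tw_pcomp m n ·' lid (tw_pro tw_base p)) ⊙' tw_pcomp (m ⊙ n) p)
      ⊙' unitl (tw_aid w ·' tw_cell (ass m n p))
    ≈ ((lid (tw_pro tw_base m) ·' tw_pcomp n p) ⊙' tw_pcomp m (n ⊙ p))
      ⊙' unitr (lid (tw_pro tw_base (m ⊙ (n ⊙ p))) ·' tw_aid z);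
  tw_pcomp1l : forall (x y : D) (m : pro x y),
    (((tw_pid x ·' lid (tw_pro tw_base m)) ⊙' tw_pcomp (pid x) m)
      ⊙' unitl (tw_aid x ·' tw_cell (lun m))) ·' lun2 (tw_arr tw_base (aid y))
    ≈ lun2 (pid (tw_ob tw_base x))
      ·' (lid (tw_pro tw_base m) ·' tw_aid y);
  tw_pcomp1r : forall (x y : D) (m : pro x y),
    (((lid (tw_pro tw_base m) ·' tw_pid y) ⊙' tw_pcomp m (pid y))
      ⊙' unitl (tw_aid x ·' tw_cell (run m))) ·' lun2 (tw_arr tw_base (aid y))
    ≈ lun2 (pid (tw_ob tw_base x))
      ·' (lid (tw_pro tw_base m) ·' tw_aid y)
}.

Definition tight_invertible (E : doubleCat) (x y : E) (m n : pro x y)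
    (a : cell (aid x) m n (aid y)) : Prop :=
  exists b : cell (aid x) n m (aid y), a ·' b ≈ cid m /\ b ·' a ≈ cid n.

Definition loose_invertible (E : doubleCat) (x y : E) (u v : arr x y)
    (a : cell u (pid x) (pid y) v) : Prop :=
  exists b : cell v (pid x) (pid y) u,
    glcomp a b = lid u /\ glcomp b a = lid v.

Definition tw_lax (D E : doubleCat) (F : twFunctor D E) : Prop :=
  (forall (x y z : D) (m : pro x y) (n : pro y z),
     loose_invertible (tw_pcomp F m n)) /\
  (forall x : D, loose_invertible (tw_pid F x)).

Definition tw_normal (D E : doubleCat) (F : twFunctor D E) : Prop :=
  forall x : D, tight_invertible (tw_aid F x).

Definition tw_pseudo (D E : doubleCat) (F : twFunctor D E) : Prop :=
  [/\ tw_lax F,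
      forall (x y z : D) (f : arr x y) (g : arr y z),
        tight_invertible (tw_acomp F f g)
    & forall x : D, tight_invertible (tw_aid F x)].

Record companion (D : doubleCat) (x y : D) (f : arr x y) := Companion {
  cmp_pro : pro x y;
  cmp_unit : cell (aid x) (pid x) cmp_pro f;
  cmp_counit : cell f cmp_pro (pid y) (aid y);
  cmp_tight : cmp_unit ·' cmp_counit ≈ lid f;
  cmp_loose : (cmp_unit ⊙' cmp_counit) ·' run cmp_pro ≈ lun cmp_pro
}.

Record conjoint (D : doubleCat) (x y : D) (f : arr x y) := Conjoint {
  cnj_pro : pro y x;
  cnj_unit : cell f (pid x) cnj_pro (aid x);
  cnj_counit : cell (aid y) cnj_pro (pid y) f;
  cnj_tight : cnj_unit ·' cnj_counit ≈ lid f;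
  cnj_loose : (cnj_counit ⊙' cnj_unit) ·' lun cnj_pro ≈ run cnj_pro
}.

(* Data rather than existence: the chosen companions and conjoints matter. *)
Definition has_companions (D : doubleCat) : Type :=
  forall (x y : D) (f : arr x y), companion f.

Definition has_conjoints (D : doubleCat) : Type :=
  forall (x y : D) (f : arr x y), conjoint f.

(* Main.v *)
(* A twisted functor turns a companion f_! of f around: applying F to its unit and
   counit, and removing the comparisons F^x, F_x, which are invertible by laxness
   and normality, exhibits the proarrow Ff as a companion of the arrow F(f_!) in E.
   Cells between companions transpose to 2-cells of TwoCat E, compatibly with both
   compositions and all constraints, so transposing F cellwise yields the twisted
   functor to squares.  It is pseudo because the companion equations of f make
   each F_{f,g} invertible.  For conjoints the same construction is applied to the dual
   of F, from D^op to E^co.  On an equipment Ff is at once a companion of F(f_!)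
   and a conjoint of F(f^* ), whence F(f_!) -| F(f^* ), and a square between left
   adjoints determines its mate. *)
From Corelib Require Import ssreflect ssrbool ssrfun.
From Stdlib Require Import ClassicalEpsilon.
Require Import Defs.

Set Implicit Arguments.
Unset Strict Implicit.
Unset Printing Implicit Defensive.

Local Open Scope dbl_scope.

(** * Tight composition and whiskering with globular cells *)

(** Twisting exchanges the two compositions, so the companion equations swap roles. The tight
    equation of f yields the loose equation of Ff by naturality of F_{f,g}. The loose equation of f
    involves unitors; their images are controlled by the unit laws of F^{m,n}, and the outcome is
    the tight equation of Ff.

    The main obstacle is typing: arrows compose strictly only up to equality, while loose
    composition has genuine unitors. Composition with a globular cell, tight or loose, is therefore
    packaged with its casts and unitors into operations that keep the other boundaries fixed ([pre],
    [post], [whl], [whr]). They satisfy strict action laws, so the laws of F become plain equations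
    for rewriting. Where boundaries really differ, computation passes to [tot] in E or [tt2] in a
    2-category.

    Dualising is not formal either: reversing proarrows reverses loosely globular cells, so the dual
    functor takes the inverses of F^{m,n} and F^x as comparison cells, and their coherence laws are
    obtained by inverting those of F. *)

Lemma co_ceq (D : dblData) (x y x' y' : D) (f f' : arr x x') (m m' : pro y x)
  (n n' : pro y' x') (g g' : arr y y') (a : cell g m n f)
  (b : cell g' m' n' f') :
  @ceq (co_data D) x y x' y' f m n g a f' m' n' g' b -> a ≈ b.
Proof. by case. Qed.

Section Whiskering.
Variable E : doubleCat.
Implicit Types x y z : E.
Let L := dbl_laws E.

(** The cast absorbs the identity arrows that tight composition adds to the sides, so both sides of
    an equation keep the same type and Leibniz rewriting applies. *)
Definition pre x y x' y' (f : arr x x') (m m' : pro x y) (n : pro x' y')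
    (g : arr y y') (i : cell (aid x) m m' (aid y)) (a : cell f m' n g) :
    cell f m n g :=
  unitl (i ·' a).

Definition post x y x' y' (f : arr x x') (m : pro x y) (n n' : pro x' y')
    (g : arr y y') (a : cell f m n g) (j : cell (aid x') n n' (aid y')) :
    cell f m n' g :=
  unitr (a ·' j).

Lemma tot_unitl x y x' y' (f : arr x x') (m : pro x y) (n : pro x' y')
  (g : arr y y') (a : cell (aid x · f) m n (aid y · g)) :
  tot (unitl a) = tot a.
Proof. exact: tot_ecast. Qed.

Lemma tot_unitr x y x' y' (f : arr x x') (m : pro x y) (n : pro x' y')
  (g : arr y y') (a : cell (f · aid x') m n (g · aid y')) :
  tot (unitr a) = tot a.
Proof. exact: tot_ecast. Qed.

Lemma tot_pre x y x' y' (f : arr x x') (m m' : pro x y) (n : pro x' y')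
  (g : arr y y') (i : cell (aid x) m m' (aid y)) (a : cell f m' n g) :
  tot (pre i a) = tcomp (tot i) (tot a).
Proof. exact: tot_unitl. Qed.

Lemma tot_post x y x' y' (f : arr x x') (m : pro x y) (n n' : pro x' y')
  (g : arr y y') (a : cell f m n g) (j : cell (aid x') n n' (aid y')) :
  tot (post a j) = tcomp (tot a) (tot j).
Proof. exact: tot_unitr. Qed.

Definition totE := (tot_pre, tot_post, tot_gcomp, tot_unitl, tot_unitr,
  tot_ecast, tot_ccomp).

Section PrePost.
Variables (x y x' y' : E) (f : arr x x') (g : arr y y').

Lemma pre1 (m : pro x y) (n : pro x' y') (a : cell f m n g) : pre (cid m) a = a.
Proof. by apply: tot_eq; rewrite !totE tcomp1l. Qed.

Lemma post1 (m : pro x y) (n : pro x' y') (a : cell f m n g) :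
  post a (cid n) = a.
Proof. by apply: tot_eq; rewrite !totE tcomp1r. Qed.

Lemma pre_pre (m m' m'' : pro x y) (n : pro x' y')
  (i : cell (aid x) m m' (aid y)) (j : cell (aid x) m' m'' (aid y))
  (a : cell f m'' n g) : pre i (pre j a) = pre (gcomp i j) a.
Proof. by apply: tot_eq; rewrite !totE tcompA. Qed.

Lemma post_post (m : pro x y) (n n' n'' : pro x' y') (a : cell f m n g)
  (i : cell (aid x') n n' (aid y')) (j : cell (aid x') n' n'' (aid y')) :
  post (post a i) j = post a (gcomp i j).
Proof. by apply: tot_eq; rewrite !totE tcompA. Qed.

Lemma post_pre (m m' : pro x y) (n n' : pro x' y')
  (i : cell (aid x) m m' (aid y)) (a : cell f m' n g)
  (j : cell (aid x') n n' (aid y')) : post (pre i a) j = pre i (post a j).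
Proof. by apply: tot_eq; rewrite !totE tcompA. Qed.

Lemma pre_inj (m m' : pro x y) (n : pro x' y')
  (i : cell (aid x) m m' (aid y)) (i' : cell (aid x) m' m (aid y))
  (a b : cell f m' n g) : i' ·' i ≈ cid m' -> pre i a = pre i b -> a = b.
Proof.
move=> /ceq_tot e /(congr1 (pre i')); rewrite !pre_pre.
suff -> : gcomp i' i = cid m' by rewrite !pre1.
by apply: tot_eq; rewrite !totE.
Qed.

Lemma post_inj (m : pro x y) (n n' : pro x' y')
  (j : cell (aid x') n n' (aid y')) (j' : cell (aid x') n' n (aid y'))
  (a b : cell f m n g) : j ·' j' ≈ cid n -> post a j = post b j -> a = b.
Proof.
move=> /ceq_tot e /(congr1 (fun c => post c j')); rewrite !post_post.
suff -> : gcomp j j' = cid n by rewrite !post1.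
by apply: tot_eq; rewrite !totE.
Qed.
End PrePost.

Lemma pre_gcomp x y (m n p : pro x y) (i : cell (aid x) m n (aid y))
  (j : cell (aid x) n p (aid y)) : pre i j = gcomp i j.
Proof. by apply: tot_eq; rewrite !totE. Qed.

Lemma post_gcomp x y (m n p : pro x y) (i : cell (aid x) m n (aid y))
  (j : cell (aid x) n p (aid y)) : post i j = gcomp i j.
Proof. by apply: tot_eq; rewrite !totE. Qed.

Lemma gcomp_ceq x y (m n p : pro x y) (i : cell (aid x) m n (aid y))
  (j : cell (aid x) n p (aid y)) : gcomp i j ≈ i ·' j.
Proof. exact: ecastE. Qed.

Section Ccomp.
Variables (x y x' y' x'' y'' : E) (f : arr x x') (f' : arr x' x'')
  (g : arr y y') (g' : arr y' y'').

Lemma pre_ccomp (m m' : pro x y) (n : pro x' y') (p : pro x'' y'')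
  (i : cell (aid x) m m' (aid y)) (a : cell f m' n g) (b : cell f' n p g') :
  pre i a ·' b = pre i (a ·' b).
Proof. by apply: tot_eq; rewrite !totE tcompA. Qed.

Lemma ccomp_post (m : pro x y) (n : pro x' y') (p p' : pro x'' y'')
  (a : cell f m n g) (b : cell f' n p g') (j : cell (aid x'') p p' (aid y'')) :
  a ·' post b j = post (a ·' b) j.
Proof. by apply: tot_eq; rewrite !totE tcompA. Qed.

Lemma post_ccomp (m : pro x y) (n n' : pro x' y') (p : pro x'' y'')
  (a : cell f m n g) (j : cell (aid x') n n' (aid y')) (b : cell f' n' p g') :
  post a j ·' b = a ·' pre j b.
Proof. by apply: tot_eq; rewrite !totE tcompA. Qed.
End Ccomp.

Section Lcomp.
Variables (x y z x' y' z' : E) (f : arr x x') (g : arr y y') (h : arr z z').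

Lemma lcomp_pre (m m' : pro x y) (n n' : pro y z) (p : pro x' y')
  (q : pro y' z') (i : cell (aid x) m m' (aid y))
  (j : cell (aid y) n n' (aid z)) (a : cell f m' p g) (b : cell g n' q h) :
  pre i a ⊙' pre j b = pre (i ⊙' j) (a ⊙' b).
Proof.
apply: tot_eq; rewrite [RHS]tot_pre -tot_ccomp (interchange L).
apply/ceq_tot/ceq_lcomp; exact: ecastE.
Qed.

Lemma lcomp_post (m : pro x y) (n : pro y z) (p p' : pro x' y')
  (q q' : pro y' z') (a : cell f m p g) (b : cell g n q h)
  (i : cell (aid x') p p' (aid y')) (j : cell (aid y') q q' (aid z')) :
  post a i ⊙' post b j = post (a ⊙' b) (i ⊙' j).
Proof.
apply: tot_eq; rewrite [RHS]tot_post -tot_ccomp (interchange L).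
apply/ceq_tot/ceq_lcomp; exact: ecastE.
Qed.

Variables (m : pro x y) (n : pro y z) (p : pro x' y') (q : pro y' z')
  (a : cell f m p g) (b : cell g n q h).

Lemma lcomp_prel (m' : pro x y) (i : cell (aid x) m' m (aid y)) :
  pre i a ⊙' b = pre (i ⊙' cid n) (a ⊙' b).
Proof. by rewrite -{1}[b]pre1 lcomp_pre. Qed.

Lemma lcomp_prer (n' : pro y z) (j : cell (aid y) n' n (aid z)) :
  a ⊙' pre j b = pre (cid m ⊙' j) (a ⊙' b).
Proof. by rewrite -{1}[a]pre1 lcomp_pre. Qed.

Lemma lcomp_postl (p' : pro x' y') (i : cell (aid x') p p' (aid y')) :
  post a i ⊙' b = post (a ⊙' b) (i ⊙' cid q).
Proof. by rewrite -{1}[b]post1 lcomp_post. Qed.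

Lemma lcomp_postr (q' : pro y' z') (j : cell (aid y') q q' (aid z')) :
  a ⊙' post b j = post (a ⊙' b) (cid p ⊙' j).
Proof. by rewrite -{1}[a]post1 lcomp_post. Qed.
End Lcomp.

Lemma ass_post w x y z w' x' y' z'
  (m : pro w x) (n : pro x y) (p : pro y z)
  (m' : pro w' x') (n' : pro x' y') (p' : pro y' z')
  (e : arr w w') (f : arr x x') (g : arr y y') (h : arr z z')
  (a : cell e m m' f) (b : cell f n n' g) (c : cell g p p' h) :
  post ((a ⊙' b) ⊙' c) (ass m' n' p') = pre (ass m n p) (a ⊙' (b ⊙' c)).
Proof. by apply: tot_eq; rewrite !totE tot_ass_nat. Qed.

Lemma lun_post x y x' y' (f : arr x x') (m : pro x y) (n : pro x' y')
  (g : arr y y') (a : cell f m n g) :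
  post (lid f ⊙' a) (lun n) = pre (lun m) a.
Proof. by apply: tot_eq; rewrite !totE tot_lun_nat. Qed.

Lemma run_post x y x' y' (f : arr x x') (m : pro x y) (n : pro x' y')
  (g : arr y y') (a : cell f m n g) :
  post (a ⊙' lid g) (run n) = pre (run m) a.
Proof. by apply: tot_eq; rewrite !totE tot_run_nat. Qed.

Lemma glunK x y (m : pro x y) : gcomp (lun m) (lun_inv m) = cid _.
Proof. by apply: tot_eq; rewrite !totE tot_lunK. Qed.

Lemma glun_invK x y (m : pro x y) : gcomp (lun_inv m) (lun m) = cid _.
Proof. by apply: tot_eq; rewrite !totE tot_lun_invK. Qed.

Lemma grunK x y (m : pro x y) : gcomp (run m) (run_inv m) = cid _.
Proof. by apply: tot_eq; rewrite !totE tot_runK. Qed.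

Lemma grun_invK x y (m : pro x y) : gcomp (run_inv m) (run m) = cid _.
Proof. by apply: tot_eq; rewrite !totE tot_run_invK. Qed.

Lemma gassK w x y z (m : pro w x) (n : pro x y) (p : pro y z) :
  gcomp (ass m n p) (ass_inv m n p) = cid _.
Proof. by apply: tot_eq; rewrite !totE tot_assK. Qed.

Lemma gass_invK w x y z (m : pro w x) (n : pro x y) (p : pro y z) :
  gcomp (ass_inv m n p) (ass m n p) = cid _.
Proof. by apply: tot_eq; rewrite !totE tot_ass_invK. Qed.

(** Kelly's argument on the other side: [ass_lun] is read in [coD E], where left and right unitors
    are exchanged and the associator becomes its inverse. *)
Lemma ass_run x y z (m : pro x y) (n : pro y z) :
  gcomp (ass m n (pid z)) (cid m ⊙' run n) = run (m ⊙ n).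
Proof.
have: gcomp (ass_inv m n (pid z)) (run (m ⊙ n)) = cid m ⊙' run n.
  apply: ceq_eq; apply: ceq_trans (gcomp_ceq _ _) _; apply: co_ceq.
  apply: ceq_trans (eq_ceq (@ass_lun (coD E) z y x n m)).
  exact: (ceq_sym (@ecastE (coD E) _ _ _ _ _ _ _ _ _ _ _ _ _)).
by move=> <-; rewrite gcompA gassK gcomp1l.
Qed.

(* Whiskering by loosely globular cells, which acts strictly. *)
Definition whl x y x' y' (u v : arr x x') (m : pro x y) (n : pro x' y')
    (g : arr y y') (b : cell u (pid x) (pid x') v) (a : cell v m n g) :
    cell u m n g :=
  post (pre (lun_inv m) (b ⊙' a)) (lun n).

Definition whr x y x' y' (f : arr x x') (m : pro x y) (n : pro x' y')
    (u v : arr y y') (a : cell f m n u) (b : cell u (pid y) (pid y') v) :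
    cell f m n v :=
  post (pre (run_inv m) (a ⊙' b)) (run n).

Lemma glcompE x y (u v w : arr x y) (a : cell u (pid x) (pid y) v)
  (b : cell v (pid x) (pid y) w) : glcomp a b = whl a b.
Proof. by apply: tot_eq; rewrite /whl !totE -tcompA. Qed.

Lemma gcomp_inv x y (m n m' n' : pro x y) (i : cell (aid x) m n (aid y))
  (i' : cell (aid x) n m (aid y)) (j : cell (aid x) m' n' (aid y))
  (j' : cell (aid x) n' m' (aid y)) (a : cell (aid x) m m' (aid y))
  (b : cell (aid x) n n' (aid y)) :
  gcomp i' i = cid n -> gcomp j j' = cid m' ->
  gcomp a j = gcomp i b -> gcomp i' a = gcomp b j'.
Proof.
move=> ei ej e; rewrite -[a]gcomp1r -ej 2!gcompA -(gcompA i' a) e.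
by rewrite gcompA ei gcomp1l.
Qed.

Lemma glun_inv_nat x y (m n : pro x y) (a : cell (aid x) m n (aid y)) :
  gcomp (lun_inv m) (cid (pid x) ⊙' a) = gcomp a (lun_inv n).
Proof. exact: gcomp_inv (glun_invK m) (glunK n) (glun_nat a). Qed.

Lemma grun_inv_nat x y (m n : pro x y) (a : cell (aid x) m n (aid y)) :
  gcomp (run_inv m) (a ⊙' cid (pid y)) = gcomp a (run_inv n).
Proof. exact: gcomp_inv (grun_invK m) (grunK n) (grun_nat a). Qed.

Lemma ginv_uniq x y (m n : pro x y) (i : cell (aid x) m n (aid y))
  (j j' : cell (aid x) n m (aid y)) :
  gcomp j i = cid n -> gcomp i j' = cid m -> j = j'.
Proof. by move=> e e'; rewrite -[j]gcomp1r -e' gcompA e gcomp1l. Qed.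

Lemma lcompK x y z (m m' : pro x y) (n n' : pro y z)
  (i : cell (aid x) m m' (aid y)) (i' : cell (aid x) m' m (aid y))
  (j : cell (aid y) n n' (aid z)) (j' : cell (aid y) n' n (aid z)) :
  gcomp i i' = cid m -> gcomp j j' = cid n ->
  gcomp (i ⊙' j) (i' ⊙' j') = cid (m ⊙ n).
Proof. by move=> ei ej; rewrite -gcomp_lcomp ei ej (lcomp_cid L). Qed.

Lemma run_inv_pid x : run_inv (pid x) = lun_inv (pid x).
Proof. by apply: ginv_uniq (grun_invK _) _; rewrite lun_pid glunK. Qed.

Lemma gtriangle_inv x y z (m : pro x y) (n : pro y z) :
  gcomp (cid m ⊙' lun_inv n) (ass_inv m (pid y) n) = run_inv m ⊙' cid n.
Proof.
apply: tot_eq; rewrite tot_gcomp; exact/ceq_tot/(inv_triangle (D := E)).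
Qed.

Lemma ass_lun_inv x y z (m : pro x y) (n : pro y z) :
  gcomp (lun_inv (m ⊙ n)) (ass_inv (pid x) m n) = lun_inv m ⊙' cid n.
Proof.
apply: (@ginv_uniq _ _ _ _ (lun m ⊙' cid n)).
  rewrite -ass_lun -gcompA (gcompA (ass_inv _ _ _)).
  by rewrite gass_invK gcomp1l glun_invK.
by apply: lcompK (glunK m) _; rewrite gcomp1l.
Qed.

Lemma ass_run_inv x y z (m : pro x y) (n : pro y z) :
  gcomp (cid m ⊙' run_inv n) (ass_inv m n (pid z)) = run_inv (m ⊙ n).
Proof.
apply: (@ginv_uniq _ _ _ _ (run (m ⊙ n))); last exact: grunK.
rewrite -ass_run -gcompA (gcompA (ass_inv _ _ _)) gass_invK gcomp1l.
by apply: lcompK (grun_invK n); rewrite gcomp1l.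
Qed.

(** * Whiskering as a strict two-sided action *)

Section WhiskerAction.
Variables (x y x' y' : E).
Implicit Types (u v w : arr x x') (f g h : arr y y').

Lemma whl_lid u g (m : pro x y) (n : pro x' y') (a : cell u m n g) :
  whl (lid u) a = a.
Proof. by rewrite /whl post_pre lun_post pre_pre glun_invK pre1. Qed.

Lemma whr_lid u g (m : pro x y) (n : pro x' y') (a : cell u m n g) :
  whr a (lid g) = a.
Proof. by rewrite /whr post_pre run_post pre_pre grun_invK pre1. Qed.

Lemma whl_pre u v g (m m' : pro x y) (n : pro x' y')
  (b : cell u (pid x) (pid x') v) (i : cell (aid x) m m' (aid y))
  (a : cell v m' n g) : whl b (pre i a) = pre i (whl b a).
Proof. by rewrite /whl lcomp_prer pre_pre glun_inv_nat -pre_pre post_pre. Qed.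

Lemma whr_pre u f g (m m' : pro x y) (n : pro x' y')
  (i : cell (aid x) m m' (aid y)) (a : cell u m' n f)
  (b : cell f (pid y) (pid y') g) : whr (pre i a) b = pre i (whr a b).
Proof. by rewrite /whr lcomp_prel pre_pre grun_inv_nat -pre_pre post_pre. Qed.

Lemma whl_post u v g (m : pro x y) (n n' : pro x' y')
  (b : cell u (pid x) (pid x') v) (a : cell v m n g)
  (j : cell (aid x') n n' (aid y')) : whl b (post a j) = post (whl b a) j.
Proof.
by rewrite /whl lcomp_postr !post_pre !post_post glun_nat.
Qed.

Lemma whr_post u f g (m : pro x y) (n n' : pro x' y') (a : cell u m n f)
  (j : cell (aid x') n n' (aid y')) (b : cell f (pid y) (pid y') g) :
  whr (post a j) b = post (whr a b) j.
Proof.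
by rewrite /whr lcomp_postl !post_pre !post_post grun_nat.
Qed.

Lemma whl_whl u v w g (m : pro x y) (n : pro x' y')
  (b : cell u (pid x) (pid x') v) (b' : cell v (pid x) (pid x') w)
  (a : cell w m n g) : whl b (whl b' a) = whl (glcomp b b') a.
Proof.
rewrite glcompE /whl !(lcomp_postr, lcomp_prer, lcomp_postl, lcomp_prel).
rewrite !(post_pre, pre_pre, post_post).
(* Unitors of loose identities are turned into right unitors, the form in which the triangle exposes
   an associator; naturality then carries it across the cells until it meets its inverse. *)
rewrite -!lun_pid -!run_inv_pid -gtriangle -gtriangle_inv.
rewrite -(gcompA (ass _ _ _)) -(post_post _ (ass _ _ _)) ass_post post_pre !pre_pre.
by rewrite !gcompA -(gcompA _ (ass_inv _ _ _)) gass_invK gcomp1r.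
Qed.

Lemma whr_whr u f g h (m : pro x y) (n : pro x' y') (a : cell u m n f)
  (b : cell f (pid y) (pid y') g) (b' : cell g (pid y) (pid y') h) :
  whr (whr a b) b' = whr a (glcomp b b').
Proof.
rewrite glcompE /whl /whr !(lcomp_postr, lcomp_prer, lcomp_postl, lcomp_prel).
rewrite !(post_pre, pre_pre, post_post) -gtriangle -gtriangle_inv.
rewrite -(gcompA (ass _ _ _)) -(post_post _ (ass _ _ _)) ass_post post_pre.
by rewrite !pre_pre !gcompA -(gcompA _ (ass_inv _ _ _)) gass_invK gcomp1r.
Qed.

Lemma whl_whr u v f g (m : pro x y) (n : pro x' y')
  (b : cell u (pid x) (pid x') v) (a : cell v m n f)
  (b' : cell f (pid y) (pid y') g) : whl b (whr a b') = whr (whl b a) b'.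
Proof.
rewrite /whl /whr !(lcomp_postr, lcomp_prer, lcomp_postl, lcomp_prel).
rewrite !(post_pre, pre_pre, post_post) -ass_lun -ass_lun_inv.
rewrite -(gcompA (ass _ _ _)) -(post_post _ (ass _ _ _)) ass_post post_pre.
rewrite !pre_pre !gcompA -(gcompA _ (ass_inv _ _ _)) gass_invK gcomp1r.
by rewrite glun_inv_nat glun_nat.
Qed.

Lemma whl_whr_glcomp u v w (a : cell u (pid x) (pid x') v)
  (b : cell v (pid x) (pid x') w) : whl a b = whr a b.
Proof. by rewrite /whl /whr !lun_pid run_inv_pid. Qed.

Lemma whl_ccomp x'' y'' u v g (u' v' : arr x' x'') (g' : arr y' y'')
  (m : pro x y) (n : pro x' y') (p : pro x'' y'')
  (b : cell u (pid x) (pid x') v) (a : cell v m n g)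
  (b' : cell u' (pid x') (pid x'') v') (a' : cell v' n p g') :
  whl b a ·' whl b' a' = whl (b ·' b') (a ·' a').
Proof.
rewrite /whl -(interchange L) post_ccomp -!post_pre ccomp_post.
by rewrite !post_pre !pre_pre glunK pre1 pre_ccomp post_pre.
Qed.

Lemma whr_ccomp x'' y'' u f g (u' : arr x' x'') (f' g' : arr y' y'')
  (m : pro x y) (n : pro x' y') (p : pro x'' y'')
  (a : cell u m n f) (b : cell f (pid y) (pid y') g)
  (a' : cell u' n p f') (b' : cell f' (pid y') (pid y'') g') :
  whr a b ·' whr a' b' = whr (a ·' a') (b ·' b').
Proof.
rewrite /whr -(interchange L) post_ccomp -!post_pre ccomp_post.
by rewrite !post_pre !pre_pre grunK pre1 pre_ccomp post_pre.
Qed.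

End WhiskerAction.

Section WhiskerLcomp.
Variables (x y z x' y' z' : E) (m : pro x y) (m' : pro x' y') (n : pro y z)
  (n' : pro y' z').

(** The triangle identity lets a loosely globular cell standing between two columns be absorbed by
    either neighbour. *)
Lemma whr_lcomp (f : arr x x') (g g' : arr y y') (h : arr z z')
  (a : cell f m m' g) (b : cell g (pid y) (pid y') g') (c : cell g' n n' h) :
  whr a b ⊙' c = a ⊙' whl b c.
Proof.
rewrite /whl /whr !(lcomp_postr, lcomp_prer, lcomp_postl, lcomp_prel).
rewrite !post_pre -gtriangle -gtriangle_inv -post_post ass_post.
by rewrite post_pre pre_pre -gcompA gass_invK gcomp1r.
Qed.

Lemma lcomp_whl (f f' : arr x x') (g : arr y y') (h : arr z z')
  (b : cell f (pid x) (pid x') f') (a : cell f' m m' g) (c : cell g n n' h) :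
  whl b a ⊙' c = whl b (a ⊙' c).
Proof.
rewrite /whl !(lcomp_postr, lcomp_prer, lcomp_postl, lcomp_prel).
rewrite !post_pre -ass_lun -ass_lun_inv -post_post ass_post.
by rewrite post_pre pre_pre -gcompA gass_invK gcomp1r.
Qed.

Lemma lcomp_whr (f : arr x x') (g : arr y y') (h h' : arr z z')
  (a : cell f m m' g) (c : cell g n n' h) (b : cell h (pid z) (pid z') h') :
  a ⊙' whr c b = whr (a ⊙' c) b.
Proof.
rewrite /whr !(lcomp_postr, lcomp_prer, lcomp_postl, lcomp_prel).
rewrite !post_pre -ass_run -ass_run_inv -post_post ass_post.
by rewrite post_pre pre_pre -gcompA gass_invK gcomp1r.
Qed.
End WhiskerLcomp.

End Whiskering.

(** * Companions and transposition *)

Section Companions.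
Variable E : doubleCat.
Implicit Types x y z : E.
Let L := dbl_laws E.

Lemma cmp_looseE x y (u : arr x y) (P : companion u) :
  cmp_unit P ⊙' cmp_counit P = gcomp (lun (cmp_pro P)) (run_inv (cmp_pro P)).
Proof.
apply: (post_inj (runK L _)).
rewrite [RHS]post_gcomp -gcompA grun_invK gcomp1r.
by apply: tot_eq; rewrite tot_post; exact: (ceq_tot (cmp_loose P)).
Qed.

Definition id_companion x : companion (aid x).
Proof.
refine (@Companion E x x (aid x) (pid x) (cid (pid x)) (cid (pid x)) _ _).
- apply: ceq_trans (cidl L _) _; exact/eq_ceq/esym/(lid_aid L).
- rewrite (lcomp_cid L) lun_pid; exact: (cidl L).
Defined.

(** Companions compose: these cells make the loose composite of companions a companion of [u · v].
    The top proarrow of F_{f,g} is such a composite, and its transpose is taken along this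
    structure. *)
Definition comp_cmp_unit x y z (u : arr x y) (v : arr y z) (P : companion u)
    (Q : companion v) :
    cell (aid x) (pid x) (cmp_pro P ⊙ cmp_pro Q) (u · v) :=
  ecast (aidl L _) (erefl _)
    (post (cmp_unit P) (run_inv _) ·' (cid (cmp_pro P) ⊙' cmp_unit Q)).

Definition comp_cmp_counit x y z (u : arr x y) (v : arr y z) (P : companion u)
    (Q : companion v) :
    cell (u · v) (cmp_pro P ⊙ cmp_pro Q) (pid z) (aid z) :=
  ecast (erefl _) (aidl L _)
    (post (cmp_counit P ⊙' cid (cmp_pro Q)) (lun _) ·' cmp_counit Q).

Lemma comp_cmp_tight x y z (u : arr x y) (v : arr y z) (P : companion u)
  (Q : companion v) : comp_cmp_unit P Q ·' comp_cmp_counit P Q ≈ lid (u · v).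
Proof.
set p := cmp_pro P; set q := cmp_pro Q.
have e : tcomp (tot (cid p ⊙' cmp_unit Q)) (tot (cmp_counit P ⊙' cid q))
  = tot (cmp_counit P ⊙' cmp_unit Q).
  rewrite -tot_ccomp (interchange L).
  by apply/ceq_tot/ceq_lcomp; [exact: (cidl L)|exact: (cidr L)].
(* Interchange moves the counit of [P] before the unit of [Q]; naturality of the unitors then strips
   the identity columns, and the two tight equations apply one after the other. *)
have e' : tot (cmp_counit P ⊙' cmp_unit Q)
  = tcomp (tot (cmp_counit P ⊙' lid (aid y))) (tot (lid (aid y) ⊙' cmp_unit Q)).
  rewrite -tot_ccomp (interchange L) (lid_aid L).
  by apply/ceq_tot/ceq_sym/ceq_lcomp; [exact: (cidr L)|exact: (cidl L)].
apply: tot_ceq; rewrite !totE -!tcompA (tcompA (tot (cid p ⊙' _))) e e'.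
rewrite -!tcompA (tcompA (tot (lid (aid y) ⊙' _))) tot_lun_nat -lun_pid.
rewrite -!tcompA (tcompA (tot (cmp_counit P ⊙' _))) tot_run_nat !tcompA.
rewrite -(tcompA _ _ (tot (run p))) tot_run_invK tcomp1r.
rewrite -tcompA -!tot_ccomp (ceq_tot (ceq_ccomp (cmp_tight P) (cmp_tight Q))).
by rewrite -(lid_acomp L).
Qed.

Lemma comp_cmp_loose x y z (u : arr x y) (v : arr y z) (P : companion u)
  (Q : companion v) :
  (comp_cmp_unit P Q ⊙' comp_cmp_counit P Q) ·' run _ ≈ lun (cmp_pro P ⊙ cmp_pro Q).
Proof.
set p := cmp_pro P; set q := cmp_pro Q.
(* Interchange splits the composite into a row governed by the loose equation of [P] ([e1]) and one
   governed by that of [Q] ([e2]). Only coherence cells remain, and they cancel through [K]. *)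
have e1 : post (cmp_unit P) (run_inv p) ⊙' post (cmp_counit P ⊙' cid q) (lun q)
  = gcomp (lun (p ⊙ q))
      (gcomp (run_inv p ⊙' cid q)
        (gcomp (ass p (pid y) q) (run_inv p ⊙' lun q))).
  rewrite lcomp_post post_gcomp; set a := _ ⊙' _.
  have -> : a = gcomp (ass_inv _ _ _)
      (gcomp ((cmp_unit P ⊙' cmp_counit P) ⊙' cid q) (ass p (pid y) q)).
    rewrite -[gcomp ((_ ⊙' _) ⊙' _) _]post_gcomp ass_post pre_gcomp gcompA.
    by rewrite gass_invK gcomp1l.
  rewrite cmp_looseE -[cid q in X in X = _]gcomp1l gcomp_lcomp.
  rewrite -ass_lun !gcompA gass_invK gcomp1l.
  by rewrite -!gcompA.
have e2 : (cid p ⊙' cmp_unit Q) ⊙' cmp_counit Q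
  = gcomp (ass p (pid y) q) (gcomp (cid p ⊙' lun q) (run_inv (p ⊙ q))).
  apply: (post_inj (assK L _ _ _)).
  rewrite ass_post pre_gcomp post_gcomp -!gcompA -ass_run_inv cmp_looseE.
  rewrite -[gcomp _ (ass _ _ _)]gcompA gass_invK gcomp1r -gcomp_lcomp.
  by rewrite gcomp1l.
have K : gcomp (run_inv p ⊙' cid q) (gcomp (ass p (pid y) q) (cid p ⊙' lun q))
    = cid (p ⊙ q).
  rewrite gtriangle; apply: lcompK (grun_invK p) _; exact: gcomp1l.
apply: tot_ceq; rewrite tot_ccomp.
rewrite (ceq_tot (ceq_lcomp (ecastE _ _ _) (ecastE _ _ _))).
rewrite -(interchange L) tot_ccomp e1 e2 -!tot_gcomp.
apply: congr1.
have -> : run_inv p ⊙' lun q = gcomp (cid p ⊙' lun q) (run_inv p ⊙' cid q).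
  by rewrite -gcomp_lcomp gcomp1l gcomp1r.
rewrite -!gcompA (gcompA (ass p _ q)) (gcompA (run_inv p ⊙' cid q)) K gcomp1l.
rewrite (gcompA (ass p _ q)) (gcompA (run_inv p ⊙' cid q)) K gcomp1l.
by rewrite grun_invK gcomp1r.
Qed.

Definition comp_companion x y z (u : arr x y) (v : arr y z) (P : companion u)
    (Q : companion v) : companion (u · v) :=
  Companion (comp_cmp_tight P Q) (comp_cmp_loose P Q).

(** Passage between two ways of forgetting boundaries, [tot] for cells of [E] and [tt2] for 2-cells
    of [TwoCat E]; equations of squares are verified by computing in [E]. *)
Lemma tt2_tot x y (u u' v v' : arr x y) (a : cell u (pid x) (pid y) v)
  (b : cell u' (pid x) (pid y) v') :
  tot a = tot b -> @tt2 (TwoCat E) x y u v a = @tt2 (TwoCat E) x y u' v' b.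
Proof.
move=> e; pose F := fun c : tcell (pid x) (pid y) =>
  @tt2 (TwoCat E) x y (projT1 c) (projT1 (projT2 c)) (projT2 (projT2 c)).
exact: (congr1 F e).
Qed.

Lemma tot_lun_inv_nat x y x' y' (f : arr x x') (m : pro x y)
  (n : pro x' y') (g : arr y y') (a : cell f m n g) :
  tcomp (tot (lun_inv m)) (tot (lid f ⊙' a)) = tcomp (tot a) (tot (lun_inv n)).
Proof. exact/esym/(tmove (tot_lun_invK m) (tot_lunK n))/tot_lun_nat. Qed.

Lemma tot_run_inv_nat x y x' y' (f : arr x x') (m : pro x y)
  (n : pro x' y') (g : arr y y') (a : cell f m n g) :
  tcomp (tot (run_inv m)) (tot (a ⊙' lid g)) = tcomp (tot a) (tot (run_inv n)).
Proof. exact/esym/(tmove (tot_run_invK m) (tot_runK n))/tot_run_nat. Qed.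

(* The zigzag of the loose companion equation cancels between the columns. *)
Lemma glcomp_companion x y z w (f : arr x y) (g : arr x z) (r : arr y z)
  (R : companion r) (f' : arr y w) (g' : arr z w)
  (a : cell f (pid x) (cmp_pro R) g) (b : cell f' (cmp_pro R) (pid w) g') :
  tot (glcomp (lid f ·' (cmp_unit R ·' b)) (a ·' (cmp_counit R ·' lid g')))
  = tot (a ·' b).
Proof.
rewrite tot_glcomp -!(interchange L) !tot_ccomp cmp_looseE tot_gcomp.
rewrite -lun_pid -!tcompA tot_run_nat.
rewrite (tcompA (tot (lun_inv _))) tot_lun_inv_nat -!tcompA; congr tcomp.
rewrite (tcompA (tot (lun_inv _))) tot_lun_invK tcomp1l.
by rewrite tcompA tot_run_invK tcomp1l.
Qed.

(* The square u·s => r·v attached to a cell between companions of r and s. *)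
Definition transpose x y x' y' (u : arr x x') (r : arr x y) (s : arr x' y')
    (v : arr y y') (P : companion r) (Q : companion s)
    (a : cell u (cmp_pro P) (cmp_pro Q) v) :
    @cell (Sq (TwoCat E)) x y x' y' u r s v :=
  ecast (aidl L (u · s)) (congr1 (acomp r) (aidr L v))
    (cmp_unit P ·' (a ·' cmp_counit Q)).

Lemma tot_transpose x y x' y' (u : arr x x') (r : arr x y) (s : arr x' y')
  (v : arr y y') (P : companion r) (Q : companion s)
  (a : cell u (cmp_pro P) (cmp_pro Q) v) :
  tot (transpose a : cell (u · s) (pid x) (pid y') (r · v))
  = tcomp (tot (cmp_unit P)) (tcomp (tot a) (tot (cmp_counit Q))).
Proof. exact: tot_ecast. Qed.

(** * Transposition preserves both compositions and the coherence cells *)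

Section Transpose.
Local Notation C := (TwoCat E).

Lemma transpose_ceq x y x' y' (u u' : arr x x') (r : arr x y) (s : arr x' y')
  (v v' : arr y y') (P : companion r) (Q : companion s)
  (a : cell u (cmp_pro P) (cmp_pro Q) v) (b : cell u' (cmp_pro P) (cmp_pro Q) v') :
  a ≈ b -> transpose a ≈ transpose b.
Proof.
case/ceq_inv=> eu [em [en [ev <-]]].
by rewrite (uip em eq_refl) (uip en eq_refl); destruct eu, ev.
Qed.

Lemma transpose_ccomp x y x' y' x'' y'' (u : arr x x') (r : arr x y)
  (s : arr x' y') (v : arr y y') (u' : arr x' x'') (t : arr x'' y'')
  (v' : arr y' y'') (P : companion r) (Q : companion s) (R : companion t)
  (a : cell u (cmp_pro P) (cmp_pro Q) v)
  (b : cell u' (cmp_pro Q) (cmp_pro R) v') :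
  transpose (a ·' b) = transpose a ·' transpose b.
Proof.
apply: (@tt2_inj C); apply: etrans (esym (@tt2_ccomp C _ _ _ _ _ _ _ _ _ _ _ _ _ _ _)).
(* The tight composite of squares is a loose composite of two columns in [E]. Regrouped around [a']
   and [b'], these meet along the companion [Q], whose unit and counit are removed by
   [glcomp_companion]. *)
pose a' : cell u (pid x) _ (r · v) := ecast (aidl L u) erefl (cmp_unit P ·' a).
pose b' : cell (u' · t) _ (pid y'') v' :=
  ecast erefl (aidr L v') (b ·' cmp_counit R).
have -> : H2 (@I2 C _ _ u) (@tt2 C _ _ _ _ (transpose b))
    = @tt2 C _ _ _ _ (lid u ·' (cmp_unit Q ·' b')).
  by apply: tt2_tot; rewrite !tot_ccomp tot_transpose tot_ecast.
have -> : H2 (@tt2 C _ _ _ _ (transpose a)) (@I2 C _ _ v')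
    = @tt2 C _ _ _ _ (a' ·' (cmp_counit Q ·' lid v')).
  by apply: tt2_tot; rewrite !tot_ccomp tot_transpose tot_ecast !tcompA.
apply: etrans (@tt2V C _ _ _ _ _ _ _); apply: tt2_tot.
rewrite [RHS]glcomp_companion tot_transpose !tot_ccomp !tot_ecast.
by rewrite !tot_ccomp !tcompA.
Qed.

Lemma transpose_lcomp x y z x' y' z' (u : arr x x') (v : arr y y')
  (w : arr z z') (r : arr x y) (r' : arr y z) (s : arr x' y') (s' : arr y' z')
  (P : companion r) (P' : companion r') (Q : companion s) (Q' : companion s')
  (a : cell u (cmp_pro P) (cmp_pro Q) v)
  (b : cell v (cmp_pro P') (cmp_pro Q') w) :
  transpose (P := comp_companion P P') (Q := comp_companion Q Q') (a ⊙' b)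
  = transpose a ⊙' transpose b.
Proof.
apply: (@tt2_inj C); apply: etrans (esym (@tt2_lcomp C _ _ _ _ _ _ _ _ _ _ _ _ _ _ _)).
(* Identity cells pad both columns to five rows; interchange then exhibits, row by row, the unit of
   the composite companion, [a ⊙' b], and the counit. *)
have -> : H2 (@tt2 C _ _ _ _ (transpose a)) (@I2 C _ _ s')
    = @tt2 C _ _ _ _
        (cmp_unit P ·' (cid _ ·' (a ·' (cmp_counit Q ·' lid s')))).
  by apply: tt2_tot; rewrite !tot_ccomp tot_transpose tcomp1l !tcompA.
have -> : H2 (@I2 C _ _ r) (@tt2 C _ _ _ _ (transpose b))
    = @tt2 C _ _ _ _
        (lid r ·' (cmp_unit P' ·' (b ·' (cid _ ·' cmp_counit Q')))).
  by apply: tt2_tot; rewrite !tot_ccomp tot_transpose tcomp1l !tcompA.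
apply: etrans (@tt2V C _ _ _ _ _ _ _); apply: tt2_tot; rewrite tot_transpose [RHS]tot_glcomp.
rewrite -!(interchange L) !tot_ccomp /= !tot_ecast !tot_ccomp !tot_post.
rewrite -!tcompA -run_inv_pid (tcompA (tot (run_inv (pid x)))) tot_run_inv_nat.
by rewrite -!tcompA tot_lun_nat.
Qed.

Lemma transpose_lid x y (u : arr x y) :
  transpose (P := id_companion x) (Q := id_companion y) (lid u)
  = @lid (Sq C) x y u.
Proof.
apply: (@tt2_inj C); apply: etrans (esym (tt2_eq2 _)); apply: tt2_tot.
rewrite tot_transpose /= tcomp1l tcomp1r.
by apply: ceq_tot; rewrite [X in _ ≈ lid X](aidr L).
Qed.

(** If [a] carries the unit of [P] to that of [Q], its transpose is unit followed by counit of [Q],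
    an identity by the tight equation. All coherence cells of [Sq] are identities along equalities,
    so matching them only requires comparing units. *)
Lemma transpose_unit x y (r s : arr x y) (P : companion r) (Q : companion s)
  (a : cell (aid x) (cmp_pro P) (cmp_pro Q) (aid y)) (e : aid x · s = r · aid y) :
  tcomp (tot (cmp_unit P)) (tot a) = tot (cmp_unit Q) ->
  transpose a = @eq2 C x y _ _ e.
Proof.
move=> ea; apply: (@tt2_inj C); apply: etrans (esym (tt2_eq2 _)).
apply: tt2_tot; rewrite tot_transpose tcompA ea -tot_ccomp.
rewrite (ceq_tot (cmp_tight Q)); apply: ceq_tot.
by rewrite [X in _ ≈ lid X](aidl L).
Qed.

Lemma transpose_cid x y (r : arr x y) (P : companion r) :
  transpose (P := P) (Q := P) (cid _) = @cid (Sq C) x y r.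
Proof. by apply: transpose_unit; rewrite tcomp1r. Qed.

Lemma tot_comp_unit x y z (r : arr x y) (s : arr y z) (P : companion r)
  (Q : companion s) :
  tot (comp_cmp_unit P Q) = tcomp (tot (cmp_unit P))
    (tcomp (tot (run_inv _)) (tot (cid (cmp_pro P) ⊙' cmp_unit Q))).
Proof. by rewrite !totE tcompA. Qed.

Lemma comp_cmp_unit_ass w x y z (r : arr w x) (s : arr x y) (t : arr y z)
  (P : companion r) (Q : companion s) (R : companion t) :
  tcomp (tot (comp_cmp_unit (comp_companion P Q) R)) (tot (ass _ _ _))
  = tot (comp_cmp_unit P (comp_companion Q R)).
Proof.
set p := cmp_pro P; set q := cmp_pro Q; set k := cmp_pro R.
rewrite !tot_comp_unit /= ?tot_comp_unit -/p -/q.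
have -> : tot (cid p ⊙' comp_cmp_unit Q R) = tcomp (tot (cid p ⊙' cmp_unit Q))
    (tcomp (tot (cid p ⊙' run_inv q)) (tot (cid p ⊙' (cid q ⊙' cmp_unit R)))).
  rewrite (ceq_tot (ceq_lcomp (ceq_sym (cidl L (cid p))) (ecastE _ _ _))).
  by rewrite -(interchange L) tot_ccomp lcomp_postr tot_post tcompA.
have -> : cid p ⊙' run_inv q = gcomp (run_inv (p ⊙ q)) (ass p q (pid y)).
  by rewrite -ass_run_inv -gcompA gass_invK gcomp1r.
by rewrite tot_gcomp -!tcompA -tot_ass_nat (lcomp_cid L).
Qed.

Lemma comp_cmp_unit_lun x y (r : arr x y) (P : companion r) :
  tcomp (tot (comp_cmp_unit (id_companion x) P)) (tot (lun _)) = tot (cmp_unit P).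
Proof.
rewrite tot_comp_unit /= tcomp1l run_inv_pid -(lid_aid L) -tcompA tot_lun_nat.
by rewrite tcompA tot_lun_invK tcomp1l.
Qed.

Lemma comp_cmp_unit_run x y (r : arr x y) (P : companion r) :
  tcomp (tot (comp_cmp_unit P (id_companion y))) (tot (run _)) = tot (cmp_unit P).
Proof.
rewrite tot_comp_unit /= (lcomp_cid L) tcomp1r -tcompA tot_run_invK tcomp1r //.
Qed.

Lemma transpose_ass w x y z (r : arr w x) (s : arr x y) (t : arr y z)
  (P : companion r) (Q : companion s) (R : companion t) :
  transpose (P := comp_companion (comp_companion P Q) R)
    (Q := comp_companion P (comp_companion Q R)) (ass _ _ _)
  = @ass (Sq C) w x y z r s t.
Proof. apply: transpose_unit; exact: comp_cmp_unit_ass. Qed.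

Lemma transpose_lun x y (r : arr x y) (P : companion r) :
  transpose (P := comp_companion (id_companion x) P) (Q := P) (lun _)
  = @lun (Sq C) x y r.
Proof. apply: transpose_unit; exact: comp_cmp_unit_lun. Qed.

Lemma transpose_lun_inv x y (r : arr x y) (P : companion r) :
  transpose (P := P) (Q := comp_companion (id_companion x) P) (lun_inv _)
  = @lun_inv (Sq C) x y r.
Proof.
apply: transpose_unit.
by rewrite -comp_cmp_unit_lun -tcompA tot_lunK tcomp1r.
Qed.

Lemma transpose_run x y (r : arr x y) (P : companion r) :
  transpose (P := comp_companion P (id_companion y)) (Q := P) (run _)
  = @run (Sq C) x y r.
Proof. apply: transpose_unit; exact: comp_cmp_unit_run. Qed.

Lemma transpose_run_inv x y (r : arr x y) (P : companion r) :
  transpose (P := P) (Q := comp_companion P (id_companion y)) (run_inv _)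
  = @run_inv (Sq C) x y r.
Proof.
apply: transpose_unit.
by rewrite -comp_cmp_unit_run -tcompA tot_runK tcomp1r.
Qed.

End Transpose.

End Companions.

(** * Companions in the image of a twisted normal lax functor *)

Section TypedLaws.
Variables (D E : doubleCat) (F : twFunctor D E).

(* F_{f,g} with its codomain transported along [e], so that the laws of F hold
   as plain equations although arrows of D compose strictly only up to [=]. *)
Definition acomp_to (x y z : D) (f : arr x y) (g : arr y z) (h : arr x z)
    (e : f · g = h) :
    cell (aid _) (tw_arr F f ⊙ tw_arr F g) (tw_arr F h) (aid _) :=
  match e with eq_refl => tw_acomp F f g end.

Lemma acomp_toE (x y z : D) (f : arr x y) (g : arr y z) (h : arr x z)
  (e : f · g = h) : acomp_to e ≈ tw_acomp F f g.
Proof. by destruct e. Qed.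

Lemma cell_ccomp (x y x' y' x'' y'' : D)
  (m : pro x y) (n : pro x' y') (p : pro x'' y'')
  (f : arr x x') (f' : arr y y') (g : arr x' x'') (g' : arr y' y'')
  (h : arr x x'') (h' : arr y y'') (e : f · g = h) (e' : f' · g' = h')
  (a : cell f m n f') (b : cell g n p g') (c : cell h m p h') :
  a ·' b ≈ c ->
  post (tw_cell F a ⊙' tw_cell F b) (acomp_to e')
  = pre (acomp_to e) (tw_cell F c).
Proof.
destruct e, e' => /ceq_eq <- /=; apply: tot_eq; rewrite tot_post tot_pre.
exact: (ceq_tot (tw_cell_ccomp F a b)).
Qed.

Lemma cell_cid (x y : D) (m : pro x y) :
  post (lid (tw_pro F m)) (tw_aid F y) = pre (tw_aid F x) (tw_cell F (cid m)).
Proof.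
apply: tot_eq; rewrite tot_post tot_pre; exact: (ceq_tot (tw_cell_cid F m)).
Qed.

Lemma cell_lcomp (x y z x' y' z' : D) (m : pro x y) (m' : pro x' y')
  (n : pro y z) (n' : pro y' z') (f : arr x x') (g : arr y y') (h : arr z z')
  (a : cell f m m' g) (b : cell g n n' h) :
  whr (tw_cell F a ·' tw_cell F b) (tw_pcomp F m' n')
  = whl (tw_pcomp F m n) (tw_cell F (a ⊙' b)).
Proof.
apply: tot_eq; rewrite /whl /whr !tot_post !tot_pre.
exact: (ceq_tot (tw_cell_lcomp F a b)).
Qed.

Lemma cell_lid (x y : D) (f : arr x y) :
  whr (cid (tw_arr F f)) (tw_pid F y) = whl (tw_pid F x) (tw_cell F (lid f)).
Proof.
apply: tot_eq; rewrite /whl /whr !tot_post !tot_pre.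
exact: (ceq_tot (tw_cell_lid F f)).
Qed.

Lemma acomp_to1l (x y : D) (f : arr x y) (e : aid x · f = f) :
  gcomp (tw_aid F x ⊙' cid (tw_arr F f)) (acomp_to e) = lun (tw_arr F f).
Proof.
apply: ceq_eq; apply: ceq_trans (gcomp_ceq _ _) _.
apply: ceq_trans (tw_acomp1l F f); apply: ceq_ccomp (acomp_toE e).
exact: ceq_refl.
Qed.

Lemma acomp_to1r (x y : D) (f : arr x y) (e : f · aid y = f) :
  gcomp (cid (tw_arr F f) ⊙' tw_aid F y) (acomp_to e) = run (tw_arr F f).
Proof.
apply: ceq_eq; apply: ceq_trans (gcomp_ceq _ _) _.
apply: ceq_trans (tw_acomp1r F f); apply: ceq_ccomp (acomp_toE e).
exact: ceq_refl.
Qed.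

Lemma tot_whl_glcomp (x y x' y' : E) (u v w : arr x x') (g : arr y y')
  (m : pro x y) (n : pro x' y') (a : cell u (pid x) (pid x') v)
  (b : cell v (pid x) (pid x') w) (c : cell w m n g) :
  tot (whl (glcomp a b) c)
  = tcomp (tot (lun_inv m)) (tcomp (tot (lun_inv (pid x) ⊙' cid m))
      (tcomp (tot ((a ⊙' b) ⊙' c)) (tcomp (tot (lun (pid x') ⊙' cid n)) (tot (lun n))))).
Proof.
rewrite glcompE /whl lcomp_postl lcomp_prel !totE -!tcompA; congr tcomp.
Qed.

End TypedLaws.

(** Inverses as data: the counit of [im_companion] and the cells of [dual_functor] are built from
    them, while laxness and normality assert mere existence. *)
Record normal_lax (D E : doubleCat) (F : twFunctor D E) := NormalLax {
  pcomp_inv : forall (x y z : D) (m : pro x y) (n : pro y z),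
    cell (tw_pro F (m ⊙ n)) (pid _) (pid _) (tw_pro F m · tw_pro F n);
  pcompK : forall (x y z : D) (m : pro x y) (n : pro y z),
    glcomp (tw_pcomp F m n) (pcomp_inv m n) = lid _;
  pcomp_invK : forall (x y z : D) (m : pro x y) (n : pro y z),
    glcomp (pcomp_inv m n) (tw_pcomp F m n) = lid _;
  pid_inv : forall x : D,
    cell (tw_pro F (pid x)) (pid _) (pid _) (aid (tw_ob F x));
  pidK : forall x : D, glcomp (tw_pid F x) (pid_inv x) = lid _;
  pid_invK : forall x : D, glcomp (pid_inv x) (tw_pid F x) = lid _;
  aid_inv : forall x : D,
    cell (aid _) (tw_arr F (aid x)) (pid (tw_ob F x)) (aid _);
  aidK : forall x : D, gcomp (tw_aid F x) (aid_inv x) = cid _;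
  aid_invK : forall x : D, gcomp (aid_inv x) (tw_aid F x) = cid _
}.

Lemma normal_laxP (D E : doubleCat) (F : twFunctor D E) :
  tw_lax F -> tw_normal F -> inhabited (normal_lax F).
Proof.
move=> [lc li] n.
pose c x y z m n := constructive_indefinite_description _ (lc x y z m n).
pose i x := constructive_indefinite_description _ (li x).
pose a x := constructive_indefinite_description _ (n x).
constructor.
apply: (@NormalLax D E F
  (fun x y z m n => proj1_sig (c x y z m n)) _ _
  (fun x => proj1_sig (i x)) _ _ (fun x => proj1_sig (a x))).
- by move=> x y z p q; case: (proj2_sig (c x y z p q)).
- by move=> x y z p q; case: (proj2_sig (c x y z p q)).
- by move=> x; case: (proj2_sig (i x)).
- by move=> x; case: (proj2_sig (i x)).
- move=> x; case: (proj2_sig (a x)) => e _; apply: ceq_eq.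
  exact: ceq_trans (gcomp_ceq _ _) e.
- move=> x; case: (proj2_sig (a x)) => _ e; apply: ceq_eq.
  exact: ceq_trans (gcomp_ceq _ _) e.
Qed.

Section WhiskerCeq.
Variables (E : doubleCat) (x y x' y' : E) (m : pro x y) (n : pro x' y').

Lemma whl_ceq (u u1 v : arr x x') (f f1 : arr y y')
  (b : cell u (pid x) (pid x') v) (b1 : cell u1 (pid x) (pid x') v)
  (a : cell v m n f) (a1 : cell v m n f1) :
  b ≈ b1 -> a ≈ a1 -> whl b a ≈ whl b1 a1.
Proof.
move=> eb ea; apply: tot_ceq; rewrite /whl !tot_post !tot_pre.
by rewrite (ceq_tot (ceq_lcomp eb ea)).
Qed.

Lemma whr_ceq (u u1 : arr x x') (f g g1 : arr y y')
  (a : cell u m n f) (a1 : cell u1 m n f)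
  (b : cell f (pid y) (pid y') g) (b1 : cell f (pid y) (pid y') g1) :
  a ≈ a1 -> b ≈ b1 -> whr a b ≈ whr a1 b1.
Proof.
move=> ea eb; apply: tot_ceq; rewrite /whr !tot_post !tot_pre.
by rewrite (ceq_tot (ceq_lcomp ea eb)).
Qed.
End WhiskerCeq.

Section NormalLax.
Variables (D E : doubleCat) (F : twFunctor D E) (N : normal_lax F).
Let L := dbl_laws E.
Let LD := dbl_laws D.

(* Normality turns the image of a tightly globular cell into a loosely globular
   one: compose with F_x and with the inverse of F_y. *)
Definition hat (x y : D) (m n : pro x y) (a : cell (aid x) m n (aid y)) :
    cell (tw_pro F m) (pid _) (pid _) (tw_pro F n) :=
  post (pre (tw_aid F x) (tw_cell F a)) (aid_inv N y).

Lemma hat_cid (x y : D) (m : pro x y) : hat (cid m) = lid (tw_pro F m).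
Proof. by rewrite /hat -cell_cid post_post aidK post1. Qed.

Lemma hat_gcomp (x y : D) (m n p : pro x y) (a : cell (aid x) m n (aid y))
  (b : cell (aid x) n p (aid y)) :
  hat (gcomp a b) = glcomp (hat a) (hat b).
Proof.
(* Both facts say that F_z is multiplicative with respect to F_{1,1}; [e1] states it for the inverse
   of F_z. *)
have e1 z : gcomp (aid_inv N z ⊙' aid_inv N z) (lun (pid _))
    = gcomp (acomp_to F (aidl LD (aid z))) (aid_inv N z).
  rewrite -[X in X ⊙' _]gcomp1r -[X in _ ⊙' X]gcomp1l gcomp_lcomp.
  rewrite -gcompA glun_nat -(acomp_to1l F (aidl LD (aid z))).
  rewrite !gcompA -gcomp_lcomp aid_invK gcomp1l (lcomp_cid L) gcomp1l //.
have e2 z : gcomp (lun_inv (pid _)) (gcomp (tw_aid F z ⊙' tw_aid F z)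
    (acomp_to F (aidl LD (aid z)))) = tw_aid F z.
  rewrite -[X in X ⊙' _]gcomp1l -[X in _ ⊙' X]gcomp1r gcomp_lcomp.
  rewrite -gcompA acomp_to1l glun_nat gcompA glun_invK gcomp1l //.
rewrite glcompE /whl /hat lcomp_post lcomp_pre !post_pre !pre_pre post_post e1.
rewrite -post_post.
rewrite (cell_ccomp F (aidl LD _) _ (ceq_sym (gcomp_ceq a b))) post_pre pre_pre.
by rewrite -gcompA e2.
Qed.

(** Removes the paddings [lun2] from a unit law of a twisted functor: the one at the top cancels the
    inverse unitors contained in [whl] and [glcomp], the one at the bottom is already part of
    them. *)
Lemma unit_law (x y : E) (f f1 h g : arr x y) (n : pro y y)
  (X : cell f (pid x) (pid y) h) (X1 : cell f1 (pid x) (pid y) h)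
  (Y : cell h (pid x) (pid y) g) (Z : cell g (pid x) n f)
  (i : cell (aid y) (pid y) n (aid y)) :
  X ≈ X1 -> ((X1 ⊙' Y) ⊙' Z) ·' lun2 n ≈ lun2 (pid x) ·' (lid f ·' i) ->
  tot (whl (glcomp X Y) Z) = tot (post (lid f) i).
Proof.
move=> eX e; rewrite tot_whl_glcomp.
rewrite (ceq_tot (ceq_lcomp (ceq_lcomp eX (ceq_refl Y)) (ceq_refl Z))).
rewrite -tot_ccomp -(tot_ccomp _ (lun2 n)) (ceq_tot e) !tot_ccomp.
have K : tcomp (tot (lun_inv (pid x) ⊙' cid (pid x)))
    (tot (lun (pid x) ⊙' cid (pid x))) = tot (cid _).
  rewrite -tot_ccomp (interchange L).
  by rewrite (ceq_tot (ceq_lcomp (lun_invK L _) (cidl L _))) (lcomp_cid L).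
rewrite -!tcompA (tcompA (tot (lun_inv _ ⊙' _))) K tcomp1l.
by rewrite tcompA tot_lun_invK tcomp1l tot_post.
Qed.

(** With [hat] in place of F on globular cells, the coherence laws of F^{m,n} and F^x become
    equations in [TwoCat E], where loose inverses can be cancelled. *)
Lemma pcomp1l (x y : D) (m : pro x y) :
  glcomp (glcomp (ecast (aidl L _) erefl (tw_pid F x ·' lid (tw_pro F m)))
            (tw_pcomp F (pid x) m)) (hat (lun m)) = lid (tw_pro F m).
Proof.
rewrite glcompE /hat whl_post; apply: (post_inj (j := tw_aid F y)
  (j' := aid_inv N y)); first by rewrite -(aidK N); exact/ceq_sym/gcomp_ceq.
rewrite post_post aid_invK post1; apply: tot_eq.
exact: unit_law (ecastE _ _ _) (tw_pcomp1l F m).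
Qed.

Lemma pcomp1r (x y : D) (m : pro x y) :
  glcomp (glcomp (ecast (aidr L _) erefl (lid (tw_pro F m) ·' tw_pid F y))
            (tw_pcomp F m (pid y))) (hat (run m)) = lid (tw_pro F m).
Proof.
rewrite glcompE /hat whl_post; apply: (post_inj (j := tw_aid F y)
  (j' := aid_inv N y)); first by rewrite -(aidK N); exact/ceq_sym/gcomp_ceq.
rewrite post_post aid_invK post1; apply: tot_eq.
exact: unit_law (ecastE _ _ _) (tw_pcomp1r F m).
Qed.

Lemma pcompA (w x y z : D) (m : pro w x) (n : pro x y) (p : pro y z) :
  glcomp (glcomp (tw_pcomp F m n ·' lid (tw_pro F p)) (tw_pcomp F (m ⊙ n) p))
    (hat (ass m n p))
  ≈ glcomp (lid (tw_pro F m) ·' tw_pcomp F n p) (tw_pcomp F m (n ⊙ p)).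
Proof.
set B := glcomp (lid _ ·' _) _.
have e : whl (glcomp (tw_pcomp F m n ·' lid (tw_pro F p)) (tw_pcomp F (m ⊙ n) p))
      (pre (tw_aid F w) (tw_cell F (ass m n p)))
    ≈ post B (tw_aid F z).
  have -> : post B (tw_aid F z) = whl B (post (lid _) (tw_aid F z)).
    by rewrite whl_post -glcompE glcomp1r.
  by apply: tot_ceq; rewrite !tot_whl_glcomp (ceq_tot (tw_pcompA F m n p)).
apply: tot_ceq; rewrite glcompE /hat whl_post tot_post (ceq_tot e).
by rewrite -tot_post post_post aidK post1.
Qed.

Lemma unit_acomp (x y : D) (f : arr x y) (e : aid x · f = f) :
  gcomp (gcomp (lun_inv _) (tw_aid F x ⊙' cid (tw_arr F f))) (acomp_to F e)
  = cid _.
Proof. by rewrite -gcompA acomp_to1l glun_invK. Qed.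

Lemma acomp_to1l_inv (x y : D) (f : arr x y) (e : aid x · f = f) :
  gcomp (aid_inv N x ⊙' cid (tw_arr F f)) (lun _) = acomp_to F e.
Proof.
rewrite -(acomp_to1l F e) gcompA lcompK ?gcomp1l //; exact: aid_invK.
Qed.

Lemma acomp_to1r_inv (x y : D) (f : arr x y) (e : f · aid y = f) :
  gcomp (cid (tw_arr F f) ⊙' aid_inv N y) (run _) = acomp_to F e.
Proof.
rewrite -(acomp_to1r F e) gcompA lcompK ?gcomp1l //; exact: aid_invK.
Qed.

Lemma whr_cell_lid (x y : D) (f : arr x y) :
  whr (tw_cell F (lid f)) (pid_inv N y) = whl (pid_inv N x) (cid (tw_arr F f)).
Proof.
rewrite -[in LHS](whl_lid (tw_cell F (lid f))) -(pid_invK N) -whl_whl -cell_lid.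
by rewrite -whl_whr whr_whr pidK whr_lid.
Qed.

Lemma whl_cell_lid (x y : D) (f : arr x y) :
  whl (tw_pid F x) (whr (tw_cell F (lid f)) (pid_inv N y)) = cid (tw_arr F f).
Proof. by rewrite whr_cell_lid whl_whl pidK whl_lid. Qed.

Section Companion.
Variables (x y : D) (f : arr x y) (c : companion f).
Local Notation u := (tw_pro F (cmp_pro c)).

Definition im_unit : cell (aid _) (pid _) (tw_arr F f) u :=
  whl (tw_pid F x) (pre (tw_aid F x) (tw_cell F (cmp_unit c))).

(** The comparisons F^x and F_x can simply be attached to the image of the unit; on the image of the
    counit, F^y and F_y point the wrong way, so their inverses are used. *)
Definition im_counit : cell u (tw_arr F f) (pid _) (aid _) :=
  whr (post (tw_cell F (cmp_counit c)) (aid_inv N y)) (pid_inv N y).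

(** Comes from the tight equation of [c]: naturality of the tight-to-loose comparisons merges the
    images of unit and counit into the image of [lid f]. *)
Lemma im_loose : (im_unit ⊙' im_counit) ·' run (tw_arr F f) ≈ lun (tw_arr F f).
Proof.
suff e : post (im_unit ⊙' im_counit) (run (tw_arr F f)) = lun (tw_arr F f).
  by rewrite -e; exact/ceq_sym/ecastE.
apply: (pre_inj (lunK L _)).
rewrite [RHS]pre_gcomp glun_invK /im_unit /im_counit.
rewrite lcomp_whl lcomp_whr -whl_post -whr_post -whl_pre -whr_pre.
rewrite lcomp_prel lcomp_postr post_pre post_post (acomp_to1r_inv (aidr LD f)).
rewrite (cell_ccomp F (aidl LD f) (aidr LD f) (cmp_tight c)).
by rewrite !pre_pre unit_acomp pre1 whl_cell_lid.
Qed.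

(** Comes from the loose equation of [c]: by [eM], the image of the unit followed by that of the
    counit is the image of a composite of unitors, whiskered by a comparison cell and an inverse
    one. The two unit laws reduce this to an identity. *)
Lemma im_tight : im_unit ·' im_counit ≈ lid u.
Proof.
pose k := cmp_pro c.
have eM : tw_cell F (cmp_unit c) ·' tw_cell F (cmp_counit c)
    = whl (tw_pcomp F (pid x) k) (whr (tw_cell F (gcomp (lun k) (run_inv k)))
        (pcomp_inv N k (pid y))).
  rewrite -[LHS]whr_lid -(pcompK N) -whr_whr cell_lcomp cmp_looseE.
  by rewrite whl_whr.
pose A : cell u (pid _) (pid _) _ :=
  ecast (aidl L _) erefl (tw_pid F x ·' lid u).
pose B : cell _ (pid _) (pid _) u :=
  ecast erefl (aidr L _) (lid u ·' pid_inv N y).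
have e : im_unit ·' im_counit
    ≈ glcomp (glcomp (glcomp A (tw_pcomp F (pid x) k))
        (hat (gcomp (lun k) (run_inv k)))) (glcomp (pcomp_inv N k (pid y)) B).
  rewrite -[im_counit]whl_lid -[im_unit]whr_lid /im_unit -whl_whr whl_ccomp.
  rewrite /im_counit whr_ccomp pre_ccomp ccomp_post eM.
  rewrite -whl_post -whl_pre -whr_post -whr_pre -post_pre -/(hat _).
  apply: ceq_trans (whl_ceq (ceq_sym (ecastE (aidl L u) erefl _)) (whr_ceq (ceq_refl _)
    (ceq_sym (ecastE erefl (aidr L u) _)))) _.
  apply: eq_ceq; rewrite -/A -/B -!whl_whr_glcomp -!glcompE !glcompA //.
apply: ceq_trans e _; apply: eq_ceq; rewrite hat_gcomp.
have eB : glcomp (ecast (aidr L _) erefl (lid u ·' tw_pid F y)) B = lid u.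
  apply: ceq_eq; rewrite glcompE.
  apply: ceq_trans (whl_ceq (ecastE _ _ _) (ecastE _ _ _)) _.
  rewrite -glcompE -glcomp_ccomp glcomp1l pidK -(lid_acomp L).
  by rewrite (aidr L u).
(* The left unit law consumes everything up to [hat] of the left unitor. Inserting the right unit
   law as an identity produces [hat (run k)], which cancels the remaining [hat (run_inv k)]. *)
rewrite !glcompA pcomp1l glcomp1l -(glcomp1l (hat _)) -(pcomp1r k).
rewrite -!glcompA (glcompA (hat _) (hat _)) -hat_gcomp grunK hat_cid glcomp1l.
by rewrite (glcompA (tw_pcomp _ _ _)) pcompK glcomp1l eB glcompA pcomp1r.
Qed.

Definition im_companion : companion u := Companion im_tight im_loose.

Variables (z : D) (g : arr y z).

Let counit_g : cell (f · g) (cmp_pro c) (pid z) g :=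
  ecast erefl (aidl LD g) (cmp_counit c ·' lid g).

Let cancel : cell u (tw_arr F (f · g)) (tw_arr F g) (aid _) :=
  whr (tw_cell F counit_g) (pid_inv N z).

(* The inverse of F_{f,g} is the loose composite of the unit of Ff with [cancel];
   no companion of g is needed. *)
Lemma acomp_invertible : tight_invertible (tw_acomp F f g).
Proof.
exists (pre (lun_inv _) (im_unit ⊙' cancel)); split.
- apply: ceq_trans (ceq_sym (gcomp_ceq _ _)) _; apply: eq_ceq.
  (* Since [counit_g] is the counit of [c] followed by [lid g], naturality leaves the counit of Ff
     beside the identity of Fg; the loose companion equation then applies. *)
  have ec : pre (tw_acomp F f g) cancel = post (im_counit ⊙' cid _) (lun _).
    rewrite /cancel -whr_pre.
    rewrite -(cell_ccomp F erefl (aidl LD g) (ceq_sym (ecastE erefl _ _))).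
    rewrite whr_post -lcomp_whr whr_cell_lid -whr_lcomp.
    by rewrite -(acomp_to1l_inv (aidl LD g)) -post_post -lcomp_postl -whr_post.
  rewrite -pre_gcomp pre_pre -glun_inv_nat -pre_pre -lcomp_prer ec.
  have el : im_unit ⊙' im_counit
      = gcomp (lun (tw_arr F f)) (run_inv (tw_arr F f)).
    exact: cmp_looseE im_companion.
  rewrite lcomp_postr; set a := _ ⊙' (_ ⊙' _).
  have -> : a = gcomp (ass_inv _ _ _)
      (gcomp ((im_unit ⊙' im_counit) ⊙' cid (tw_arr F g)) (ass _ _ _)).
    rewrite -[gcomp ((_ ⊙' _) ⊙' _) _]post_gcomp ass_post pre_gcomp gcompA.
    by rewrite gass_invK gcomp1l.
  rewrite el post_gcomp pre_gcomp -!gcompA gtriangle -gcomp_lcomp -!gcompA.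
  rewrite grun_invK gcomp1r gcomp1l -ass_lun (gcompA (ass_inv _ _ _)).
  by rewrite gass_invK gcomp1l glun_invK.
- apply: ceq_trans (ceq_sym (gcomp_ceq _ _)) _; apply: eq_ceq.
  (* In this order F_{f,g} merges the images of [cmp_unit c] and [counit_g] into that of
     [lid (f · g)], by the tight equation of [c]. *)
  have ec : cmp_unit c ·' counit_g ≈ lid (f · g).
    rewrite (lid_acomp LD).
    apply: ceq_trans (ceq_ccomp (ceq_refl _) (ecastE _ _ _)) _.
    apply: ceq_trans (ccompA LD _ _ _) _.
    exact: ceq_ccomp (cmp_tight c) (ceq_refl _).
  rewrite -post_gcomp post_pre /cancel /im_unit lcomp_whl lcomp_whr.
  rewrite -whl_post -whr_post lcomp_prel post_pre.
  rewrite (cell_ccomp F (aidl LD _) erefl ec) -whl_pre -whr_pre !pre_pre.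
  by rewrite unit_acomp pre1 whl_cell_lid.
Qed.

End Companion.

End NormalLax.

(** * The functor to squares *)

Section TransposeCast.
Variable E : doubleCat.
Implicit Types x y z : E.

Lemma transpose_ecast x y x' y' (u u' : arr x x') (r : arr x y) (s : arr x' y')
  (v v' : arr y y') (P : companion r) (Q : companion s) (eu : u = u')
  (ev : v = v') (a : cell u (cmp_pro P) (cmp_pro Q) v) :
  transpose (ecast eu ev a) = @ecast (sq_data (TwoCat E)) _ _ _ _ _ _ _ _ _ _ eu ev (transpose a).
Proof. by destruct eu, ev. Qed.

Lemma transpose_unitl x y x' y' (u : arr x x') (r : arr x y) (s : arr x' y')
  (v : arr y y') (P : companion r) (Q : companion s)
  (a : cell (aid x · u) (cmp_pro P) (cmp_pro Q) (aid y · v)) :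
  transpose (unitl a) = @unitl (Sq (TwoCat E)) _ _ _ _ _ _ _ _ (transpose a).
Proof.
rewrite transpose_ecast /unitl; congr ecast; exact: uip.
Qed.

Lemma transpose_unitr x y x' y' (u : arr x x') (r : arr x y) (s : arr x' y')
  (v : arr y y') (P : companion r) (Q : companion s)
  (a : cell (u · aid x') (cmp_pro P) (cmp_pro Q) (v · aid y')) :
  transpose (unitr a) = @unitr (Sq (TwoCat E)) _ _ _ _ _ _ _ _ (transpose a).
Proof.
rewrite transpose_ecast /unitr; congr ecast; exact: uip.
Qed.

Lemma transpose_glcomp x y (u v w : arr x y) (a : cell u (pid x) (pid y) v)
  (b : cell v (pid x) (pid y) w) :
  transpose (P := id_companion x) (Q := id_companion y) (glcomp a b)
  = @glcomp (Sq (TwoCat E)) x y _ _ _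
      (transpose (P := id_companion x) (Q := id_companion y) a)
      (transpose (P := id_companion x) (Q := id_companion y) b).
Proof.
rewrite transpose_ecast /glcomp.
rewrite (transpose_ccomp (P := id_companion x) (R := id_companion y)
  (Q := comp_companion (id_companion y) (id_companion y))).
rewrite (transpose_ccomp (P := id_companion x)
  (Q := comp_companion (id_companion x) (id_companion x))).
rewrite (transpose_lun_inv (id_companion x)) (transpose_lun (id_companion y)).
rewrite transpose_lcomp; congr ecast; exact: uip.
Qed.

Lemma transpose_tight x y (r s : arr x y) (P : companion r) (Q : companion s)
  (a : cell (aid x) (cmp_pro P) (cmp_pro Q) (aid y)) :
  tight_invertible a ->
  @tight_invertible (Sq (TwoCat E)) x y r s (transpose a).
Proof.
case=> b [ab ba]; exists (transpose b); split.
  rewrite -transpose_ccomp -(transpose_cid P); exact: transpose_ceq.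
rewrite -transpose_ccomp -(transpose_cid Q); exact: transpose_ceq.
Qed.

Lemma transpose_loose x y (u v : arr x y) (a : cell u (pid x) (pid y) v) :
  loose_invertible a ->
  @loose_invertible (Sq (TwoCat E)) x y u v
    (transpose (P := id_companion x) (Q := id_companion y) a).
Proof.
case=> b [ab ba].
exists (transpose (P := id_companion x) (Q := id_companion y) b).
by rewrite -!transpose_glcomp ab ba !transpose_lid.
Qed.

End TransposeCast.

Section SquareFunctor.
Variables (D E : doubleCat) (F : twFunctor D E) (N : normal_lax F)
  (c : has_companions D).
Let LD := dbl_laws D.
Local Notation S := (Sq (TwoCat E)).

Let P (x y : D) (f : arr x y) := im_companion N (c f).
Let I (x : D) := id_companion (tw_ob F x).

Definition sq_base : twBase D S :=
  @TwBase D S (@tw_ob D E F) (fun x y f => @tw_pro D E F x y (cmp_pro (c f)))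
    (@tw_pro D E F).

Let sq_cell' (x y x' y' : D) (f : arr x x') (m : pro x y) (n : pro x' y')
    (g : arr y y') (a : cell f m n g) :
    cell (tw_pro sq_base m) (tw_arr sq_base f) (tw_arr sq_base g)
      (tw_pro sq_base n) :=
  transpose (P := P f) (Q := P g) (tw_cell F a).

Let sq_acomp (x y z : D) (f : arr x y) (g : arr y z) :
    cell (aid (tw_ob sq_base x)) (tw_arr sq_base f ⊙ tw_arr sq_base g)
      (tw_arr sq_base (f · g)) (aid (tw_ob sq_base z)) :=
  transpose (P := comp_companion (P f) (P g)) (Q := P (f · g)) (tw_acomp F f g).

Let sq_aid (x : D) :
    cell (aid (tw_ob sq_base x)) (pid (tw_ob sq_base x))
      (tw_arr sq_base (aid x)) (aid (tw_ob sq_base x)) :=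
  transpose (P := I x) (Q := P (aid x)) (tw_aid F x).

Let sq_pcomp (x y z : D) (m : pro x y) (n : pro y z) :
    cell (tw_pro sq_base m · tw_pro sq_base n) (pid (tw_ob sq_base x))
      (pid (tw_ob sq_base z)) (tw_pro sq_base (m ⊙ n)) :=
  transpose (P := I x) (Q := I z) (tw_pcomp F m n).

Let sq_pid (x : D) :
    cell (aid (tw_ob sq_base x)) (pid (tw_ob sq_base x))
      (pid (tw_ob sq_base x)) (tw_pro sq_base (pid x)) :=
  transpose (P := I x) (Q := I x) (tw_pid F x).

(** The companion at the bottom depends on an arrow of [D], and the two sides of the associativity
    and unit laws have arrows that are equal without being convertible. *)
Let transpose_ceq_to (x y : D) (x' y' : E) (u u' : arr x' (tw_ob F x))
    (r : arr x' y') (v v' : arr y' (tw_ob F y)) (R : companion r)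
    (f f' : arr x y) (a : cell u (cmp_pro R) (tw_arr F f) v)
    (b : cell u' (cmp_pro R) (tw_arr F f') v') :
  f = f' -> a ≈ b ->
  transpose (P := R) (Q := P f) a ≈ transpose (P := R) (Q := P f') b.
Proof.
move=> e; destruct e => h.
exact: (@transpose_ceq E _ _ _ _ _ _ _ _ _ _ R (P f) a b h).
Qed.

Definition sq_functor : twFunctor D S.
Proof.
refine (@TwFunctor D S sq_base sq_cell' sq_acomp sq_aid sq_pcomp sq_pid
  _ _ _ _ _ _ _ _ _ _).
(* For every law, the structure cells of [Sq] are rewritten as transposes and transposition is
   pulled outside, leaving the same law for [F]. *)
- move=> x y x' y' x'' y'' m n p f f' g g' a b.
  rewrite -transpose_lcomp -!transpose_ccomp.
  exact/transpose_ceq/(tw_cell_ccomp F).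
- move=> x y m; rewrite -transpose_lid -!transpose_ccomp.
  exact/transpose_ceq/(tw_cell_cid F).
- move=> x y z x' y' z' m m' n n' f g h a b.
  rewrite -(transpose_run_inv (P f)) -(transpose_run (P h)).
  rewrite -(transpose_lun_inv (P f)) -(transpose_lun (P h)).
  rewrite -!(transpose_ccomp, transpose_lcomp).
  exact/transpose_ceq/(tw_cell_lcomp F).
- move=> x y f.
  rewrite -(transpose_run_inv (P f)) -(transpose_run (P f)).
  rewrite -(transpose_lun_inv (P f)) -(transpose_lun (P f)).
  rewrite -(transpose_cid (P f)).
  rewrite -!(transpose_ccomp, transpose_lcomp).
  exact/transpose_ceq/(tw_cell_lid F).
- move=> w x y z f g h.
  rewrite -(transpose_cid (P f)) -(transpose_cid (P h)).
  rewrite -(transpose_ass (P f) (P g) (P h)).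
  rewrite -!(transpose_ccomp, transpose_lcomp).
  apply: transpose_ceq_to; [exact/esym/(acompA LD)|exact: (tw_acompA F)].
- move=> x y f; rewrite -(transpose_cid (P f)) -(transpose_lun (P f)).
  rewrite -!(transpose_ccomp, transpose_lcomp).
  apply: transpose_ceq_to; [exact: (aidl LD)|exact: (tw_acomp1l F)].
- move=> x y f; rewrite -(transpose_cid (P f)) -(transpose_run (P f)).
  rewrite -!(transpose_ccomp, transpose_lcomp).
  apply: transpose_ceq_to; [exact: (aidr LD)|exact: (tw_acomp1r F)].
- move=> w x y z m n p; rewrite -!transpose_lid.
  rewrite -!(transpose_ccomp, transpose_lcomp) -transpose_unitl -transpose_unitr.
  rewrite -!(transpose_ccomp, transpose_lcomp).
  exact/transpose_ceq/(tw_pcompA F).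
- move=> x y m; rewrite -!transpose_lid /lun2 -(transpose_lun (P (aid y))).
  rewrite -(transpose_lun (I x)) -(transpose_lun (I y)).
  rewrite -(transpose_cid (P (aid y))) -(transpose_cid (I x)).
  rewrite -!(transpose_ccomp, transpose_lcomp) -transpose_unitl.
  rewrite -!(transpose_ccomp, transpose_lcomp).
  exact/transpose_ceq/(tw_pcomp1l F).
- move=> x y m; rewrite -!transpose_lid /lun2 -(transpose_lun (P (aid y))).
  rewrite -(transpose_lun (I x)) -(transpose_lun (I y)).
  rewrite -(transpose_cid (P (aid y))) -(transpose_cid (I x)).
  rewrite -!(transpose_ccomp, transpose_lcomp) -transpose_unitl.
  rewrite -!(transpose_ccomp, transpose_lcomp).
  exact/transpose_ceq/(tw_pcomp1r F).
Defined.

Lemma sq_functor_pseudo : tw_pseudo sq_functor.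
Proof.
split; first split.
- move=> x y z m n; apply: transpose_loose.
  by exists (pcomp_inv N m n); rewrite pcompK pcomp_invK.
- move=> x; apply: transpose_loose.
  by exists (pid_inv N x); rewrite pidK pid_invK.
- move=> x y z f g; apply: transpose_tight. exact: (acomp_invertible N (c f) g).
- move=> x; apply: transpose_tight.
  exists (aid_inv N x); split.
    by rewrite -(aidK N); exact/ceq_sym/gcomp_ceq.
  by rewrite -(aid_invK N); exact/ceq_sym/gcomp_ceq.
Qed.

End SquareFunctor.

(** * The dual functor *)

Section LooseInverses.
Variable E : doubleCat.
Implicit Types x y z : E.

(** Uniqueness of inverses across boundaries that are only propositionally equal; it turns each
    coherence law of F^{m,n} and F^x into one for their inverses. *)
Lemma loose_inv_ceq x y (u v u' v' : arr x y) (a : cell u (pid x) (pid y) v)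
  (b : cell v (pid x) (pid y) u) (a' : cell u' (pid x) (pid y) v')
  (b' : cell v' (pid x) (pid y) u') :
  a ≈ a' -> glcomp b a = lid v -> glcomp a' b' = lid u' -> b ≈ b'.
Proof.
case/ceq_inv=> eu [em [en [ev <-]]].
rewrite (uip em eq_refl) (uip en eq_refl); destruct eu, ev => e e'.
by rewrite -[b]glcomp1r -e' glcompA e glcomp1l.
Qed.

(** Right-bracketed counterpart of [tot_whl_glcomp], with right unitors: reversing proarrows brings
    the laws of a twisted functor into this form. *)
Lemma lcomp_glcomp x y (t u v w : arr x y) (n : pro y y)
  (a : cell t (pid x) (pid y) u) (b : cell u (pid x) (pid y) v)
  (c : cell v (pid x) (pid y) w) (i : cell (aid y) (pid y) n (aid y)) :
  tot (post a i ⊙' (b ⊙' c))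
  = tcomp (tot (gcomp (cid (pid x) ⊙' run (pid x)) (run (pid x))))
      (tcomp (tot (glcomp a (glcomp b c)))
        (tot (gcomp i (gcomp (run_inv n) (cid n ⊙' run_inv (pid y)))))).
Proof.
set k := gcomp _ (run (pid x)).
have -> : gcomp i (gcomp (run_inv n) (cid n ⊙' run_inv (pid y)))
    = gcomp (gcomp (run_inv _) (cid (pid y) ⊙' run_inv (pid y))) (i ⊙' cid _).
  rewrite -gcompA -gcomp_lcomp gcomp1l gcomp1r.
  by rewrite gcompA -grun_inv_nat -gcompA -gcomp_lcomp gcomp1l gcomp1r.
rewrite lcomp_postl tot_post tot_gcomp tcompA tcompA; congr tcomp.
rewrite -tcompA -!(tot_pre, tot_post); congr tot.
rewrite !glcompE /whl !(lcomp_postr, lcomp_prer) !(post_pre, pre_pre, post_post).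
rewrite /k -!lun_pid -!run_inv_pid.
have K z : gcomp (cid (pid z) ⊙' run (pid z)) (gcomp (run (pid z))
    (gcomp (run_inv (pid z)) (cid (pid z) ⊙' run_inv (pid z)))) = cid _.
  rewrite (gcompA (run _)) grunK gcomp1l lcompK ?gcomp1l //; exact: grunK.
by rewrite -!gcompA !K post1 pre1.
Qed.

End LooseInverses.

Lemma co_unitl (E : doubleCat) (x y x' y' : E) (f : arr x x') (m : pro x y)
  (n : pro x' y') (g : arr y y') (a : cell (aid x · f) m n (aid y · g)) :
  (@unitl (coD E) y x y' x' g m n f a : cell f m n g) ≈ unitl a.
Proof.
exact: ceq_trans (co_ceq (@ecastE (coD E) _ _ _ _ _ _ _ _ _ _ _ _ _))
  (ceq_sym (ecastE _ _ _)).
Qed.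

Lemma co_unitr (E : doubleCat) (x y x' y' : E) (f : arr x x') (m : pro x y)
  (n : pro x' y') (g : arr y y') (a : cell (f · aid x') m n (g · aid y')) :
  (@unitr (coD E) y x y' x' g m n f a : cell f m n g) ≈ unitr a.
Proof.
exact: ceq_trans (co_ceq (@ecastE (coD E) _ _ _ _ _ _ _ _ _ _ _ _ _))
  (ceq_sym (ecastE _ _ _)).
Qed.

Section Dual.
Variables (D E : doubleCat) (F : twFunctor D E) (N : normal_lax F).
Let L := dbl_laws E.

Lemma cell_lcomp_inv (x y z x' y' z' : D) (m : pro x y) (m' : pro x' y')
  (n : pro y z) (n' : pro y' z') (f : arr x x') (g : arr y y') (h : arr z z')
  (a : cell f m m' g) (b : cell g n n' h) :
  whl (pcomp_inv N m n) (tw_cell F a ·' tw_cell F b)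
  = whr (tw_cell F (a ⊙' b)) (pcomp_inv N m' n').
Proof.
rewrite -[X in whl _ X]whr_lid -(pcompK N m' n') -whr_whr cell_lcomp.
by rewrite whl_whr whl_whl pcomp_invK whl_lid.
Qed.

Lemma acompA_inv (w x y z : D) (f : arr w x) (g : arr x y) (h : arr y z) :
  (cid (tw_arr F f) ⊙' tw_acomp F g h) ·' tw_acomp F f (g · h)
  ≈ ass_inv (tw_arr F f) (tw_arr F g) (tw_arr F h)
    ·' ((tw_acomp F f g ⊙' cid (tw_arr F h)) ·' tw_acomp F (f · g) h).
Proof.
apply: ceq_sym; apply: ceq_trans (ceq_ccomp (ceq_refl _) (tw_acompA F f g h)) _.
apply: ceq_trans (ccompA L _ _ _) _.
apply: ceq_trans (ceq_ccomp (ass_invK L _ _ _) (ceq_refl _)) _.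
exact: (cidl L).
Qed.

Lemma post_hat (x y : D) (m n : pro x y) (a : cell (aid x) m n (aid y)) :
  post (hat N a) (tw_aid F y) = pre (tw_aid F x) (tw_cell F a).
Proof. by rewrite /hat post_post aid_invK post1. Qed.

Lemma pcompA_inv (w x y z : D) (m : pro w x) (n : pro x y) (p : pro y z) :
  glcomp (hat N (ass_inv m n p))
    (glcomp (pcomp_inv N (m ⊙ n) p) (pcomp_inv N m n ·' lid (tw_pro F p)))
  ≈ glcomp (pcomp_inv N m (n ⊙ p)) (lid (tw_pro F m) ·' pcomp_inv N n p).
Proof.
apply: loose_inv_ceq (pcompA N m n p) _ _.
- rewrite -!glcompA (glcompA (_ ·' _)) -glcomp_ccomp pcomp_invK glcomp1l.
  rewrite -(lid_acomp L) glcomp1l (glcompA (pcomp_inv _ _ _)) pcomp_invK.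
  by rewrite glcomp1l -hat_gcomp gass_invK hat_cid.
- rewrite -!glcompA (glcompA (tw_pcomp _ _ _)) pcompK glcomp1l -glcomp_ccomp.
  by rewrite pcompK glcomp1l -(lid_acomp L).
Qed.

Lemma lcomp_pcompA_inv (w x y z : D) (m : pro w x) (n : pro x y) (p : pro y z)
  (Z : cell (tw_pro F (m ⊙ (n ⊙ p))) (pid _) (tw_arr F (aid z))
         (tw_pro F (m ⊙ n ⊙ p)))
  (Z' : cell (tw_pro F (m ⊙ (n ⊙ p))) (pid _) (tw_arr F (aid z))
          (tw_pro F (m ⊙ (n ⊙ p)))) :
  Z ≈ pre (tw_aid F w) (tw_cell F (ass_inv m n p)) ->
  Z' ≈ post (lid (tw_pro F (m ⊙ (n ⊙ p)))) (tw_aid F z) ->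
  Z ⊙' (pcomp_inv N (m ⊙ n) p ⊙' (pcomp_inv N m n ·' lid (tw_pro F p)))
  ≈ Z' ⊙' (pcomp_inv N m (n ⊙ p) ⊙' (lid (tw_pro F m) ·' pcomp_inv N n p)).
Proof.
move=> /ceq_eq -> /ceq_eq ->; rewrite -post_hat; apply: tot_ceq.
rewrite !lcomp_glcomp glcomp1l; congr (tcomp _ (tcomp _ _)).
exact: ceq_tot (pcompA_inv m n p).
Qed.

Lemma unit_law_inv (x y : E) (f h g g1 : arr x y) (n : pro y y)
  (Z : cell f (pid x) (pid y) h) (Y : cell h (pid x) (pid y) g)
  (X : cell g (pid x) (pid y) g1) (i : cell (aid y) (pid y) n (aid y)) :
  glcomp Z (glcomp Y X) ≈ lid f ->
  (post Z i ⊙' (Y ⊙' X)) ·' ((cid n ⊙' run (pid y)) ·' run n)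
  ≈ ((cid (pid x) ⊙' run (pid x)) ·' run (pid x)) ·' (lid f ·' i).
Proof.
move=> e; have G z (p : pro z y) : tot ((cid p ⊙' run (pid y)) ·' run p)
    = tot (gcomp (cid p ⊙' run (pid y)) (run p)) by rewrite tot_gcomp.
apply: tot_ceq; rewrite tot_ccomp lcomp_glcomp (ceq_tot e) G.
rewrite -!tcompA -tot_gcomp [RHS]tot_ccomp tot_gcomp -tcompA.
rewrite [in RHS](tot_ccomp (cid _ ⊙' _)) -!tcompA; do 2!congr tcomp.
rewrite tot_ccomp; congr tcomp; congr tot; rewrite -!gcompA.
rewrite (gcompA (cid n ⊙' run_inv _)) lcompK ?gcomp1l ?grun_invK ?gcomp1r //.
Qed.

Lemma lcomp_pcomp1l_inv (x y : D) (m : pro x y)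
  (Z : cell (tw_pro F m) (pid _) (tw_arr F (aid y)) (tw_pro F (pid x ⊙ m))) :
  Z ≈ pre (tw_aid F x) (tw_cell F (lun_inv m)) ->
  (Z ⊙' (pcomp_inv N (pid x) m ⊙' (pid_inv N x ·' lid (tw_pro F m))))
    ·' ((cid (tw_arr F (aid y)) ⊙' run (pid _)) ·' run (tw_arr F (aid y)))
  ≈ ((cid (pid _) ⊙' run (pid _)) ·' run (pid _))
    ·' (lid (tw_pro F m) ·' tw_aid F y).
Proof.
move=> /ceq_eq ->; rewrite -post_hat; apply: unit_law_inv.
have e : glcomp (glcomp (tw_pid F x ·' lid (tw_pro F m))
    (tw_pcomp F (pid x) m)) (hat N (lun m)) ≈ lid (tw_pro F m).
  apply: ceq_trans (eq_ceq (pcomp1l N m)); rewrite -!glcompA !glcompE.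
  exact: whl_ceq (ceq_sym (ecastE _ _ _)) (ceq_refl _).
apply: loose_inv_ceq e _ (glcomp1l _).
rewrite -!glcompA (glcompA (_ ·' _)) -glcomp_ccomp pid_invK glcomp1l.
rewrite -(lid_acomp L) glcomp1l (glcompA (pcomp_inv _ _ _)) pcomp_invK.
by rewrite glcomp1l -hat_gcomp glun_invK hat_cid.
Qed.

Lemma lcomp_pcomp1r_inv (x y : D) (m : pro x y)
  (Z : cell (tw_pro F m) (pid _) (tw_arr F (aid y)) (tw_pro F (m ⊙ pid y))) :
  Z ≈ pre (tw_aid F x) (tw_cell F (run_inv m)) ->
  (Z ⊙' (pcomp_inv N m (pid y) ⊙' (lid (tw_pro F m) ·' pid_inv N y)))
    ·' ((cid (tw_arr F (aid y)) ⊙' run (pid _)) ·' run (tw_arr F (aid y)))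
  ≈ ((cid (pid _) ⊙' run (pid _)) ·' run (pid _))
    ·' (lid (tw_pro F m) ·' tw_aid F y).
Proof.
move=> /ceq_eq ->; rewrite -post_hat; apply: unit_law_inv.
have e : glcomp (glcomp (lid (tw_pro F m) ·' tw_pid F y)
    (tw_pcomp F m (pid y))) (hat N (run m)) ≈ lid (tw_pro F m).
  apply: ceq_trans (eq_ceq (pcomp1r N m)); rewrite -!glcompA !glcompE.
  exact: whl_ceq (ceq_sym (ecastE _ _ _)) (ceq_refl _).
apply: loose_inv_ceq e _ (glcomp1l _).
rewrite -!glcompA (glcompA (_ ·' _)) -glcomp_ccomp pid_invK glcomp1l.
rewrite -(lid_acomp L) glcomp1l (glcompA (pcomp_inv _ _ _)) pcomp_invK.
by rewrite glcomp1l -hat_gcomp grun_invK hat_cid.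
Qed.

Definition dual_base : twBase (opD D) (coD E) :=
  @TwBase (opD D) (coD E) (@tw_ob D E F)
    (fun x y (f : @arr D y x) => tw_arr F f) (@tw_pro D E F).

Let dual_cell (x y x' y' : opD D) (f : arr x x') (m : pro x y)
    (n : pro x' y') (g : arr y y') (a : cell f m n g) :
    cell (tw_pro dual_base m) (tw_arr dual_base f) (tw_arr dual_base g)
      (tw_pro dual_base n) :=
  tw_cell F (a : @cell D x' y' x y f n m g).

Let dual_acomp (x y z : opD D) (f : arr x y) (g : arr y z) :
    cell (aid (tw_ob dual_base x)) (tw_arr dual_base f ⊙ tw_arr dual_base g)
      (tw_arr dual_base (f · g)) (aid (tw_ob dual_base z)) :=
  @tw_acomp D E F z y x g f.

Let dual_aid (x : opD D) :
    cell (aid (tw_ob dual_base x)) (pid (tw_ob dual_base x))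
      (tw_arr dual_base (aid x)) (aid (tw_ob dual_base x)) :=
  tw_aid F x.

Let dual_pcomp (x y z : opD D) (m : pro x y) (n : pro y z) :
    cell (tw_pro dual_base m · tw_pro dual_base n) (pid (tw_ob dual_base x))
      (pid (tw_ob dual_base z)) (tw_pro dual_base (m ⊙ n)) :=
  @pcomp_inv D E F N x y z m n.

Let dual_pid (x : opD D) :
    cell (aid (tw_ob dual_base x)) (pid (tw_ob dual_base x))
      (pid (tw_ob dual_base x)) (tw_pro dual_base (pid x)) :=
  pid_inv N x.

(** F_{f,g} and F_x keep their direction, whereas F^{m,n} and F^x are replaced by their inverses;
    laxness is what makes the dual available. *)
Definition dual_functor : twFunctor (opD D) (coD E).
Proof.
refine (@TwFunctor (opD D) (coD E) dual_base dual_cell dual_acomp dual_aid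
  dual_pcomp dual_pid _ _ _ _ _ _ _ _ _ _).
- move=> x y x' y' x'' y'' m n p f f' g g' a b; apply: ceq_co.
  exact: (tw_cell_ccomp F b a).
- by move=> x y m; apply: ceq_co; exact: (tw_cell_cid F m).
- move=> x y z x' y' z' m m' n n' f g h a b; apply: ceq_co; apply: tot_ceq.
  move: (congr1 (@tot _ _ _ _ _ _ _ _ _) (cell_lcomp_inv a b)).
  rewrite /whl /whr !tot_post !tot_pre.
  exact.
- move=> x y f; apply: ceq_co; apply: tot_ceq.
  move: (congr1 (@tot _ _ _ _ _ _ _ _ _) (esym (whr_cell_lid N f))).
  rewrite /whl /whr !tot_post !tot_pre.
  exact.
- move=> w x y z f g h; apply: ceq_co; exact: acompA_inv.
- move=> x y f; apply: ceq_co; exact: (tw_acomp1r F f).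
- move=> x y f; apply: ceq_co; exact: (tw_acomp1l F f).
- move=> w x y z m n p; apply: ceq_co.
  exact: lcomp_pcompA_inv (co_unitl _) (co_unitr _).
- move=> x y m; apply: ceq_co; exact: lcomp_pcomp1l_inv (co_unitl _).
- move=> x y m; apply: ceq_co; exact: lcomp_pcomp1r_inv (co_unitl _).
Defined.

(** In [coD E] loosely globular cells are composed through the right unitors of [E], which agree
    with the left ones at loose identities. *)
Lemma co_glcomp x y (u v w : @arr E x y) (a : cell v (pid x) (pid y) u)
  (b : cell w (pid x) (pid y) v) :
  (@glcomp (coD E) x y u v w a b : cell w (pid x) (pid y) u) = glcomp b a.
Proof.
apply: ceq_eq.
have h := co_ceq (@ecastE (coD E) _ _ _ _ _ _ _ _ _ _
  (etrans (aidr (dbl_laws (coD E)) _) (aidl (dbl_laws (coD E)) u))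
  (etrans (aidr (dbl_laws (coD E)) _) (aidl (dbl_laws (coD E)) w))
  (@lun_inv (coD E) x x (pid x) ·' (@lcomp (coD E) _ _ _ _ _ _ _ _ _ _ _ _ _ a b)
   ·' @lun (coD E) y y (pid y))).
have e : lun_inv (pid x) ·' (b ⊙' a) ·' lun (pid y) ≈ glcomp b a.
  exact: ceq_sym (ecastE _ _ _).
by move: e; rewrite -lun_pid -run_inv_pid => e; exact: ceq_trans h e.
Qed.

Lemma co_gcomp (x y : E) (m n p : @pro E x y) (a : cell (aid x) m n (aid y))
  (b : cell (aid x) n p (aid y)) :
  (@gcomp (coD E) y x m n p a b : cell (aid x) m p (aid y)) = gcomp a b.
Proof.
apply: ceq_eq.
exact: ceq_trans (co_ceq (@ecastE (coD E) _ _ _ _ _ _ _ _ _ _ _ _ _))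
  (ceq_sym (ecastE _ _ _)).
Qed.

Definition dual_normal_lax : normal_lax dual_functor.
Proof.
apply: (@NormalLax (opD D) (coD E) dual_functor (@tw_pcomp D E F) _ _
  (tw_pid F) _ _ (aid_inv N)).
- move=> x y z m n; exact: etrans (co_glcomp _ _) (pcompK N m n).
- move=> x y z m n; exact: etrans (co_glcomp _ _) (pcomp_invK N m n).
- move=> x; exact: etrans (co_glcomp _ _) (pidK N x).
- move=> x; exact: etrans (co_glcomp _ _) (pid_invK N x).
- move=> x; exact: etrans (co_gcomp _ _) (aidK N x).
- move=> x; exact: etrans (co_gcomp _ _) (aid_invK N x).
Defined.

End Dual.

(** * Conjoints as companions in the dual double categories *)

Section Conjoints.
Variable D : doubleCat.

Definition op_companion (x y : D) (f : arr x y) (c : conjoint f) :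
  @companion (opD D) y x f.
Proof.
refine (@Companion (opD D) y x f (cnj_pro c) (cnj_counit c) (cnj_unit c) _ _).
  exact/ceq_op/(cnj_tight c).
apply: ceq_op; apply: tot_ceq; rewrite /= tot_ccomp -[LHS]tcomp1r.
rewrite -(tot_lunK (cnj_pro c)) tcompA -(tcompA (tot (run_inv _))) -tot_ccomp.
rewrite (ceq_tot (cnj_loose c)) tot_run_invK; exact: tcomp1l.
Defined.

Definition conjoint_co (x y : D) (f : arr x y) (c : @companion (coD D) x y f) :
  conjoint f.
Proof.
refine (@Conjoint D x y f (cmp_pro c) (cmp_unit c) (cmp_counit c) _ _).
  exact/co_ceq/(cmp_tight c).
exact/co_ceq/(cmp_loose c).
Defined.

End Conjoints.

(** * The functor to adjunctions *)

Section CompanionConjoint.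
Variables (E : doubleCat) (x y : E) (u : arr x y) (v : arr y x).
Variables (P : companion u) (Q : conjoint v).
Hypothesis e : cnj_pro Q = cmp_pro P.
Let L := dbl_laws E.

Let p := cmp_pro P.
Let ceta : cell v (pid y) p (aid y) :=
  match e in _ = q return cell v (pid y) q (aid y) with
  | eq_refl => cnj_unit Q
  end.
Let ceps : cell (aid x) p (pid x) v :=
  match e in _ = q return cell (aid x) q (pid x) v with
  | eq_refl => cnj_counit Q
  end.

Let cnj_tightE : tcomp (tot ceta) (tot ceps) = tot (lid v).
Proof.
rewrite -tot_ccomp -(ceq_tot (cnj_tight Q)) /ceta /ceps /p.
by case: _ / e.
Qed.

Let cnj_looseE : ceps ⊙' ceta = gcomp (run p) (lun_inv p).
Proof.
have h : post (cnj_counit Q ⊙' cnj_unit Q) (lun _) = run _.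
  by apply: tot_eq; rewrite tot_post; exact: (ceq_tot (cnj_loose Q)).
rewrite /ceta /ceps /p; case: _ / e; apply: (post_inj (lunK L _)).
by rewrite h [RHS]post_gcomp -gcompA glun_invK gcomp1r.
Qed.

Lemma glcomp_conjoint z w (f : arr z x) (g : arr z y) (g' : arr x w)
  (h : arr y w) (a : cell f (pid z) p g) (b : cell g' p (pid w) h) :
  tot (glcomp (a ·' (ceps ·' lid g')) (lid g ·' (ceta ·' b))) = tot (a ·' b).
Proof.
rewrite tot_glcomp -!(interchange L) !tot_ccomp cnj_looseE tot_gcomp.
rewrite -!tcompA tot_lun_nat -run_inv_pid.
rewrite (tcompA (tot (run_inv _))) tot_run_inv_nat -!tcompA; congr tcomp.
rewrite (tcompA (tot (run_inv _))) tot_run_invK tcomp1l.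
by rewrite tcompA tot_lun_invK tcomp1l.
Qed.

(** Adjunction between arrows whose companion and conjoint share the proarrow [p]. In each triangle
    the loose equation of one structure cancels a zigzag and the tight equation of the other leaves
    the identity. *)
Definition companion_conjoint_adj : @isAdj (TwoCat E) x y u v.
Proof.
refine (@IsAdj (TwoCat E) x y u v
  (ecast (aidl L (aid x)) erefl (cmp_unit P ·' ceps))
  (ecast erefl (aidl L (aid y)) (ceta ·' cmp_counit P)) _ _).
- apply: tt2_inj; rewrite !(@tt2E (TwoCat E)).
  set i := ecast _ _ _; set j := ecast _ _ _.
  have -> : H2 (@tt2 (TwoCat E) _ _ _ _ i) (@I2 (TwoCat E) _ _ u)
      = @tt2 (TwoCat E) _ _ _ _ (cmp_unit P ·' (ceps ·' lid u)).
    by apply: tt2_tot; rewrite /i !tot_ccomp tot_ecast !tot_ccomp tcompA.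
  have -> : H2 (@I2 (TwoCat E) _ _ u) (@tt2 (TwoCat E) _ _ _ _ j)
      = @tt2 (TwoCat E) _ _ _ _ (lid u ·' (ceta ·' cmp_counit P)).
    by apply: tt2_tot; rewrite /j !tot_ccomp tot_ecast !tot_ccomp.
  rewrite -(@tt2V (TwoCat E)); apply: tt2_tot.
  by rewrite [LHS]glcomp_conjoint (ceq_tot (cmp_tight P)).
- apply: tt2_inj; rewrite !(@tt2E (TwoCat E)).
  set i := ecast _ _ _; set j := ecast _ _ _.
  have -> : H2 (@I2 (TwoCat E) _ _ v) (@tt2 (TwoCat E) _ _ _ _ i)
      = @tt2 (TwoCat E) _ _ _ _ (lid v ·' (cmp_unit P ·' ceps)).
    by apply: tt2_tot; rewrite /i !tot_ccomp tot_ecast !tot_ccomp.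
  have -> : H2 (@tt2 (TwoCat E) _ _ _ _ j) (@I2 (TwoCat E) _ _ v)
      = @tt2 (TwoCat E) _ _ _ _ (ceta ·' (cmp_counit P ·' lid v)).
    by apply: tt2_tot; rewrite /j !tot_ccomp tot_ecast !tot_ccomp tcompA.
  rewrite -(@tt2V (TwoCat E)); apply: tt2_tot.
  by rewrite [LHS]glcomp_companion tot_ccomp cnj_tightE.
Defined.

End CompanionConjoint.

Lemma ecast_irr (D : dblData) (x y x' y' : D) (f f1 : arr x x') (m : pro x y)
  (n : pro x' y') (g g1 : arr y y') (ef ef' : f = f1) (eg eg' : g = g1)
  (a : cell f m n g) : ecast ef eg a = ecast ef' eg' a.
Proof. by rewrite (uip ef ef') (uip eg eg'). Qed.

(** * Lifting a functor to squares along right adjoints of its arrows *)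

Section AdjointLift.
Variables (C : twoCategory) (D : doubleCat) (G : twFunctor D (Sq C)).
Variable (r : forall x y : D, arr x y -> @hom C (tw_ob G y) (tw_ob G x)).
Variable (A : forall (x y : D) (f : arr x y),
  @isAdj C (tw_ob G x) (tw_ob G y) (tw_arr G f) (r f)).

Let LD := dbl_laws D.

Lemma mates_ceq x y x' y' (f f' : @hom C x x') (m : adjunction x y)
  (n : adjunction x' y') (g g' : @hom C y y') (a : mates f m n g)
  (b : mates f' m n g') :
  @ceq (sq_data C) _ _ _ _ f (ladj m) (ladj n) g (mleft a)
     f' (ladj m) (ladj n) g' (mleft b) ->
  @ceq (adj_data C) _ _ _ _ f m n g a f' m n g' b.
Proof. by move=> h; case/ceq_inv: (h) => ef [_ [_ [eg _]]]; exact: adj_ceq. Qed.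

Lemma mleft_ecast x y x' y' (f f' : @hom C x x') (m : adjunction x y)
  (n : adjunction x' y') (g g' : @hom C y y') (ef : f = f') (eg : g = g')
  (a : mates f m n g) :
  mleft (@ecast (adj_data C) _ _ _ _ _ _ _ _ _ _ ef eg a)
  = @ecast (sq_data C) _ _ _ _ _ _ (ladj m) (ladj n) _ _ ef eg (mleft a).
Proof. by destruct ef, eg. Qed.

Lemma mleft_unitl x y x' y' (f : @hom C x x') (m : adjunction x y)
  (n : adjunction x' y') (g : @hom C y y')
  (a : mates (hid x · f)%two m n (hid y · g)%two) :
  mleft (@unitl (Adj C) _ _ _ _ f m n g a)
  = @unitl (Sq C) _ _ _ _ f (ladj m) (ladj n) g (mleft a).
Proof. rewrite /unitl mleft_ecast; exact: (@ecast_irr (sq_data C)). Qed.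

Lemma mleft_unitr x y x' y' (f : @hom C x x') (m : adjunction x y)
  (n : adjunction x' y') (g : @hom C y y')
  (a : mates (f · hid x')%two m n (g · hid y')%two) :
  mleft (@unitr (Adj C) _ _ _ _ f m n g a)
  = @unitr (Sq C) _ _ _ _ f (ladj m) (ladj n) g (mleft a).
Proof. rewrite /unitr mleft_ecast; exact: (@ecast_irr (sq_data C)). Qed.

Lemma mleft_glcomp x y (u v w : @hom C x y)
  (a : mates u (id_adj x) (id_adj y) v)
  (b : mates v (id_adj x) (id_adj y) w) :
  mleft (@glcomp (Adj C) x y u v w a b)
  = @glcomp (Sq C) x y u v w (mleft a) (mleft b).
Proof. rewrite /glcomp mleft_ecast; exact: (@ecast_irr (sq_data C)). Qed.

Let lift_mates (x y x' y' : C) (f : hom x x') (m : adjunction x y)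
    (n : adjunction x' y') (g : hom y y')
    (s : two (f · ladj n)%two (ladj m · g)%two) : mates f m n g :=
  @Mates C x y x' y' f m n g s _ erefl.

Definition adj_base : twBase D (Adj C) :=
  @TwBase D (Adj C) (@tw_ob D (Sq C) G) (fun x y f => Adjunction (A f))
    (@tw_pro D (Sq C) G).

Let adj_ceq_to (x y : D) (x' y' : C) (f f' : @hom C x' (tw_ob G x))
  (m : adjunction x' y') (h h' : arr x y) (g g' : @hom C y' (tw_ob G y))
  (a : mates f m (Adjunction (A h)) g) (b : mates f' m (Adjunction (A h')) g') :
  h = h' ->
  @ceq (sq_data C) _ _ _ _ f (ladj m) (tw_arr G h) g (mleft a)
     f' (ladj m) (tw_arr G h') g' (mleft b) ->
  @ceq (adj_data C) _ _ _ _ f m (Adjunction (A h)) g a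
    f' m (Adjunction (A h')) g' b.
Proof. by move=> e; destruct e; exact: (@mates_ceq _ _ _ _ f f' m (Adjunction (A h)) g g' a b). Qed.

Definition adj_functor : twFunctor D (Adj C).
Proof.
refine (@TwFunctor D (Adj C) adj_base
  (fun x y x' y' f m n g a =>
     @lift_mates _ _ _ _ _ (Adjunction (A f)) (Adjunction (A g)) _ (tw_cell G a))
  (fun x y z f g => @lift_mates _ _ _ _ _
     (comp_adj (Adjunction (A f)) (Adjunction (A g))) (Adjunction (A (f · g))) _
     (tw_acomp G f g))
  (fun x => @lift_mates _ _ _ _ _ (id_adj _) (Adjunction (A (aid x))) _
     (tw_aid G x))
  (fun x y z m n => @lift_mates _ _ _ _ _ (id_adj _) (id_adj _) _
     (tw_pcomp G m n))
  (fun x => @lift_mates _ _ _ _ _ (id_adj _) (id_adj _) _ (tw_pid G x))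
  _ _ _ _ _ _ _ _ _ _).
(* The left parts of the structure cells of [Adj C] are those of [Sq C] by conversion, so each law
   is the one of [G]; only casts have to be commuted with [mleft]. *)
- move=> *; apply: mates_ceq; exact: (tw_cell_ccomp G).
- move=> *; apply: mates_ceq; exact: (tw_cell_cid G).
- move=> *; apply: mates_ceq; exact: (tw_cell_lcomp G).
- move=> *; apply: mates_ceq; exact: (tw_cell_lid G).
- move=> *; apply: adj_ceq_to; [exact/esym/(acompA LD)|exact: (tw_acompA G)].
- move=> *; apply: adj_ceq_to; [exact: (aidl LD)|exact: (tw_acomp1l G)].
- move=> *; apply: adj_ceq_to; [exact: (aidr LD)|exact: (tw_acomp1r G)].
- move=> *; apply: mates_ceq; rewrite /= mleft_unitl mleft_unitr.
  exact: (tw_pcompA G).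
- move=> *; apply: mates_ceq; rewrite /= mleft_unitl.
  exact: (tw_pcomp1l G).
- move=> *; apply: mates_ceq; rewrite /= mleft_unitl.
  exact: (tw_pcomp1r G).
Defined.

Lemma adj_functor_pseudo : tw_pseudo G -> tw_pseudo adj_functor.
Proof.
have loose x y (u v : @hom C x y) (a : mates u (id_adj x) (id_adj y) v) :
    @loose_invertible (Sq C) x y u v (mleft a) ->
    @loose_invertible (Adj C) x y u v a.
  case=> b [ab ba]; exists (@lift_mates _ _ _ _ _ (id_adj x) (id_adj y) _ b).
  by split; apply: mates_eq; rewrite mleft_glcomp.
have tight x y (m n : @adjunction C x y) (a : mates (hid x) m n (hid y)) :
    @tight_invertible (Sq C) x y (ladj m) (ladj n) (mleft a) ->
    @tight_invertible (Adj C) x y m n a.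
  case=> b [ab ba]; exists (@lift_mates _ _ _ _ _ n m _ b).
  by split; apply: mates_ceq.
move=> [[Gc Gi] Ga G1]; split; first split.
- move=> x y z m n; exact/loose/Gc.
- move=> x; exact/loose/Gi.
- move=> x y z f g; exact/tight/Ga.
- move=> x; exact/tight/G1.
Qed.

End AdjointLift.

Theorem theorem2p23 (D E : doubleCat) (F : twFunctor D E)
    (F_lax : tw_lax F) (F_normal : tw_normal F) :
  (forall c : has_companions D,
    exists G : twFunctor D (Sq (TwoCat E)),
      tw_pseudo G /\
      tw_base G =
        @TwBase D (Sq (TwoCat E))
          (@tw_ob D E F)
          (fun x y f => @tw_pro D E F x y (cmp_pro (c x y f)))
          (@tw_pro D E F)) /\
  (forall c : has_conjoints D,
    exists G : twFunctor (opD D) (Sq (TwoCat (coD E))),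
      tw_pseudo G /\
      tw_base G =
        @TwBase (opD D) (Sq (TwoCat (coD E)))
          (@tw_ob D E F)
          (fun x y (f : @arr D y x) => @tw_pro D E F x y (cnj_pro (c y x f)))
          (@tw_pro D E F)) /\
  (forall (c : has_companions D) (c' : has_conjoints D),
    exists (A : forall (x y : D) (f : @arr D x y),
              @isAdj (TwoCat E) (tw_ob F x) (tw_ob F y)
                (@tw_pro D E F x y (cmp_pro (c x y f)))
                (@tw_pro D E F y x (cnj_pro (c' x y f))))
           (G : twFunctor D (Adj (TwoCat E))),
      tw_pseudo G /\
      tw_base G =
        @TwBase D (Adj (TwoCat E))
          (@tw_ob D E F)
          (fun x y f => Adjunction (A x y f))
          (@tw_pro D E F)).
Proof.
have [N] := normal_laxP F_lax F_normal.
pose N' := dual_normal_lax N.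
split; [move=> c|split=> [c|c c']].
- by exists (sq_functor N c); split; first exact: sq_functor_pseudo.
- pose op_c : has_companions (opD D) := fun x y f => op_companion (c y x f).
  by exists (sq_functor N' op_c); split; first exact: sq_functor_pseudo.
- have A (x y : D) (f : arr x y) : @isAdj (TwoCat E) (tw_ob F x) (tw_ob F y)
      (tw_pro F (cmp_pro (c x y f))) (tw_pro F (cnj_pro (c' x y f))).
    apply: (@companion_conjoint_adj E _ _ _ _ (im_companion N (c x y f))
      (conjoint_co (im_companion N' (op_companion (c' x y f))))).
    (* Both structures live on the proarrow Ff: a companion in [coD E], obtained from the dual
       functor, is a conjoint in [E]. The two proarrows agree by conversion because the
       constructions are transparent. *)
    by [].
  exists A, (@adj_functor (TwoCat E) D (sq_functor N c) _ A); split=> //.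
  exact/adj_functor_pseudo/sq_functor_pseudo.
Qed.
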